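(* Let $g$ be a function which defines an elliptical family on $\mathbb{R}^p$ and satisfies G1, G2 and Gp. Let $\{X_n\}_n$ be a random sample (i.i.d.) taken from the distribution $$\mathbb{P}=(1-\pi_0)\mathbb{P}_{\theta_0}+\pi_0Q$$ in the GEM of the elliptical family defined by $g$, with $0\le\pi_0<1/2$ and $\theta_0\in\Theta$. Let $A$ be an MVE of $\mathbb{P}$, which is assumed to be unique. Let $\{A_n\}_n$ be a sequence of empirical MVE's (MVE's of the empirical distributions $P_n$) and let $\{(\hat\pi_n,\hat\mu_n,\hat\Sigma_n)\}_n$ be a sequence of MLE(s) based on the ellipsoids $\{A_n\}_n$. Then: 1. The MLE(s) based on $\{A_n\}_n$ is strongly consistent, i.e. $(\hat\pi_n,(\hat\mu_n,\hat\Sigma_n))\to(\pi_0,\theta_0)$ almost surely. 2. If $\pi_0=0$, then the MLE(c) based on $\{A_n\}_n$ is strongly consistent, i.e. $\hat\theta_{c,n}\to\theta_0$ almost surely. 3. If $\alpha\in(0,1/2)$, then the MLE(r), $\hat\theta_{r,n}$, based on $\{A_n\}_n$ under the restrictions given by $\Theta^\alpha_{A_n}$ is strongly consistent, i.e. $\hat\theta_{r,n}\to\theta_0$ almost surely. Moreover, if $\hat\pi_n$ is computed from $\hat\theta_{r,n}$ by $\hat\pi_n=\frac{\mathbb{P}_{\hat\theta_{r,n}}(A_n)-P_n(A_n)}{\mathbb{P}_{\hat\theta_{r,n}}(A_n)}$, then also $\hat\pi_n\to\pi_0$ almost surely.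
   Context: $\mathcal{M}^+_{p\times p}$ is the set of positive definite symmetric $p\times p$ matrices and $\Theta=\mathbb{R}^p\times\mathcal{M}^+_{p\times p}$. For $(\mu,\Sigma,r)\in\mathbb{R}^p\times\mathcal{M}^+_{p\times p}\times(0,\infty)$, $\mathcal{E}(\mu,\Sigma,r)=\{x:(x-\mu)^T\Sigma^{-1}(x-\mu)\le r^2\}$; these are the ellipsoids. Elliptical family: for a nonincreasing $g:[0,\infty)\to[0,\infty)$, the family $\{\mathbb{P}_\theta:\theta\in\Theta\}$ of probabilities on $\mathbb{R}^p$ with Lebesgue densities $f_\theta(x)=|\Sigma|^{-1/2}g((x-\mu)^T\Sigma^{-1}(x-\mu))$, $\theta=(\mu,\Sigma)$. Conditions. G1: there is a strictly decreasing sequence $t_k\to0$ with $g(t_k)<g(t_{k+1})$ for every $k$. G2: $g$ is continuous. Gp: if $p>1$, there exists $\gamma>p/2$ with $\lim_{r\to\infty}r^\gamma g(r)=0$. MVE: an ellipsoid $A$ is an MVE (minimum volume ellipsoid) of a probability $\mathbb{P}$ if $\mathbb{P}(A)\ge1/2$ and its volume is minimal among ellipsoids with this property. GEM (gross error model): $\mathbb{P}$ belongs to the GEM of $\{\mathbb{P}_\theta\}$ if $\mathbb{P}=(1-\pi)\mathbb{P}_\theta+\pi Q$ for some $\pi\in[0,1)$, $\theta\in\Theta$ and a probability $Q$ such that $Q(A)=0$ for any MVE $A$ of $\mathbb{P}$ (whence $A$ is also a central part of $\mathbb{P}_\theta$, i.e. of the form $\mathcal{E}(\mu,\Sigma,r)$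 with $(\mu,\Sigma)=\theta$). Estimators based on a set $A$ and the sample $X_1,\dots,X_n$ with empirical distribution $P_n$ ($P_nh=\frac1n\sum_ih(X_i)$; $0\times\infty=0$): - MLE(s): $(\hat\pi_n,\hat\theta_{s,n})$ maximizing over $(\theta,\pi)\in\Theta\times[0,1)$ the function $P_n\big(I_A\log((1-\pi)f_\theta)+I_{A^c}\log((1-\pi)\mathbb{P}_\theta(A^c)+\pi)\big)$. - MLE(c): $\hat\theta_{c,n}$ maximizing over $\theta\in\Theta$ the function $P_n\big(I_A\log f_\theta+I_{A^c}\log\mathbb{P}_\theta(A^c)\big)$. - MLE(r): $\hat\theta_{r,n}$ maximizing $P_n\big(I_A\log(f_\theta/\mathbb{P}_\theta(A))\big)$ over $\Theta_A^\alpha=\{\theta\in\Theta:\mathbb{P}_\theta(A)\ge\alpha\}$. Estimators are considered for $n$ large enough that they exist. *)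

(* Defs.v *)
From HB Require Import structures.
From mathcomp Require Import all_boot all_order all_algebra.
From mathcomp Require Import finmap.
From mathcomp Require Import all_classical all_reals all_analysis.

Set Implicit Arguments.
Unset Strict Implicit.
Unset Printing Implicit Defensive.

Import Order.TTheory GRing.Theory Num.Theory.
Import numFieldTopology.Exports.

Local Open Scope classical_set_scope.
Local Open Scope ring_scope.

(* ['cV[R]_p] carries the sigma-algebra generated by its coordinates, as
   [p.-tuple R] does in the library. *)
Definition measure_col_display : measure_display -> measure_display.
Proof. exact. Qed.

Section measurable_col.
Context {d} {T : sigmaRingType d}.
Variable p : nat.

Let coors : 'I_p -> 'cV[T]_p -> T := fun i v => v i ord0.

Let col_set0 : g_sigma_preimage coors set0.
Proof. exact: sigma_algebra0. Qed.

Let col_setC A : g_sigma_preimage coors A -> g_sigma_preimage coors (~` A).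
Proof. exact: sigma_algebraC. Qed.

Let col_bigcup (F : _^nat) : (forall i, g_sigma_preimage coors (F i)) ->
  g_sigma_preimage coors (\bigcup_i (F i)).
Proof. exact: sigma_algebra_bigcup. Qed.

HB.instance Definition _ := @isMeasurable.Build (measure_col_display d)
  'cV[T]_p (g_sigma_preimage coors) col_set0 col_setC col_bigcup.

End measurable_col.

Lemma measurable_coord d (T : sigmaRingType d) p (i : 'I_p) :
  measurable_fun [set: 'cV[T]_p] (fun v => v i ord0).
Proof.
move=> _ Y mY; rewrite setTI; apply: sub_sigma_algebra => /=.
rewrite -bigcup_seq/=; exists i => /=; first by rewrite mem_index_enum.
by exists Y => //; rewrite setTI.
Qed.

Lemma measurable_fun_colP d1 d2 (T1 : measurableType d1) (T2 : measurableType d2)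
    p (f : T1 -> 'cV[T2]_p) :
  (forall i, measurable_fun [set: T1] (fun x => f x i ord0)) ->
  measurable_fun [set: T1] f.
Proof.
move=> mf _ A mA.
suff : g_sigma_preimage (fun (i : 'I_p) (v : 'cV[T2]_p) => v i ord0) `<=`
    [set B | measurable (f @^-1` B)].
  by move=> /(_ A mA) /=; rewrite setTI.
apply: smallest_sub.
  split => /=.
  - by rewrite preimage_set0.
  - by move=> B mB; rewrite setTD preimage_setC; exact: measurableC.
  - by move=> F mF; rewrite preimage_bigcup; exact: bigcup_measurable.
rewrite -bigcup_seq; apply: bigcup_sub => i _ B [C mC <-] /=.
by rewrite setTI -[X in measurable X]setTI; exact: mf.
Qed.

Section lebesgue_col.
Variable R : realType.

Definition col_cons p (z : 'cV[R]_p * measurableTypeR R) : 'cV[R]_p.+1 :=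
  col_mx (const_mx z.2 : 'cV_1) z.1.

Lemma col_cons0 p z : @col_cons p z ord0 ord0 = z.2.
Proof. by rewrite /col_cons mxE; case: splitP => // j _; rewrite mxE. Qed.

Lemma col_consS p z j : @col_cons p z (lift ord0 j) ord0 = z.1 j ord0.
Proof.
rewrite /col_cons mxE; case: splitP => [k|k /= [/val_inj ->]//].
by rewrite (ord1 k).
Qed.

Lemma measurable_col_cons p : measurable_fun setT (@col_cons p).
Proof.
apply: measurable_fun_colP => i; have [j|] := unliftP ord0 i => ->.
  under eq_fun do rewrite col_consS.
  apply: (measurableT_comp (f := fun v : 'cV[R]_p => v j ord0)) => //.
  exact: measurable_coord.
by under eq_fun do rewrite col_cons0; exact: measurable_snd.
Qed.

HB.instance Definition _ p := isMeasurableFun.Build _ _ _ _ (@col_cons p)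
  (@measurable_col_cons p).

Section lebesgue_col_step.
Local Open Scope ereal_scope.
Variables (p : nat) (m : {measure set 'cV[R]_p -> \bar R}).

Definition lebesgue_col_step : set 'cV[R]_p.+1 -> \bar R :=
  pushforward (m \x @lebesgue_measure R) (@col_cons p).

Let step0 : lebesgue_col_step set0 = 0.
Proof. exact: measure0. Qed.

Let step_ge0 A : 0 <= lebesgue_col_step A.
Proof. exact: measure_ge0. Qed.

Let step_sigma_additive : semi_sigma_additive lebesgue_col_step.
Proof.
exact: measure_semi_sigma_additive.
Qed.

HB.instance Definition _ := isMeasure.Build _ _ _ lebesgue_col_step
  step0 step_ge0 step_sigma_additive.

End lebesgue_col_step.

(* Lebesgue measure on R^p, as the p-fold product of Lebesgue measure on R. *)
Fixpoint lebesgue_col p : {measure set 'cV[R]_p -> \bar R} :=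
  match p with
  | 0 => dirac (0 : 'cV[R]_0)
  | q.+1 => lebesgue_col_step (lebesgue_col q)
  end.

Lemma lebesgue_col_box p (B : 'I_p -> set (measurableTypeR R)) :
  (forall i, measurable (B i)) ->
  lebesgue_col p [set v | forall i, B i (v i ord0)] =
  (\prod_(i < p) lebesgue_measure (B i))%E.
Proof.
elim: p B => [|p IHp] B mB.
  by rewrite big_ord0 /= diracE mem_set// => -[].
rewrite big_ord_recl /= /lebesgue_col_step /pushforward muleC.
rewrite (_ : _ @^-1` _ =
  [set v : 'cV[R]_p | forall j, B (lift ord0 j) (v j ord0)] `*` B ord0).
  rewrite product_measure1E//; first by rewrite -IHp.
  rewrite (_ : [set _ | _] =
      \bigcap_(j in [set: 'I_p]) (fun v : 'cV[R]_p => v j ord0) @^-1`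
        B (lift ord0 j)).
    apply: fin_bigcap_measurable => // j _.
    by rewrite -[X in measurable X]setTI; apply: measurable_coord => //; exact: mB.
  by apply/seteqP; split => v /= h j; [move=> _|]; exact: h.
apply/seteqP; split => -[v x] /=.
- move=> h; split=> [j|].
    by move: (h (lift ord0 j)); rewrite col_consS.
  by move: (h ord0); rewrite col_cons0.
- move=> [hv hx] i; have [j|] := unliftP ord0 i => ->.
    by rewrite col_consS; exact: hv.
  by rewrite col_cons0.
Qed.

End lebesgue_col.

Section parameters.
Variables (R : realType) (p : nat).
Implicit Types (mu x : 'cV[R]_p) (S : 'M[R]_p).

Definition posdefmx S :=
  S^T = S /\ forall x, x != 0 -> 0 < (x^T *m S *m x) ord0 ord0.

(* A parameter theta = (mu, Sigma) is a pair; [Theta] is R^p x M^+_{p x p}. *)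
Definition Theta : set ('cV[R]_p * 'M[R]_p) := [set th | posdefmx th.2].

Definition qform mu S x : R := ((x - mu)^T *m invmx S *m (x - mu)) ord0 ord0.

Definition ellipsoid mu S (r : R) : set 'cV[R]_p :=
  [set x | qform mu S x <= r ^+ 2].

Definition is_ellipsoid (A : set 'cV[R]_p) :=
  exists mu S r, [/\ posdefmx S, 0 < r & A = ellipsoid mu S r].

Local Open Scope ereal_scope.

Definition is_mve (P : set 'cV[R]_p -> \bar R) (A : set 'cV[R]_p) :=
  [/\ is_ellipsoid A, (2^-1)%:E <= P A &
      forall B, is_ellipsoid B -> (2^-1)%:E <= P B ->
        lebesgue_col R p A <= lebesgue_col R p B].

End parameters.
Arguments Theta : clear implicits.

(* The generator g : [0, +oo) -> [0, +oo) is a total function R -> R of which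
   only the values on [0, +oo) matter. *)
Section elliptical_family.
Variables (R : realType) (p : nat) (g : R -> R).
Implicit Types (th : 'cV[R]_p * 'M[R]_p) (A : set 'cV[R]_p).

Definition elliptical_pdf th (x : 'cV[R]_p) : R :=
  (Num.sqrt (\det th.2))^-1 * g (qform th.1 th.2 x).

Definition elliptical_prob th A : \bar R :=
  (\int[lebesgue_col R p]_(x in A) (elliptical_pdf th x)%:E)%E.

Definition elliptical_generator :=
  [/\ forall t, 0 <= t -> 0 <= g t,
      forall s t, 0 <= s -> s <= t -> g t <= g s &
      forall th, Theta R p th -> elliptical_prob th setT = 1%E].

Definition condG1 := exists t : nat -> R,
  [/\ forall k, t k.+1 < t k, t @ \oo --> 0 & forall k, g (t k) < g (t k.+1)].

Definition condG2 := {within `[0, +oo[, continuous g}.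

Definition condGp := (1 < p)%N ->
  exists2 gamma : R, p%:R / 2 < gamma &
    r `^ gamma * g r @[r --> +oo] --> 0.

(* P = (1 - pi) P_theta + pi Q is a decomposition witnessing that P belongs to
   the gross error model. *)
Definition gross_error_model (P : probability 'cV[R]_p R) (pi0 : R) th
    (Q : probability 'cV[R]_p R) :=
  [/\ 0 <= pi0 < 1, Theta R p th,
      forall B, measurable B ->
        P B = ((1 - pi0)%:E * elliptical_prob th B + pi0%:E * Q B)%E &
      forall A, is_mve P A -> Q A = 0%E].

End elliptical_family.

Section estimators.
Variables (R : realType) (p : nat) (g : R -> R).
(* Only the first n terms of the sequence of observations x are used. *)
Variables (x : nat -> 'cV[R]_p) (n : nat).
Implicit Types (th : 'cV[R]_p * 'M[R]_p) (A : set 'cV[R]_p).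
Local Open Scope ereal_scope.

Local Notation "'f_ th" := (@elliptical_pdf R p g th)
  (at level 0, th at level 2).
Local Notation "'P_ th" := (@elliptical_prob R p g th)
  (at level 0, th at level 2).

Definition emp_mean (h : 'cV[R]_p -> \bar R) : \bar R :=
  (n%:R^-1)%:E * \sum_(i < n) h (x i).

Definition emp_prob A : \bar R := emp_mean (fun y => (\1_A y)%:E).

(* In the three criteria log is [lne], so that log 0 = -oo, and 0 * -oo = 0. *)
Definition lik_s A (pi : R) th : \bar R :=
  emp_mean (fun y =>
    (\1_A y)%:E * lne ((1 - pi)%:E * ('f_th y)%:E) +
    (\1_(~` A) y)%:E * lne ((1 - pi)%:E * 'P_th (~` A) + pi%:E)).

Definition lik_c A th : \bar R :=
  emp_mean (fun y =>
    (\1_A y)%:E * lne ('f_th y)%:E +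
    (\1_(~` A) y)%:E * lne ('P_th (~` A))).

Definition lik_r A th : \bar R :=
  emp_mean (fun y => (\1_A y)%:E * lne (('f_th y)%:E / 'P_th A)).

Definition is_MLEs A (pi : R) th :=
  [/\ (0 <= pi < 1)%R, Theta R p th &
      forall pi' th', (0 <= pi' < 1)%R -> Theta R p th' ->
        lik_s A pi' th' <= lik_s A pi th].

Definition is_MLEc A th :=
  Theta R p th /\ forall th', Theta R p th' -> lik_c A th' <= lik_c A th.

Definition Theta_ge A (alpha : R) : set ('cV[R]_p * 'M[R]_p) :=
  [set th | Theta R p th /\ alpha%:E <= 'P_th A].

Definition is_MLEr A (alpha : R) th :=
  Theta_ge A alpha th /\
  forall th', Theta_ge A alpha th' -> lik_r A th' <= lik_r A th.

End estimators.

Section random_sample.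
Context d (T : measurableType d) (R : realType) (Pr : probability T R).
Context d' (U : measurableType d').

Definition mutually_independent (X : nat -> {RV Pr >-> U}) :=
  forall (J : {fset nat}) (B : nat -> set U),
    (forall j, measurable (B j)) ->
    Pr (\bigcap_(j in [set` J]) X j @^-1` B j) =
    (\prod_(j <- J) Pr (X j @^-1` B j))%E.

Definition random_sample (P : probability U R) (X : nat -> {RV Pr >-> U}) :=
  mutually_independent X /\
  forall i B, measurable B -> distribution Pr (X i) B = P B.

End random_sample.

(* Main.v *)
Require Import Defs.
From HB Require Import structures.
From mathcomp Require Import all_boot all_order all_algebra.
From mathcomp Require Import finmap.
From mathcomp Require Import all_classical all_reals all_analysis.
From mathcomp Require Import perm measurable_realfun.
From mathcomp Require Import ring lra.

Set Implicit Arguments.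
Unset Strict Implicit.
Unset Printing Implicit Defensive.

Import Order.TTheory GRing.Theory Num.Theory.
Import numFieldTopology.Exports.

Local Open Scope classical_set_scope.
Local Open Scope ring_scope.

(** Once the strong law has given limsup P_n(C) <= P(C) for every closed C almost
    surely, the argument is deterministic, and all limits are taken along an
    arbitrary ultrafilter finer than \oo, so that bounded sequences converge.

    Since Q(A) = 0, the MVE A is an ellipsoid {q0 <= t0} central for P_theta0 and
    P(A) = 1/2. A thin slab has limiting empirical mass at most pi0 < 1/2, so the
    empirical MVEs cannot flatten; their limit is an MVE of P, hence A.

    For each estimator, the product over the sample of v, equal to c f_theta on A_n
    and to a constant b off A_n, of total mass c P_theta(A_n) + b = 1, is at least
    the product for theta0. A maximizer can exist for one sample only if g decays
    like r^-gamma with gamma > p/2: otherwise the criterion blows up along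
    parameters shrinking to an observation. With this decay, large precision
    matrices are too costly outside slabs, and the estimates stay in a compact set.

    By the AM-GM inequality the empirical mean of sqrt (v / v0) is at least 1. In
    the limit this says that the Hellinger distance between c' f_theta' and
    (1 - pi0) f_theta0 on A vanishes. By G1, 0 is the only maximizer of g, so that
    both densities have the same center; along each ray g (rho t) = g t for small
    t, which forces rho = 1. *)

(** * Quadratic forms *)

(** All three criteria take one form, given by theta and a pair (c, b): (1 - pi, (1 - pi)
    P_theta(A_n^c) + pi) for the MLE(s), (1, P_theta(A_n^c)) for the MLE(c), and (1 / (2
    P_theta(A_n)), 1/2) for the MLE(r), whose criterion is rescaled by 1/2. At theta0 the pair has
    to tend to (1 - pi0, 1/2): this is where pi0 = 0 enters for the MLE(c), and alpha < 1/2 makes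
    theta0 admissible for the MLE(r), since P_theta0(A_n) tends to 1 / (2 (1 - pi0)) >= 1/2.

    The averaged functions depend on n through A_n and the estimates, so the strong law does not
    apply to them directly. They converge uniformly on boxes, and the mean of the limit function is
    cut into finitely many layers carried by closed superlevel sets. Closed sets give upper bounds
    only, and this is enough because AM-GM supplies the lower bound.

    Lebesgue measure is transported by dilations and translations alone. That volumes of ellipsoids
    are proportional to sqrt (det Sigma) is read off the fact that all densities of the family
    integrate to 1. *)

Section bilinear_forms.
Variables (R : realType) (p : nat).
Implicit Types (M S : 'M[R]_p) (u v x y mu : 'cV[R]_p).

Definition bform M u v : R := (u^T *m M *m v) ord0 ord0.
Definition qf M y : R := bform M y y.

Lemma bformDl M u v y : bform M (u + v) y = bform M u y + bform M v y.
Proof. by rewrite /bform linearD !mulmxDl mxE. Qed.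

Lemma bformDr M u v y : bform M y (u + v) = bform M y u + bform M y v.
Proof. by rewrite /bform mulmxDr mxE. Qed.

Lemma bformZl M a u v : bform M (a *: u) v = a * bform M u v.
Proof. by rewrite /bform linearZ /= -!scalemxAl mxE. Qed.

Lemma bformZr M a u v : bform M u (a *: v) = a * bform M u v.
Proof. by rewrite /bform -scalemxAr mxE. Qed.

Lemma bformC M u v : M^T = M -> bform M u v = bform M v u.
Proof.
move=> sM; rewrite /bform -[in LHS](trmxK (u^T *m M *m v)) mxE.
by rewrite !trmx_mul trmxK sM mulmxA.
Qed.

Lemma qfZ M a y : qf M (a *: y) = a ^+ 2 * qf M y.
Proof. by rewrite /qf bformZl bformZr mulrA expr2. Qed.

Lemma qfN M y : qf M (- y) = qf M y.
Proof. by rewrite -scaleN1r qfZ sqrrN expr1n mul1r. Qed.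

Lemma qfZl M a y : qf (a *: M) y = a * qf M y.
Proof. by rewrite /qf /bform -scalemxAr -scalemxAl mxE. Qed.

Lemma qf0 M : qf M 0 = 0.
Proof. by rewrite /qf /bform mulmx0 mxE. Qed.

Lemma qfE M y : qf M y = \sum_i \sum_j y j ord0 * M j i * y i ord0.
Proof.
rewrite /qf /bform mxE; apply: eq_bigr => i _; rewrite mxE big_distrl /=.
by apply: eq_bigr => j _; rewrite mxE.
Qed.

Lemma bform_delta M i y :
  bform M (delta_mx i ord0) y = \sum_j M i j * y j ord0.
Proof.
rewrite /bform trmx_delta -rowE mxE; apply: eq_bigr => j _; by rewrite mxE.
Qed.

Lemma bform_delta2 M i j : bform M (delta_mx i ord0) (delta_mx j ord0) = M i j.
Proof.
rewrite bform_delta (bigD1 j) //= mxE !eqxx mulr1 big1 ?addr0// => k kj.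
by rewrite mxE (negbTE kj) mulr0.
Qed.

Lemma qfD M u v : M^T = M -> qf M (u + v) = qf M u + 2 * bform M u v + qf M v.
Proof.
by move=> sM; rewrite /qf bformDl !bformDr (bformC v u sM); ring.
Qed.

Section psd.
Variable M : 'M[R]_p.
Hypotheses (sM : M^T = M) (M0 : forall y, 0 <= qf M y).

Lemma bform_CS u v : bform M u v ^+ 2 <= qf M u * qf M v.
Proof.
have pol a b : 0 <= a ^+ 2 * qf M u + 2 * (a * b * bform M u v) + b ^+ 2 * qf M v.
  by have := M0 (a *: u + b *: v); rewrite qfD// !qfZ bformZl bformZr !mulrA.
(* The form is only semidefinite. If it vanishes at v, [pol] is evaluated where it is a negative
   multiple of [bform M u v ^+ 2], which must then be 0. *)
have [v0|v0] := eqVneq (qf M v) 0.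
  rewrite v0 mulr0.
  have [//|u0] := eqVneq (qf M u) 0.
    have := pol 1 (- bform M u v); rewrite v0; nra.
  have := pol (bform M u v) (- qf M u); rewrite v0.
  have := M0 u; nra.
have {}v0 : 0 < qf M v by rewrite lt_def v0 M0.
have := pol (qf M v) (- bform M u v).
rewrite (_ : _ + _ = qf M v * (qf M u * qf M v - bform M u v ^+ 2)); last by ring.
by rewrite pmulr_rge0// subr_ge0.
Qed.

Lemma psd_diag i : 0 <= M i i.
Proof. by have := M0 (delta_mx i ord0); rewrite /qf bform_delta2. Qed.

Lemma psd_offdiag i j : M i j ^+ 2 <= M i i * M j j.
Proof.
have := bform_CS (delta_mx i ord0) (delta_mx j ord0).
by rewrite /qf !bform_delta2.
Qed.

Lemma psd_entry m i j : (forall k, M k k <= m) -> `|M i j| <= m.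
Proof.
move=> Mm; have m0 : 0 <= m := le_trans (psd_diag i) (Mm i).
rewrite -ler_sqr ?nnegrE// real_normK ?num_real//.
apply: le_trans (psd_offdiag i j) _; rewrite expr2.
by apply: ler_pM => //; exact: psd_diag.
Qed.

(** Cauchy-Schwarz against the i-th basis vector. It confines the points with [qf M y <= u] to a
    slab of half-width sqrt (u / M i i), so a large diagonal entry of a precision matrix means a
    thin ellipsoid. *)
Lemma psd_slab i y : 0 < M i i ->
  M i i * (\sum_j M i j / M i i * y j ord0) ^+ 2 <= qf M y.
Proof.
move=> Mi; have := bform_CS (delta_mx i ord0) y.
rewrite bform_delta {1}/qf bform_delta2.
under [X in _ * X ^+ 2 <= _]eq_bigr do rewrite mulrAC.
rewrite -mulr_suml exprMn -(ler_pM2l Mi) => CS; apply: le_trans CS.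
by rewrite exprVn [X in X <= _](_ : _ = (\sum_j M i j * y j ord0) ^+ 2) //; field; rewrite gt_eqF.
Qed.

(** Limits of positive definite matrices are a priori only semidefinite. Invertibility restores
    strictness, because Cauchy-Schwarz turns [qf M y = 0] into [M *m y = 0]. *)
Lemma psd_unit_pos y : M \in unitmx -> y != 0 -> 0 < qf M y.
Proof.
move=> uM y0; rewrite lt_def M0 andbT; apply/eqP => qy.
suff My : M *m y = 0 by move: y0; rewrite -(mulKmx uM y) My mulmx0 eqxx.
apply/colP => i; have := bform_CS (delta_mx i ord0) y.
rewrite qy mulr0 => ?; rewrite [RHS]mxE.
have -> : (M *m y) i ord0 = bform M (delta_mx i ord0) y.
  by rewrite bform_delta mxE.
by apply/eqP; rewrite -sqrf_eq0 eq_le sqr_ge0 andbT.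
Qed.

End psd.
End bilinear_forms.

Section posdef.
Variables (R : realType).

Lemma pd_psd p (S : 'M[R]_p) y : posdefmx S -> 0 <= qf S y.
Proof.
move=> [_ S0]; have [->|/S0/ltW//] := eqVneq y 0.
by rewrite qf0.
Qed.

Lemma pd_qf_eq0 p (S : 'M[R]_p) y : posdefmx S -> qf S y <= 0 -> y = 0.
Proof. by move=> [_ S0]; have [//|/S0 + ?] := eqVneq y 0; rewrite ltNge => /negP. Qed.

Lemma pd_unit p (S : 'M[R]_p) : posdefmx S -> S \in unitmx.
Proof.
move=> [_ S0]; rewrite unitmxE unitfE; apply/det0P => -[v v0 vS].
have := S0 v^T; rewrite trmxK vS mul0mx mxE ltxx => S0'.
by have : v^T != 0 by [rewrite trmx_eq0]; move=> /S0'.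
Qed.

Lemma trmx_invmx p (S : 'M[R]_p) : (invmx S)^T = invmx S^T.
Proof. by rewrite trmx_inv. Qed.

Lemma pd_inv p (S : 'M[R]_p) : posdefmx S -> posdefmx (invmx S).
Proof.
move=> pS; have uS := pd_unit pS; case: (pS) => sS S0.
split=> [|x x0]; first by rewrite trmx_invmx sS.
have -> : x^T *m invmx S *m x = (invmx S *m x)^T *m S *m (invmx S *m x).
  by rewrite trmx_mul trmx_invmx sS -!mulmxA (mulmxA S) mulmxV// mul1mx.
apply: S0; apply: contra x0 => /eqP Sx.
by rewrite -(mulKVmx uS x) Sx mulmx0.
Qed.

Lemma pdZ p (S : 'M[R]_p) a : 0 < a -> posdefmx S -> posdefmx (a *: S).
Proof.
move=> a0 [sS S0]; split=> [|x /S0 ?]; first by rewrite linearZ /= sS.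
by rewrite -[X in _ < X]/(qf _ _) qfZl mulr_gt0.
Qed.

Lemma pd1 p : posdefmx (1%:M : 'M[R]_p).
Proof.
split=> [|x x0]; first by rewrite trmx1.
rewrite mulmx1 mxE lt_def; apply/andP; split; last first.
  by apply: sumr_ge0 => i _; rewrite mxE -expr2 sqr_ge0.
apply: contra x0; rewrite psumr_eq0 => [|i _]; last first.
  by rewrite mxE -expr2 sqr_ge0.
move=> /allP h; apply/eqP/colP => i; have := h i (mem_index_enum _).
by rewrite /= !mxE -expr2 sqrf_eq0 => /eqP.
Qed.

(** Cauchy-Schwarz for [invmx S] between [S *m delta_mx j ord0] and y. It puts an ellipsoid into a
    box read off the diagonal of its covariance matrix. *)
Lemma pd_coord p (S : 'M[R]_p) (y : 'cV[R]_p) j : posdefmx S ->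
  y j ord0 ^+ 2 <= S j j * qf (invmx S) y.
Proof.
move=> pS; have pM := pd_inv pS.
have := bform_CS pM.1 (fun z => pd_psd z pM) (S *m delta_mx j ord0) y.
have SMS : (S *m (delta_mx j ord0 : 'cV_p))^T *m invmx S = (delta_mx j ord0)^T.
  by rewrite trmx_mul pS.1 -mulmxA mulmxV ?mulmx1// pd_unit.
rewrite /bform SMS {1}/qf /bform SMS.
have -> : ((delta_mx j ord0 : 'cV_p)^T *m y) ord0 ord0 = y j ord0.
  by rewrite trmx_delta -rowE mxE.
by rewrite trmx_delta -rowE mxE -colE mxE.
Qed.

Lemma det_bound n (M : 'M[R]_n) (m : R) : (forall i j, `|M i j| <= m) ->
  `|\det M| <= n`!%:R * m ^+ n.
Proof.
move=> Mm; rewrite /determinant; apply: le_trans (ler_norm_sum _ _ _) _.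
apply: (@le_trans _ _ (\sum_(s : 'S_n) m ^+ n)).
  apply: ler_sum => s _; rewrite normrM normrX normrN1 expr1n mul1r normr_prod.
  rewrite -[in X in _ <= X](card_ord n) -prodr_const.
  by apply: ler_prod => i _; rewrite normr_ge0 Mm.
by rewrite sumr_const card_Sn mulr_natl.
Qed.

(** Cofactor formula for the inverse, each cofactor being a determinant of order p - 1. *)
Lemma invmx_bound p (M : 'M[R]_p) m i j :
  M \in unitmx -> (forall i j, `|M i j| <= m) ->
  `|invmx M i j| <= (p.-1)`!%:R * m ^+ p.-1 / `|\det M|.
Proof.
move=> uM Mm; rewrite /invmx uM !mxE normrM mulrC normfV.
apply: ler_wpM2r; first by rewrite invr_ge0.
rewrite /cofactor normrM normrX normrN1 expr1n mul1r.
by apply: det_bound => k l; rewrite !mxE.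
Qed.

(* The composition of the two central symmetries is a translation, which can
   preserve a bounded set only if it is trivial. *)
Lemma ellipsoid_center p (M M' : 'M[R]_p) (mu mu' : 'cV[R]_p) (s s' : R) :
  posdefmx M -> 0 <= s ->
  (forall x, (qf M (x - mu) <= s) = (qf M' (x - mu') <= s')) -> mu = mu'.
Proof.
move=> pM s0 h; pose d := mu' - mu.
have hk k : qf M (k%:R *: (2 *: d)) <= s.
  elim: k => [|k IH]; first by rewrite scale0r qf0.
  have := h (mu - k%:R *: (2 *: d)).
  have -> : mu - k%:R *: (2 *: d) - mu = - (k%:R *: (2 *: d)) by rewrite addrC addKr.
  rewrite qfN IH => /esym; rewrite -qfN => h'.
  have := h (2 *: mu' - (mu - k%:R *: (2 *: d))).
  have -> : 2 *: mu' - (mu - k%:R *: (2 *: d)) - mu' =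
     - (mu - k%:R *: (2 *: d) - mu').
    by apply/colP => i; rewrite !mxE; ring.
  rewrite h' => /idP; congr (qf M _ <= _).
  by apply/colP => i; rewrite !mxE -natr1; ring.
suff : d = 0 by move/eqP; rewrite subr_eq0 => /eqP.
apply: (pd_qf_eq0 pM); rewrite leNgt; apply/negP => d0.
have [k] : exists k : nat, s < (k%:R * 2) ^+ 2 * qf M d.
  have [k] : exists k : nat, s / qf M d < k%:R.
    by exists (Num.trunc (s / qf M d)).+1; rewrite truncnS_gt.
  rewrite ltr_pdivrMr// => hh; exists k; apply: lt_le_trans hh _.
  apply: ler_wpM2r; first exact: ltW.
  rewrite -natrM -natrX ler_nat -mulnn.
  apply: (@leq_trans (k * 2)%N); first by rewrite leq_pmulr.
  by case: (k * 2)%N => // m; rewrite leq_pmulr.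
have := hk k; rewrite scalerA qfZ => + /lt_le_trans h'.
by move=> /h'; rewrite ltxx.
Qed.

(** Once the centers agree, bringing each vector to the boundary level s compares the two forms on
    it, and polarization recovers the entries of the matrices. *)
Lemma ellipsoid_inj p (M M' : 'M[R]_p) (mu mu' : 'cV[R]_p) (s : R) :
  posdefmx M -> posdefmx M' -> 0 < s ->
  (forall x, (qf M (x - mu) <= s) = (qf M' (x - mu') <= s)) ->
  mu = mu' /\ M = M'.
Proof.
move=> pM pM' s0 h; have emu := ellipsoid_center pM (ltW s0) h.
split=> //; rewrite -emu in h.
have {}h y : (qf M y <= s) = (qf M' y <= s) by rewrite -(addrK mu y) h.
have le (N N' : 'M[R]_p) y : posdefmx N -> (forall y, qf N y <= s -> qf N' y <= s) ->
    qf N' y <= qf N y.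
  move=> pN hN; have [->|y0] := eqVneq y 0; first by rewrite !qf0.
  have N0 : 0 < qf N y by exact: pN.2.
  have := hN (Num.sqrt (s / qf N y) *: y).
  have sq : Num.sqrt (s / qf N y) ^+ 2 = s / qf N y.
    by rewrite sqr_sqrtr// divr_ge0// ltW.
  rewrite !qfZ sq divfK ?gt_eqF// lexx => /(_ isT).
  by rewrite mulrAC ler_pdivrMr// ler_pM2l.
have qE y : qf M y = qf M' y.
  by apply/eqP; rewrite eq_le !le// => z; rewrite h.
apply/matrixP => i j; rewrite -!bform_delta2.
have := qE (delta_mx i ord0 + delta_mx j ord0).
rewrite !qfD ?pM.1 ?pM'.1// !qE => /addIr /addrI /mulfI; apply.
by rewrite pnatr_eq0.
Qed.

End posdef.

(** * Limits of matrices and Borel sets *)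

Section limits.
Import numFieldNormedType.Exports.
Context {R : realType}.

Lemma cvg_mx_coord (T : Type) (F : set_system T) m n (f : T -> 'M[R]_(m, n))
    (M : 'M[R]_(m, n)) :
  Filter F ->
  (forall i j, f t i j @[t --> F] --> M i j) -> f t @[t --> F] --> M.
Proof.
move=> FF h A [P MP PA].
have PF i j : F [set t | P i j (f t i j)] by exact: h.
have : F (\bigcap_(ij in [set: 'I_m * 'I_n]) [set t | P ij.1 ij.2 (f t ij.1 ij.2)]).
  have -> : [set: 'I_m * 'I_n] = [set` [fset x in predT]%fset].
    by apply/seteqP; split=> x //= _; rewrite !inE.
  by apply: filter_bigI => ij _; exact: PF.
move=> hF; change (F [set t | A (f t)]); apply: filterS hF => t h'.
by apply: PA => i j; exact: (h' (i, j) I).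
Qed.

Lemma cvg_coord (T : Type) (F : set_system T) m n (f : T -> 'M[R]_(m, n))
    (M : 'M[R]_(m, n)) i j :
  Filter F -> f t @[t --> F] --> M -> f t i j @[t --> F] --> M i j.
Proof.
move=> FF fM.
move=> B MB; have hc : nbhs M [set N : 'M[R]_(m, n) | B (N i j)].
  exact: (@coord_continuous R m n i j M B MB).
exact: (fM _ hc).
Qed.

Lemma cvg_sumr (T I : Type) (F : set_system T) (r : seq I) (f : I -> T -> R) (l : I -> R) :
  Filter F -> (forall i, f i t @[t --> F] --> l i) ->
  \sum_(i <- r) f i t @[t --> F] --> \sum_(i <- r) l i.
Proof. by move=> FF h; apply: cvg_big => //; exact: add_continuous. Qed.

Lemma cvg_sub0 (T : Type) (F : set_system T) (f h : T -> R) (l : R) :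
  Filter F -> f t @[t --> F] --> l -> h t @[t --> F] --> l -> f t - h t @[t --> F] --> (0 : R).
Proof. by move=> FF fl hl; rewrite -(subrr l); exact: cvgB. Qed.

Lemma cvg_prodr (T I : Type) (F : set_system T) (r : seq I) (f : I -> T -> R) (l : I -> R) :
  Filter F -> (forall i, f i t @[t --> F] --> l i) ->
  \prod_(i <- r) f i t @[t --> F] --> \prod_(i <- r) l i.
Proof. by move=> FF h; apply: cvg_big => //; exact: mul_continuous. Qed.

Lemma cvg_qf (T : Type) (F : set_system T) p (M : T -> 'M[R]_p) (y : T ->
  'cV[R]_p) (M0 : 'M[R]_p) (y0 : 'cV[R]_p) :
  Filter F -> M t @[t --> F] --> M0 -> y t @[t --> F] --> y0 ->
  qf (M t) (y t) @[t --> F] --> qf M0 y0.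
Proof.
move=> FF hM hy; rewrite qfE; under eq_cvg do rewrite qfE.
apply: cvg_sumr => i; apply: cvg_sumr => j.
by apply: cvgM; [apply: cvgM|]; exact: cvg_coord.
Qed.

Lemma cvg_det (T : Type) (F : set_system T) p (M : T -> 'M[R]_p) (M0 : 'M[R]_p) :
  Filter F -> M t @[t --> F] --> M0 -> \det (M t) @[t --> F] --> \det M0.
Proof.
move=> FF hM; rewrite /determinant.
apply: cvg_sumr => s; apply: cvgM; first exact: cvg_cst.
by apply: cvg_prodr => i; exact: cvg_coord.
Qed.

Lemma cvg_addmx (T : Type) (F : set_system T) m n (f g : T -> 'M[R]_(m, n))
    (f0 g0 : 'M[R]_(m, n)) :
  Filter F -> f t @[t --> F] --> f0 -> g t @[t --> F] --> g0 ->
  f t + g t @[t --> F] --> f0 + g0.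
Proof.
move=> FF hf hg; apply: cvg_mx_coord => i j; rewrite mxE.
under eq_cvg do rewrite mxE; by apply: cvgD; exact: cvg_coord.
Qed.

Lemma cvg_oppmx (T : Type) (F : set_system T) m n (f : T -> 'M[R]_(m, n)) (f0 : 'M[R]_(m, n)) :
  Filter F -> f t @[t --> F] --> f0 -> - f t @[t --> F] --> - f0.
Proof.
move=> FF hf; apply: cvg_mx_coord => i j; rewrite mxE.
under eq_cvg do rewrite mxE; by apply: cvgN; exact: cvg_coord.
Qed.

Lemma cvg_mulmx (T : Type) (F : set_system T) m n k (f : T -> 'M[R]_(m, n)) 
  (g : T -> 'M[R]_(n, k)) (f0 : 'M[R]_(m, n)) (g0 : 'M[R]_(n, k)) :
  Filter F -> f t @[t --> F] --> f0 -> g t @[t --> F] --> g0 ->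
  f t *m g t @[t --> F] --> f0 *m g0.
Proof.
move=> FF hf hg; apply: cvg_mx_coord => i j; rewrite mxE.
under eq_cvg do rewrite mxE.
by apply: cvg_sumr => l; apply: cvgM; exact: cvg_coord.
Qed.

Lemma cvg_qf_sub (T : Type) (F : set_system T) p (M : T -> 'M[R]_p)
    (mu y : T -> 'cV[R]_p)
    (M0 : 'M[R]_p) (mu0 y0 : 'cV[R]_p) :
  Filter F -> M t @[t --> F] --> M0 -> mu t @[t --> F] --> mu0 ->
  y t @[t --> F] --> y0 ->
  qf (M t) (y t - mu t) @[t --> F] --> qf M0 (y0 - mu0).
Proof.
move=> FF hM hmu hy; apply: cvg_qf => //.
by apply: cvg_addmx => //; exact: cvg_oppmx.
Qed.

Lemma continuous_qf p (M : 'M[R]_p) mu : continuous (fun x : 'cV[R]_p => qf M (x - mu)).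
Proof. by move=> x; apply: (@cvg_qf_sub _ (nbhs x) p (fun=> M) (fun=> mu) id);
  [exact: cvg_cst|exact: cvg_cst|exact: cvg_id]. Qed.

Lemma ultra_bounded_cvg (T : Type) (U : set_system T) (f : T -> R) (B : R) :
  UltraFilter U -> (\forall t \near U, `|f t| <= B) ->
  exists l : R, f t @[t --> U] --> l.
Proof.
move=> UU hB.
have UfU : UltraFilter (f t @[t --> U]).
  split=> [|G GG fG]; first exact: fmap_proper_filter.
  rewrite predeqE => A; split=> [GA|]; last exact: fG.
  have [//|nA] := in_ultra_setVsetC (f @^-1` A) UU.
  have : G (~` A) by exact: fG.
  by move=> /(filterI GA); rewrite setICr => /filter_not_empty.
have : compact `[-B, B] by exact: segment_compact.
rewrite compact_ultra => /(_ _ UfU) [|l [_ hl]]; last by exists l.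
by move: hB; apply: filterS => t /=; rewrite in_itv/= ler_norml.
Qed.

Lemma ultra_bounded_cvg_mx (T : Type) (U : set_system T) m n (f : T -> 'M[R]_(m, n)) (B : R) :
  UltraFilter U -> (\forall t \near U, forall i j, `|f t i j| <= B) ->
  exists l : 'M[R]_(m, n), f t @[t --> U] --> l.
Proof.
move=> UU hB.
have h i j : exists l : R, f t i j @[t --> U] --> l.
  by apply: (@ultra_bounded_cvg _ U _ B) => //; move: hB; apply: filterS => t.
have [l hl] : exists l : 'I_m -> 'I_n -> R, forall i j, f t i j @[t --> U] --> l i j.
  exists (fun i j => projT1 (cid (h i j))) => i j; exact: (projT2 (cid (h i j))).
by exists (\matrix_(i, j) l i j); apply: cvg_mx_coord => i j; rewrite mxE.
Qed.

(** An ultrafilter decides, for every B, the set where f is at most B. This replaces the extraction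
    of a subsequence in arguments by contradiction. *)
Lemma ultra_bounded_or (T : Type) (U : set_system T) (f : T -> R) :
  UltraFilter U -> (exists B : R, \forall t \near U, f t <= B) \/
  (forall B : R, \forall t \near U, B < f t).
Proof.
move=> UU; have [h|h] := pselect (exists B : R, \forall t \near U, f t <= B).
  by left.
right=> B; have [hB|] := in_ultra_setVsetC [set t | f t <= B] UU.
  by case: h; exists B.
by apply: filterS => t /= /negP; rewrite -ltNge.
Qed.

(** If the preimage of some neighbourhood were not in F, the trace of F on its complement would be a
    proper filter, and any ultrafilter above that trace would contradict the hypothesis. *)
Lemma ultra_cvg (T : Type) (F : set_system T) (V : topologicalType) (f : T -> V) (l : V) :
  ProperFilter F ->
  (forall U, UltraFilter U -> F `<=` U -> f t @[t --> U] --> l) ->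
  f t @[t --> F] --> l.
Proof.
move=> FF h A lA; apply: contrapT => nA.
have GP : ProperFilter (within (~` (f @^-1` A)) F).
  apply: Build_ProperFilter_ex => B; rewrite /within /=; apply: contraPP => /forallNP nB BF.
  by apply: nA; move: BF; apply: filterS => t Bt; apply: contrapT => /Bt; exact: nB.
have [U [UU GU]] := ultraFilterLemma GP.
have FU : F `<=` U by move=> B FB; apply: GU; rewrite /within; apply: filterS FB.
have UA : U (f @^-1` A) by exact: (h U UU FU).
have : U (~` (f @^-1` A)) by apply: GU; rewrite /within /=; apply: filterS filterT.
by move=> /(filterI UA); rewrite setICr => /filter_not_empty.
Qed.

Lemma continuous_norm_coord p (i : 'I_p) :
  continuous (fun v : 'cV[R]_p => `|v i ord0|).
Proof.
move=> v; have h : (w : 'cV[R]_p) i ord0 @[w --> v] --> v i ord0.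
  exact: (@coord_continuous R p 1 i ord0 v).
exact: cvg_norm h.
Qed.

Definition cbox p (B : R) : set 'cV[R]_p := [set v : 'cV[R]_p | forall i, `|v i ord0| <= B].

Lemma compact_cbox p B : compact (@cbox p B).
Proof.
rewrite compact_ultra => U UU UB.
have [l hl] : exists l : 'cV[R]_p, v @[v --> U] --> l.
  apply: (@ultra_bounded_cvg_mx _ U _ _ id B) => //.
  by move: UB; apply: filterS => v h i j; rewrite (ord1 j).
exists l; split=> // i.
have h1 : `|(v : 'cV[R]_p) i ord0| @[v --> U] --> `|l i ord0|.
  by apply: cvg_norm; exact: cvg_coord.
apply: (cvgr_to_le h1); change (U [set v : 'cV[R]_p | `|v i ord0| <= B]).
by apply: filterS UB => v /(_ i).
Qed.

Lemma closed_cbox p B : closed (@cbox p B).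
Proof.
rewrite (_ : cbox B = \bigcap_(i in [set: 'I_p]) ((fun v : 'cV[R]_p =>
  `|v i ord0|) @^-1` [set x | x <= B])).
  apply: closed_bigI => i _; apply: preimage_closed; last exact: closed_le.
  by move=> v _; exact: continuous_norm_coord.
by apply/seteqP; split=> v /= h i; [move=> _|]; exact: h.
Qed.

(** Continuous convergence on a compact set is uniform. The hypothesis lives on the product filter
    because the covering form of compactness needs the point and the index to vary together. *)
Lemma uniform_near (T : Type) (F : set_system T) p (B : R) (h : T -> 'cV[R]_p ->
  R) (h0 : 'cV[R]_p -> R) :
  Filter F ->
  (forall y, @cbox p B y -> h z.2 z.1 - h0 z.1 @[z --> (nbhs y, F)] --> (0 : R)) ->
  forall e, 0 < e -> \forall t \near F, forall y, @cbox p B y -> `|h t y - h0 y| < e.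
Proof.
move=> FF hc e e0.
have := @compact_cbox p B; rewrite compact_near_coveringP => /(_ _ F (fun t y =>
  `|h t y - h0 y| < e) FF).
apply => y yB; have /cvgrPdist_lt /(_ e e0) := hc y yB.
by apply: filterS => -[y' t] /=; rewrite sub0r normrN.
Qed.

End limits.

Section borel.
Import numFieldNormedType.Exports.
Context {R : realType} (p : nat).

(** A countable base of open sets. It shows that open sets belong to the sigma-algebra generated by
    the coordinates, and later reduces the strong law to countably many events. *)
Definition rbox (c : {ffun 'I_p -> rat * rat}) : set 'cV[R]_p :=
  [set v | forall i, ratr (c i).1 < v i ord0 < ratr (c i).2].

Lemma rbox_basis (O : set 'cV[R]_p) x : open O -> O x ->
  exists c, rbox c x /\ rbox c `<=` O.
Proof.
move=> oO Ox; have : nbhs x O by exact: open_nbhs_nbhs.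
move=> [P xP PO].
have h i : exists q : rat * rat, ratr q.1 < x i ord0 < ratr q.2 /\
   forall t, ratr q.1 < t < ratr q.2 -> P i ord0 t.
  have /nbhs_ballP[e /= e0 he] := xP i ord0.
  have [a /[!in_itv]/= /andP[a1 a2]] := @rat_in_itvoo R (x i ord0 - e) (x i ord0) ltac:(by
    rewrite ltrBlDr ltrDl).
  have [b /[!in_itv]/= /andP[b1 b2]] := @rat_in_itvoo R (x i ord0) (x i ord0 + e) ltac:(by
    rewrite ltrDl).
  exists (a, b); split; first by rewrite /= a2 b1.
  move=> t /andP[/= ta tb]; apply: he; rewrite /ball/= ltr_norml.
  by apply/andP; split; lra.
exists [ffun i => projT1 (cid (h i))]; split.
  by move=> i; rewrite ffunE; exact: (projT2 (cid (h i))).1.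
move=> v hv; apply: PO => i j; rewrite (ord1 j).
by apply: (projT2 (cid (h i))).2; have := hv i; rewrite ffunE.
Qed.

Lemma measurable_rbox c : measurable (rbox c).
Proof.
rewrite (_ : rbox c = \bigcap_(i in [set: 'I_p]) ((fun v : 'cV[R]_p =>
  v i ord0) @^-1` `]ratr (c i).1, ratr (c i).2[)).
  apply: fin_bigcap_measurable => // i _; rewrite -[X in measurable X]setTI.
  by apply: measurable_coord => //; exact: measurable_itv.
apply/seteqP; split=> v /= h i; first by move=> _; exact: h.
exact: h i I.
Qed.

Definition rbox_of (n : nat) : set 'cV[R]_p :=
  if @choice.unpickle {ffun 'I_p -> rat * rat} n is Some c then rbox c else set0.

Lemma measurable_rbox_of n : measurable (rbox_of n).
Proof. by rewrite /rbox_of; case: choice.unpickle => [c|]; [exact: measurable_rbox|]. Qed.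

Lemma open_rbox_bigcup (O : set 'cV[R]_p) : open O ->
  O = \bigcup_(n in [set n | rbox_of n `<=` O]) rbox_of n.
Proof.
move=> oO; apply/seteqP; split=> [x Ox|x [n nO nx]]; last exact: nO.
have [c [cx cO]] := rbox_basis oO Ox.
by exists (choice.pickle c); rewrite /= /rbox_of choice.pickleK.
Qed.

Lemma open_measurable_col (O : set 'cV[R]_p) : open O -> measurable O.
Proof.
move=> oO; rewrite (open_rbox_bigcup oO).
by apply: bigcup_measurable => n _; exact: measurable_rbox_of.
Qed.

Lemma closed_measurable_col (C : set 'cV[R]_p) : closed C -> measurable C.
Proof.
by move=> cC; rewrite -(setCK C); apply: measurableC; apply: open_measurable_col;
  exact: closed_openC.
Qed.

Lemma continuous_measurable_col (f : 'cV[R]_p -> R) :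
  continuous f -> measurable_fun setT f.
Proof.
move=> cf; apply: (measurability _ (measurable_realfun.RGenOpens.measurableE R)).
move=> _ [_ [a [b ->] <-]]; rewrite setTI; apply: open_measurable_col.
by move/continuousP : cf; apply; exact: interval_open.
Qed.

End borel.

(** * Lebesgue measure of ellipsoids *)

Section pushforward_measure.
Context d1 d2 (T1 : measurableType d1) (T2 : measurableType d2) (R : realType).
Variables (m : {measure set T1 -> \bar R}) (f : T1 -> T2).
Hypothesis mf : measurable_fun [set: T1] f.

Definition pushm : {measure set T2 -> \bar R}.
Proof. refine (pushforward m f : {measure set T2 -> \bar R}); exact: mf. Defined.

Lemma pushmE A : pushm A = m (f @^-1` A). Proof. by []. Qed.

End pushforward_measure.

Section lebesgue_affine.
Import numFieldNormedType.Exports.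
Context {R : realType}.
Local Open Scope ereal_scope.

Lemma measurable_affine (s b : R) :
  measurable_fun [set: measurableTypeR R] (fun x : measurableTypeR R =>
    (s * x + b : measurableTypeR R)%R).
Proof.
by apply: measurable_funD => //; apply: measurable_funM.
Qed.

(** The image of Lebesgue measure, multiplied by s, agrees with Lebesgue measure on the intervals
    ]a, c], which determine it. *)
Lemma lebesgue_measure_affine (s b : R) (B : set (measurableTypeR R)) :
  (0 < s)%R -> measurable B ->
  lebesgue_measure ((fun x => s * x + b)%R @^-1` B) = s^-1%:E * lebesgue_measure B.
Proof.
move=> s0 mB.
pose m := mscale (NngNum (ltW s0)) (pushm (@lebesgue_measure R) (measurable_affine s b)).
have h : lebesgue_measure B = m B.
  apply: lebesgue_measure_unique => // _ [[a c]] _ <-.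
  rewrite [RHS](_ : _ = s%:E * lebesgue_measure `](a - b) / s, (c - b) / s]%classic%R); last first.
    change (s%:E * lebesgue_measure ((fun x : R =>
      (s * x + b)%R) @^-1` `]a, c]%classic) = s%:E * lebesgue_measure `](a - b) / s,
        (c - b) / s]%classic%R).
    congr (_ * lebesgue_measure _).
    apply/seteqP; split=> x /=; rewrite !in_itv /= ltr_pdivrMr// ler_pdivlMr// ltrBlDr lerBrDr
      (mulrC x)//.
  rewrite /= !lebesgue_measure_itv /= !lte_fin ltr_pM2r ?invr_gt0// ltrD2r.
  case: ifPn => _; last by rewrite mule0.
  by rewrite -!EFinB -EFinM; congr EFin; field; rewrite gt_eqF.
rewrite h /m /mscale /= muleA -EFinM mulVf ?mul1e// gt_eqF//.
Qed.

Variable p : nat.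
Local Notation lam := (lebesgue_col R p).

Definition col_boxes : set (set 'cV[R]_p) :=
  [set [set v : 'cV[R]_p | forall i, B i (v i ord0)] |
    B in [set B : 'I_p -> set (measurableTypeR R) | forall i, measurable (B i)]].

Lemma setI_closed_boxes : setI_closed col_boxes.
Proof.
move=> _ _ [B mB <-] [C mC <-]; exists (fun i => B i `&` C i).
  by move=> i; exact: measurableI.
by apply/seteqP; split=> v /=; [move=> h; split=> i; have [] := h i|move=> [h1 h2] i; split].
Qed.

Lemma measurable_boxes A : col_boxes A -> measurable A.
Proof.
move=> [B mB <-].
rewrite (_ : [set _ | _] = \bigcap_(j in [set: 'I_p]) (fun v : 'cV[R]_p => v j ord0) @^-1` B j).
  apply: fin_bigcap_measurable => // j _.
  by rewrite -[X in measurable X]setTI; apply: measurable_coord => //; exact: mB.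
by apply/seteqP; split => v /= h j; [move=> _|]; exact: h.
Qed.

Lemma measurable_boxesE : (measurable : set (set 'cV[R]_p)) = <<s col_boxes >>.
Proof.
apply/seteqP; split; last first.
  by apply: smallest_sub; [exact: sigma_algebra_measurable|exact: measurable_boxes].
apply: smallest_sub; first exact: smallest_sigma_algebra.
rewrite -bigcup_seq; apply: bigcup_sub => i _ B [C mC <-] /=.
apply: sub_sigma_algebra; exists (fun j => if j == i then C else setT).
  by move=> j; case: ifP.
rewrite setTI; apply/seteqP; split=> v /= h; first by have := h i; rewrite eqxx.
by move=> j; case: eqP => // ->.
Qed.

Lemma cbox_box (K : R) : cbox K = [set v : 'cV[R]_p | forall i, `[(- K)%R, K]%classic (v i ord0)].
Proof. by apply/seteqP; split=> v /= h i; have := h i; rewrite /= in_itv /= ler_norml. Qed.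

Lemma lebesgue_cbox (K : R) : (0 <= K)%R -> lam (cbox K) = ((2 * K) ^+ p)%:E.
Proof.
move=> K0; rewrite cbox_box (@lebesgue_col_box R p (fun=> `[(- K)%R, K]%classic));
  last by move=> i; exact: measurable_itv.
under eq_bigr do rewrite lebesgue_measure_itv /= lte_fin.
rewrite (_ : (if (- K < K)%R then (K%:E - (- K)%:E) else 0) = (2 * K)%:E); last first.
  case: ltP => [_|h]; first by rewrite -EFinB; congr EFin; ring.
  by congr EFin; lra.
by rewrite prodEFin prodr_const card_ord.
Qed.

Lemma measurable_cbox (K : R) : measurable (@cbox R p K).
Proof. by apply: closed_measurable_col; exact: closed_cbox. Qed.

Lemma lebesgue_bounded_lty (A : set 'cV[R]_p) K : measurable A -> A `<=` cbox K -> lam A < +oo.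
Proof.
move=> mA AK; have AK' : A `<=` cbox (Num.max K 0%R).
  by move=> v /AK h i; apply: le_trans (h i) _; rewrite le_max lexx.
apply: (@le_lt_trans _ _ (lam (cbox (Num.max K 0%R)))).
  by apply: le_measure; rewrite ?inE//; exact: measurable_cbox.
by rewrite lebesgue_cbox ?ltry// le_max lexx orbT.
Qed.

Lemma measurable_col_affine (s : R) (b : 'cV[R]_p) :
  measurable_fun [set: 'cV[R]_p] (fun y : 'cV[R]_p => s *: y + b)%R.
Proof.
apply: measurable_fun_colP => i; under eq_fun do rewrite !mxE.
apply: (measurableT_comp (measurable_affine s (b i ord0))).
exact: measurable_coord.
Qed.

Lemma bigcup_cbox : \bigcup_k (@cbox R p k%:R) = setT.
Proof.
apply/seteqP; split=> // v _.
pose K := (\sum_i `|v i ord0|)%R.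
exists (Num.trunc K).+1 => // i; apply: (@le_trans _ _ K); last exact: ltW (truncnS_gt _).
by rewrite /K (bigD1 i)//= lerDl sumr_ge0.
Qed.

(** Homotheties and translations act coordinatewise, so measurable boxes are enough. The effect of
    the shape of an ellipsoid on its volume is obtained in [uvol_prop] by another route. *)
Lemma lebesgue_col_affine (s : R) (b : 'cV[R]_p) (B : set 'cV[R]_p) :
  (0 < s)%R -> measurable B ->
  lam ((fun y => s *: y + b)%R @^-1` B) = (s^-1 ^+ p)%:E * lam B.
Proof.
move=> s0 mB.
have sp0 : (0 < s ^+ p)%R by rewrite exprn_gt0.
pose m := mscale (NngNum (ltW sp0)) (pushm lam (measurable_col_affine s b)).
have h : lam B = m B.
  apply: (measure_unique col_boxes (fun k => @cbox R p k%:R)) => //.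
  - exact: measurable_boxesE.
  - exact: setI_closed_boxes.
  - by move=> k; rewrite cbox_box; exists (fun=> `[(- k%:R)%R, k%:R]%classic).
  - exact: bigcup_cbox.
  - move=> _ [C mC <-]; rewrite /m /mscale /= /pushforward.
    change (lam [set v : 'cV[R]_p | forall i, C i (v i ord0)] =
      (s ^+ p)%:E * lam ((fun y : 'cV[R]_p => s *: y + b)%R @^-1` [set v : 'cV[R]_p | forall i,
        C i (v i ord0)])).
    have -> : (fun y : 'cV[R]_p => s *: y + b)%R @^-1` [set v : 'cV[R]_p | forall i,
      C i (v i ord0)] =
        [set v : 'cV[R]_p | forall i, ((fun x => s * x + b i ord0)%R @^-1` C i) (v i ord0)].
      by apply/seteqP; split=> v /= + i => /(_ i); rewrite !mxE.
    rewrite lebesgue_col_box// (@lebesgue_col_box R p (fun i => (fun x =>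
      s * x + b i ord0)%R @^-1` C i)); last first.
      by move=> i; rewrite -[X in measurable X]setTI; apply: measurable_affine => //; exact: mC.
    have sE : (s ^+ p)%:E = \prod_(i < p) s%:E by rewrite prodEFin prodr_const card_ord.
    rewrite sE -big_split /=; apply: eq_bigr => i _.
    rewrite (lebesgue_measure_affine (b i ord0) s0 (mC i)).
    by rewrite muleA -EFinM divff ?mul1e// gt_eqF.
  - by move=> k; rewrite lebesgue_cbox// ltry.
rewrite h /m /mscale /= muleA -EFinM exprVn mulVf ?mul1e// gt_eqF//.
Qed.

End lebesgue_affine.

Section measure_facts.
Context d (T : measurableType d) (R : realType) (mu : {measure set T -> \bar R}).
Implicit Types A B : set T.
Local Open Scope ereal_scope.

Lemma null_negligible A : measurable A -> mu A = 0 -> mu.-negligible A.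
Proof. by move=> mA A0; apply/negligibleP. Qed.

Lemma negligible_null A : measurable A -> mu.-negligible A -> mu A = 0.
Proof. exact: measure_negligible. Qed.

Lemma le_measureS A B : measurable A -> measurable B -> A `<=` B -> mu A <= mu B.
Proof. by move=> mA mB AB; apply: le_measure; rewrite ?inE. Qed.

End measure_facts.

Section qballs.
Import numFieldNormedType.Exports.
Context {R : realType} {p : nat}.
Implicit Types (M S : 'M[R]_p) (mu : 'cV[R]_p) (u : R).
Local Notation lam := (lebesgue_col R p).

(** M is a precision matrix and u a squared radius, so that limits of shapes and of levels involve
    neither inverses nor roots. *)
Definition qball M mu u : set 'cV[R]_p := [set x | qf M (x - mu) <= u].
Definition qballo M mu u : set 'cV[R]_p := [set x | qf M (x - mu) < u].

Lemma closed_qball M mu u : closed (qball M mu u).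
Proof.
apply: (@preimage_closed _ _ (fun x : 'cV[R]_p => qf M (x - mu)) [set x | x <= u]) => [x _|].
  exact: continuous_qf.
exact: closed_le.
Qed.

Lemma open_qballo M mu u : open (qballo M mu u).
Proof.
apply: (@open_comp _ _ (fun x : 'cV[R]_p => qf M (x - mu)) [set x | x < u]) => [x _|].
  exact: continuous_qf.
exact: open_lt.
Qed.

Lemma measurable_qball M mu u : measurable (qball M mu u).
Proof. by apply: closed_measurable_col; exact: closed_qball. Qed.

Lemma measurable_qballo M mu u : measurable (qballo M mu u).
Proof. by apply: open_measurable_col; exact: open_qballo. Qed.

Lemma measurable_qf M mu :
  measurable_fun [set: 'cV[R]_p] (fun x : 'cV[R]_p => qf M (x - mu) : measurableTypeR R).
Proof. by apply: continuous_measurable_col; exact: continuous_qf. Qed.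

Lemma qball_cbox M mu u B B' : posdefmx M -> (forall j, invmx M j j <= B) ->
  (forall j, `|mu j ord0| <= B') -> qball M mu u `<=` cbox (B' + 1 + B * `|u|).
Proof.
move=> pM hB hB' x xu j.
have : (x - mu) j ord0 ^+ 2 <= B * `|u|.
  have := @pd_coord R p (invmx M) (x - mu) j (pd_inv pM); rewrite invmxK => /le_trans; apply.
  apply: ler_pM => //.
  - exact: psd_diag (fun y => pd_psd y (pd_inv pM)) _.
  - exact: pd_psd.
  - by apply: le_trans xu _; rewrite ler_norm.
rewrite !mxE => h.
have : `|x j ord0 - mu j ord0| <= 1 + B * `|u|.
  (* [t <= 1 + t ^+ 2] avoids a square root in the size of the box. *)
  apply: le_trans (_ : 1 + (x j ord0 - mu j ord0) ^+ 2 <= _); last by rewrite lerD2l.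
  rewrite -real_normK ?num_real//; have := normr_ge0 (x j ord0 - mu j ord0); nra.
move=> h2; rewrite -(subrK (mu j ord0) (x j ord0)).
apply: le_trans (ler_normD _ _) _; have := hB' j; lra.
Qed.

Lemma qball_bounded M mu u : posdefmx M -> exists K, qball M mu u `<=` cbox K.
Proof.
move=> pM; pose B := \sum_j invmx M j j; pose B' := \sum_j `|mu j ord0|.
exists (B' + 1 + B * `|u|); apply: qball_cbox => // j.
  rewrite /B (bigD1 j)//= lerDl sumr_ge0// => i _.
  exact: psd_diag (fun y => pd_psd y (pd_inv pM)) _.
by rewrite /B' (bigD1 j)//= lerDl sumr_ge0.
Qed.

Lemma qballS M mu u v : u <= v -> qball M mu u `<=` qball M mu v.
Proof. by move=> uv x /le_trans; exact. Qed.

Lemma qballoW M mu u : qballo M mu u `<=` qball M mu u.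
Proof. by move=> x /ltW. Qed.

Lemma qball_qballo M mu u v : u < v -> qball M mu u `<=` qballo M mu v.
Proof. by move=> uv x /le_lt_trans; exact. Qed.

Lemma qball_lty M mu u : posdefmx M -> (lam (qball M mu u) < +oo)%E.
Proof.
move=> pM; have [K hK] := @qball_bounded M mu u pM.
exact: lebesgue_bounded_lty (measurable_qball _ _ _) hK.
Qed.

Lemma qball_dilate M mu u : 0 < u ->
  lam (qball M mu u) = ((Num.sqrt u ^+ p)%:E * lam (qball M mu 1))%E.
Proof.
move=> u0; have su0 : 0 < Num.sqrt u by rewrite sqrtr_gt0.
have := @lebesgue_col_affine R p _ (mu - Num.sqrt u *: mu) _ su0 (measurable_qball M mu u).
rewrite (_ : _ @^-1` _ = qball M mu 1).
  by move=> ->; rewrite muleA -EFinM -exprMn divff ?gt_eqF// expr1n mul1e.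
have e y : Num.sqrt u *: y + (mu - Num.sqrt u *: mu) - mu = Num.sqrt u *: (y - mu).
  by apply/colP => i; rewrite !mxE; ring.
have h y : (u * qf M (y - mu) <= u) = (qf M (y - mu) <= 1).
  by rewrite -[X in _ <= X]mulr1 ler_pM2l.
by apply/seteqP; split=> y /=; rewrite /qball /= e qfZ sqr_sqrtr ?(ltW u0)// h.
Qed.

Lemma qballo_dilate M mu u : 0 < u ->
  lam (qballo M mu u) = ((Num.sqrt u ^+ p)%:E * lam (qballo M mu 1))%E.
Proof.
move=> u0; have su0 : 0 < Num.sqrt u by rewrite sqrtr_gt0.
have := @lebesgue_col_affine R p _ (mu - Num.sqrt u *: mu) _ su0 (measurable_qballo M mu u).
rewrite (_ : _ @^-1` _ = qballo M mu 1).
  by move=> ->; rewrite muleA -EFinM -exprMn divff ?gt_eqF// expr1n mul1e.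
have e y : Num.sqrt u *: y + (mu - Num.sqrt u *: mu) - mu = Num.sqrt u *: (y - mu).
  by apply/colP => i; rewrite !mxE; ring.
have h y : (u * qf M (y - mu) < u) = (qf M (y - mu) < 1).
  by rewrite -[X in _ < X]mulr1 ltr_pM2l.
by apply/seteqP; split=> y /=; rewrite /qballo /= e qfZ sqr_sqrtr ?(ltW u0)// h.
Qed.

Lemma bigcup_qball M mu : \bigcup_k (qball M mu k.+1%:R) = setT.
Proof.
apply/seteqP; split=> // x _.
by exists (Num.trunc (qf M (x - mu))) => //; exact: ltW (truncnS_gt _).
Qed.

(** If the unit ball were null, so would be its dilates, and they cover the space. *)
Lemma qball_gt0 M mu : (0 < lam (qball M mu 1))%E.
Proof.
rewrite lt_def measure_ge0 andbT; apply/eqP => h.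
have : lam.-negligible (\bigcup_k (qball M mu k.+1%:R)).
  apply: negligible_bigcup => k; apply: null_negligible; first exact: measurable_qball.
  by rewrite qball_dilate// h mule0.
rewrite bigcup_qball => /(negligibleS (@subsetT _ (cbox 1))) /(negligible_null (measurable_cbox _)).
by rewrite lebesgue_cbox// => -[] /eqP; rewrite mulr1 expf_eq0 pnatr_eq0 andbF.
Qed.

(** The open ball contains the closed balls of radius t < 1, whose volume is t ^ p times that of the
    closed unit ball; let t tend to 1. *)
Lemma qballo1 M mu : posdefmx M -> lam (qballo M mu 1) = lam (qball M mu 1).
Proof.
move=> pM; apply/eqP; rewrite eq_le; apply/andP; split.
  by apply: le_measure; rewrite ?inE; [exact: measurable_qballo|exact: measurable_qball|exact:
    qballoW].
have f1 : lam (qball M mu 1) \is a fin_num.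
  by rewrite ge0_fin_numE ?measure_ge0// qball_lty.
have f2 : lam (qballo M mu 1) \is a fin_num.
  rewrite ge0_fin_numE ?measure_ge0//; apply: le_lt_trans (qball_lty mu 1 pM).
  by apply: le_measure; rewrite ?inE; [exact: measurable_qballo|exact: measurable_qball|exact:
    qballoW].
rewrite -(fineK f1) -(fineK f2) lee_fin.
have h : t ^+ p * fine (lam (qball M mu 1)) @[t --> (1:R)^'-] --> 1 ^+ p * fine (lam (qball M mu
  1)).
  apply: cvg_at_left_filter; apply: cvgM; last exact: cvg_cst.
  exact: exprn_continuous.
rewrite expr1n mul1r in h.
apply: (cvgr_to_le h); near=> t.
have t0 : 0 < t by near: t; apply: nbhs_left_gt.
have t1 : t < 1 by near: t; apply: nbhs_left_lt.
have : (lam (qball M mu (t ^+ 2)) <= lam (qballo M mu 1))%E.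
  apply: le_measure; rewrite ?inE; [exact: measurable_qball|exact: measurable_qballo|].
  by apply: qball_qballo; rewrite expr_lt1// ltW.
rewrite qball_dilate ?exprn_gt0// sqrtr_sqr ger0_norm ?(ltW t0)//.
by rewrite -(fineK f1) -(fineK f2) -EFinM lee_fin.
Unshelve. all: by end_near. Qed.

Lemma nbhs_qball (a : 'cV[R]_p) (O : set 'cV[R]_p) : nbhs a O ->
  exists2 e : R, 0 < e & qball 1%:M a e `<=` O.
Proof.
move=> /nbhs_ballP [e /= e0 he]; exists ((e / 2) ^+ 2); first by rewrite exprn_gt0// divr_gt0.
move=> y hy; apply/he; split=> // k l; rewrite (ord1 l) /ball /= distrC.
apply: (@le_lt_trans _ _ (e / 2)); last by rewrite ltr_pdivrMr// ltr_pMr// ltr1n.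
have e2 : 0 <= e / 2 by rewrite divr_ge0// ltW.
rewrite -ler_sqr ?nnegrE// real_normK ?num_real//; apply: le_trans hy.
have := pd_coord (y - a) k (pd1 R p); rewrite invmx1 !mxE eqxx mul1r.
exact.
Qed.

(* Infinitely many disjoint translates of a slice of the hyperplane fit in a
   bounded set. *)
Lemma hyperplane_null (w : 'I_p -> R) c i0 : w i0 != 0 ->
  lam [set x : 'cV[R]_p | \sum_j w j * x j ord0 = c] = 0%E.
Proof.
move=> w0; set H := [set x : 'cV[R]_p | _].
have cH : closed H.
  apply: (@preimage_closed _ _ (fun x : 'cV[R]_p => \sum_j w j * x j ord0) [set x | x = c]) =>
    [x _|].
    apply: (@cvg_sumr R _ _ (nbhs x)) => i; apply: cvgM; first exact: cvg_cst.
    exact: coord_continuous.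
  exact: closed_eq.
suff h k : lam (H `&` cbox k%:R) = 0%E.
  apply: negligible_null; first exact: closed_measurable_col.
  rewrite -(setIT H) -bigcup_cbox setI_bigcupr; apply: negligible_bigcup => k.
  have m1 : measurable (H `&` cbox k%:R).
    by apply: measurableI; [exact: closed_measurable_col|exact: measurable_cbox].
  exact: null_negligible.
have mHk : measurable (H `&` cbox k%:R).
  by apply: measurableI; [exact: closed_measurable_col|exact: measurable_cbox].
pose t (j : nat) : R := j.+1%:R^-1.
pose F j := (fun y : 'cV[R]_p => 1 *: y + (- t j *: delta_mx i0 ord0)) @^-1` (H `&` cbox k%:R).
have mF j : measurable (F j).
  by rewrite /F -[X in measurable X]setTI; exact: measurable_col_affine.
have lF j : lam (F j) = lam (H `&` cbox k%:R).
  by rewrite /F lebesgue_col_affine// invr1 expr1n mul1e.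
have sF j x : F j x -> \sum_i w i * x i ord0 = c + t j * w i0.
  move=> [+ _]; rewrite /H /= => <-.
  under [in RHS]eq_bigr do rewrite !mxE mul1r mulrDr.
  rewrite big_split /= -addrA [X in _ = _ + X](_ : _ = 0) ?addr0//.
  rewrite (bigD1 i0)//= big1 ?addr0; last by move=> i ii0; rewrite (negbTE ii0) !mulr0.
  by rewrite !eqxx mulr1; ring.
have tF : trivIset setT F.
  apply/trivIsetP => i j _ _ ij; apply/seteqP; split=> x //= [/sF e1 /sF].
  rewrite e1 => /addrI /(mulIf w0) /invr_inj /eqP; rewrite eqr_nat => /eqP [] e.
  by rewrite e eqxx in ij.
have FB : \bigcup_j F j `<=` cbox (k%:R + 1).
  move=> x [j _ [_ /= h]] i; have := h i; rewrite !mxE mul1r => h1.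
  rewrite -(subrK (t j * (i == i0)%:R) (x i ord0)); apply: le_trans (ler_normD _ _) _.
  apply: lerD; first by rewrite andbT mulNr in h1.
  rewrite normrM ger0_norm ?invr_ge0// mulr_ile1 ?invr_ge0 ?invf_le1 ?ler1n//.
  by case: eqP; rewrite ?normr1 ?normr0.
have mUF : measurable (\bigcup_j F j) by exact: bigcupT_measurable.
have UF : (lam (\bigcup_j F j) < +oo)%E by exact: lebesgue_bounded_lty FB.
have sumF : (lam (\bigcup_j F j) = \sum_(j <oo) lam (H `&` cbox k%:R))%E.
  rewrite measure_bigcup// [in LHS]eseries_mkcond; apply: eq_eseriesr => j _.
  by rewrite mem_setT; exact: lF.
apply/eqP; rewrite eq_le measure_ge0 andbT leNgt; apply/negP => m0.
have mfin : lam (H `&` cbox k%:R) \is a fin_num.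
  rewrite ge0_fin_numE ?measure_ge0//.
  by apply: lebesgue_bounded_lty (@subIsetr _ _ _).
have Ufin : lam (\bigcup_j F j) \is a fin_num by rewrite ge0_fin_numE ?measure_ge0.
set m := lam _ in m0 mfin sumF.
have hN N : N%:R * fine m <= fine (lam (\bigcup_j F j)).
  rewrite -lee_fin fineK// sumF EFinM fineK//.
  apply: le_trans (nneseries_lim_ge N _) => //.
  by rewrite -(fineK mfin) sumEFin -EFinM lee_fin sumr_const_nat subn0 mulr_natl.
  by move=> *; exact: ltW m0.
have m0' : 0 < fine m by rewrite -lte_fin fineK.
have := hN (Num.trunc (fine (lam (\bigcup_j F j)) / fine m)).+1.
rewrite leNgt => /negP; apply; rewrite -ltr_pdivrMr//.
exact: truncnS_gt.
Qed.

End qballs.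

(** * Elliptical laws *)

Section radial.
Import numFieldNormedType.Exports.
Context {R : realType} {p : nat}.
Local Notation lam := (lebesgue_col R p).
Local Open Scope ereal_scope.

(** The image of Lebesgue measure under the squared radius. Integrals of radial functions become
    integrals over the line against this measure. *)
Definition qlaw (M : 'M[R]_p) (mu : 'cV[R]_p) : {measure set (measurableTypeR R) -> \bar R} :=
  pushm lam (measurable_qf M mu).

Lemma qlaw_ray (M : 'M[R]_p) mu (u : R) : posdefmx M -> 
  qlaw M mu `]-oo, u[%classic = 
    (if (0 < u)%R then (Num.sqrt u ^+ p)%:E else 0) * lam (qball M mu 1).
Proof.
move=> pM; rewrite /qlaw pushmE.
have -> : (fun x : 'cV[R]_p => qf M (x - mu)) @^-1` `]-oo, u[ = qballo M mu u.
  by apply/seteqP; split=> x /=; rewrite in_itv.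
case: ifPn => u0; first by rewrite qballo_dilate// qballo1.
rewrite mul0e (_ : qballo M mu u = set0) ?measure0//.
apply/seteqP; split=> x //=; rewrite /qballo /= => h.
by move: u0; rewrite -leNgt => u0; have := lt_le_trans h u0; rewrite ltNge pd_psd.
Qed.

(* Both measures agree up to a factor on the intervals ]-oo, u[. *)
Lemma qlaw_prop (M M' : 'M[R]_p) mu mu' A : posdefmx M -> posdefmx M' -> measurable A ->
  qlaw M mu A = (fine (lam (qball M mu 1)) / fine (lam (qball M' mu' 1)))%:E * qlaw M' mu' A.
Proof.
move=> pM pM' mA.
have r0 N nu : posdefmx N -> (0 < fine (lam (qball N nu 1)))%R.
  by move=> pN; rewrite fine_gt0// qball_gt0 qball_lty.
have fin N nu : posdefmx N -> lam (qball N nu 1) \is a fin_num.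
  by move=> pN; rewrite ge0_fin_numE ?measure_ge0// qball_lty.
set c := (_ / _)%R; have c0 : (0 <= c)%R by rewrite divr_ge0// ltW// r0.
pose m : {measure set (measurableTypeR R) -> \bar R} := mscale (NngNum c0) (qlaw M' mu').
suff : qlaw M mu A = m A by [].
refine (@measure_unique _ R (measurableTypeR R) (@measurable_realfun.RGenInftyO.G R) (fun k =>
  `]-oo, k%:R[%classic%R) _ _ _ _ (qlaw M mu) m _ _ A mA) => //.
- exact: measurable_realfun.RGenInftyO.measurableE.
- move=> _ _ [x ->] [y ->]; exists (Num.min x y).
  by apply/seteqP; split=> z /=; rewrite !in_itv /= lt_min; [move=> [-> ->]|move=> /andP[]].
- by move=> k; exists k%:R%R.
- apply/seteqP; split=> // x _; exists (Num.trunc x).+1 => //=.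
  by rewrite in_itv /= truncnS_gt.
- move=> _ [u ->]; rewrite [RHS](_ : _ = c%:E * qlaw M' mu' `]-oo, u[%classic)//.
  rewrite !qlaw_ray//; case: ifPn => u0; last by rewrite !mul0e mule0.
  rewrite -(fineK (fin M mu pM)) -(fineK (fin M' mu' pM')) -!EFinM; congr EFin.
  by rewrite mulrCA /c divfK// gt_eqF// r0.
- move=> k; rewrite [X in X < _](_ : _ = qlaw M mu `]-oo, k%:R[%classic%R)// qlaw_ray//.
  by case: ifPn => u0; rewrite -(fineK (fin M mu pM)) -?EFinM ?mul0e ltry.
Qed.

End radial.

Section elliptical.
Import numFieldNormedType.Exports.
Context {R : realType} {p : nat} (g : R -> R).
Hypotheses (g_ell : elliptical_generator p g) (gG2 : condG2 g).
Local Notation lam := (lebesgue_col R p).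
Local Notation Prec th := (invmx th.2).

Lemma gen_ge0 t : 0 <= t -> 0 <= g t.
Proof. by case: g_ell => h _ _; exact: h. Qed.

Lemma gen_le s t : 0 <= s -> s <= t -> g t <= g s.
Proof. by case: g_ell => _ h _; exact: h. Qed.

(* [g] is only specified on the nonnegative reals. *)
Definition gabs (t : R) : R := g `|t|.

Lemma gabs_ge0 t : 0 <= gabs t. Proof. exact: gen_ge0. Qed.

Lemma gabs_le0 t : gabs t <= g 0. Proof. by apply: gen_le. Qed.

Lemma continuous_gabs : continuous gabs.
Proof.
move=> t A /= hA.
have h : (fun s : R => `|s|) @ t --> `|t| by exact: norm_continuous.
have t0 : `[0, +oo[%classic `|t| by rewrite /= in_itv /= andbT.
have /subspace_continuousP /(_ _ t0) /(_ A hA) hg := gG2.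
have hh : nbhs t [set s : R | `|s| \in `[0, +oo[ -> A (g `|s|)] := h _ hg.
change (nbhs t [set s : R | A (gabs s)]); move: hh.
by apply: filterS => s /=; apply; rewrite in_itv /= andbT.
Qed.

Lemma measurable_gabs : measurable_fun [set: measurableTypeR R] (gabs : measurableTypeR R -> R).
Proof. exact: measurable_realfun.continuous_measurable_fun continuous_gabs. Qed.

Lemma elliptical_pdfE th x : Theta R p th ->
  elliptical_pdf g th x = (Num.sqrt (\det th.2))^-1 * gabs (qf (Prec th) (x - th.1)).
Proof.
by move=> pth; rewrite /elliptical_pdf /gabs ger0_norm//; exact: pd_psd (pd_inv pth).
Qed.

Lemma elliptical_pdf_ge0 th x : Theta R p th -> 0 <= elliptical_pdf g th x.
Proof. by move=> pth; rewrite elliptical_pdfE// mulr_ge0 ?invr_ge0 ?sqrtr_ge0 ?gabs_ge0. Qed.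

Lemma continuous_elliptical_pdf th : Theta R p th -> continuous (elliptical_pdf g th).
Proof.
move=> pth; rewrite (_ : elliptical_pdf g th = fun x =>
  (Num.sqrt (\det th.2))^-1 * gabs (qf (Prec th) (x - th.1))); last first.
  by apply/funext => x; rewrite elliptical_pdfE.
move=> x; have h : {for qf (Prec th) (x - th.1), continuous gabs} by exact: continuous_gabs.
exact: (cvgM (cvg_cst _) (continuous_cvg _ h (@continuous_qf R p (Prec th) th.1 x))).
Qed.

Lemma measurable_elliptical_pdf th : Theta R p th ->
  measurable_fun [set: 'cV[R]_p] (elliptical_pdf g th).
Proof. by move=> pth; apply: continuous_measurable_col; exact: continuous_elliptical_pdf. Qed.

(** Read off the normalization: for a nonpositive determinant [Num.sqrt] is 0, its inverse is 0 as
    well, and the density could not integrate to 1. *)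
Lemma det_gt0 th : Theta R p th -> 0 < \det th.2.
Proof.
move=> pth; rewrite ltNge; apply/negP => d0.
have := g_ell; case=> _ _ /(_ th pth); rewrite /elliptical_prob.
under eq_integral do rewrite /elliptical_pdf ler0_sqrtr// invr0 mul0r.
by rewrite integral0 => /eqP; rewrite eq_sym onee_eq0.
Qed.

Lemma sqrt_det_gt0 th : Theta R p th -> 0 < Num.sqrt (\det th.2).
Proof. by move=> pth; rewrite sqrtr_gt0 det_gt0. Qed.

Definition uvol (th : 'cV[R]_p * 'M[R]_p) : R := fine (lam (qball (Prec th) th.1 1)).

Lemma uvol_gt0 th : Theta R p th -> 0 < uvol th.
Proof. by move=> pth; rewrite fine_gt0// qball_gt0 qball_lty//; exact: pd_inv. Qed.

Lemma uvolE th : Theta R p th -> lam (qball (Prec th) th.1 1) = (uvol th)%:E.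
Proof.
move=> pth; rewrite /uvol fineK// ge0_fin_numE ?measure_ge0// qball_lty//; exact: pd_inv.
Qed.

(** The right-hand integral is taken for a fixed reference [th1], so that the dependence on [th] is
    confined to an explicit factor. *)
Lemma radial_prob th th1 B : Theta R p th -> Theta R p th1 -> measurable B ->
  elliptical_prob g th ((fun x => qf (Prec th) (x - th.1)) @^-1` B) =
  (((Num.sqrt (\det th.2))^-1 * (uvol th / uvol th1))%:E *
    \int[qlaw (Prec th1) th1.1]_(t in B) (gabs t)%:E)%E.
Proof.
move=> pth pth1 mB; rewrite /elliptical_prob.
have mg D : measurable_fun D (fun t : measurableTypeR R => (gabs t)%:E).
  by apply/measurable_EFinP; apply: measurable_funTS; exact: measurable_gabs.
have c0 : 0 <= uvol th / uvol th1 by rewrite divr_ge0// ltW// uvol_gt0.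
have -> : (\int[lam]_(x in (fun x => qf (Prec th) (x - th.1)) @^-1` B) (elliptical_pdf g th x)%:E =
  \int[lam]_(x in (fun x => qf (Prec th) (x - th.1)) @^-1` B) 
   ((Num.sqrt (\det th.2))^-1%:E * ((fun t => (gabs t)%:E) \o (fun x =>
     qf (Prec th) (x - th.1))) x))%E.
  by apply: eq_integral => x _; rewrite elliptical_pdfE// EFinM.
have mq : measurable ((fun x : 'cV[R]_p => qf (Prec th) (x - th.1)) @^-1` B).
  by rewrite -[X in measurable X]setTI; exact: measurable_qf.
rewrite ge0_integralZl_EFin ?invr_ge0 ?sqrtr_ge0//; last 2 first.
- by move=> x _; rewrite lee_fin gabs_ge0.
- apply: (measurableT_comp (mg setT)); apply: measurable_funTS; exact: measurable_qf.
rewrite EFinM -muleA; congr (_ * _)%E.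
rewrite -(ge0_integral_pushforward (measurable_qf (Prec th) th.1) lam mB (mg B)); last first.
  by move=> t _; rewrite lee_fin gabs_ge0.
rewrite -[LHS]/(\int[qlaw (Prec th) th.1]_(t in B) (gabs t)%:E)%E.
rewrite -(@ge0_integral_mscale _ _ _ (qlaw (Prec th1) th1.1) B mB (NngNum c0))//; last first.
  by move=> t _; rewrite lee_fin gabs_ge0.
apply: eq_measure_integral => A mA AB.
rewrite [RHS](_ : _ = (uvol th / uvol th1)%:E * qlaw (Prec th1) th1.1 A)%E//.
by apply: qlaw_prop => //; exact: pd_inv.
Qed.

(** Take B to be the whole line in [radial_prob]: both total masses are 1 and share the same radial
    integral, so the factors in front of it agree. This stands in for a linear change of
    variables. *)
Lemma uvol_prop th th1 : Theta R p th -> Theta R p th1 ->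
  uvol th / Num.sqrt (\det th.2) = uvol th1 / Num.sqrt (\det th1.2).
Proof.
move=> pth pth1.
have h t : Theta R p t -> (((Num.sqrt (\det t.2))^-1 * (uvol t / uvol th1))%:E *
    \int[qlaw (Prec th1) th1.1]_t (gabs t)%:E)%E = 1%E.
  move=> pt; rewrite -radial_prob// preimage_setT.
  by have [_ _] := g_ell; apply.
have h1 := h _ pth1; have h0 := h _ pth.
have u1 := uvol_gt0 pth1; have u0 := uvol_gt0 pth.
have s1 := sqrt_det_gt0 pth1; have s0 := sqrt_det_gt0 pth.
move: h1 h0; set I := (\int[_]_t _)%E.
have I0 : (0 <= I)%E by apply: integral_ge0 => t _; rewrite lee_fin gabs_ge0.
case: I I0 => [r|//|//]; last first.
  by move=> _; rewrite gt0_muley// lte_fin mulr_gt0 ?invr_gt0// divr_gt0.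
rewrite lee_fin => r0; rewrite -!EFinM => -[] h1 -[] h0.
have r1 : r = Num.sqrt (\det th1.2).
  by move: h1; rewrite divff ?gt_eqF// mulr1 => /(canRL (mulVKf _)) ->; rewrite ?mulr1// gt_eqF.
have : uvol th / Num.sqrt (\det th.2) = uvol th1 / r.
  have rn0 : r != 0 by rewrite r1 gt_eqF.
  have un : uvol th1 != 0 by rewrite gt_eqF.
  have sn : Num.sqrt (\det th.2) != 0 by rewrite gt_eqF.
  apply: (mulIf rn0); rewrite divfK//; apply: (mulIf (invr_neq0 un)); rewrite divff// -[RHS]h0.
  by field; rewrite ?sn ?un.
by rewrite r1.
Qed.

(** The squared Mahalanobis distance is a pivot: its law under [th] does not depend on [th]. *)
Lemma radial_prob_eq th th1 B : Theta R p th -> Theta R p th1 -> measurable B ->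
  elliptical_prob g th ((fun x => qf (Prec th) (x - th.1)) @^-1` B) =
  elliptical_prob g th1 ((fun x => qf (Prec th1) (x - th1.1)) @^-1` B).
Proof.
move=> pth pth1 mB; rewrite (radial_prob pth pth1 mB) (radial_prob pth1 pth1 mB).
congr (_%:E * _)%E; rewrite divff ?gt_eqF ?uvol_gt0// mulr1 mulrA (mulrC _ (uvol th)).
by rewrite (uvol_prop pth pth1) mulrAC divff ?mul1r// gt_eqF// uvol_gt0.
Qed.

End elliptical.

(** * The strong law for indicators *)

Section second_moment.
Context d (T : measurableType d) {R : realType} (Pr : probability T R).
Variables (E : nat -> set T) (q : R).
Hypotheses (mE : forall i, measurable (E i)) (PE : forall i, Pr (E i) = q%:E)
  (PEE : forall i j, i != j -> Pr (E i `&` E j) = (q * q)%:E).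
Implicit Type n : nat.

Definition hits n (w : T) : R := \sum_(i < n) \1_(E i) w.

Lemma measurable_hits n : measurable_fun [set: T] (hits n).
Proof. by apply: measurable_sum => i; exact: measurable_indic. Qed.

Lemma hits_ge0 n w : 0 <= hits n w.
Proof. by apply: sumr_ge0 => i _; rewrite indicE ler0n. Qed.

Lemma q_ge0 : 0 <= q.
Proof. by rewrite -lee_fin -(PE 0). Qed.

Lemma hits_sq n : (\int[Pr]_w ((hits n w - n%:R * q) ^+ 2)%:E <= n%:R%:E)%E.
Proof.
have q0 := q_ge0.
have m2 : measurable_fun [set: T] (fun w => ((hits n w - n%:R * q) ^+ 2)%:E).
  apply/measurable_EFinP; apply: measurable_funX; apply: measurable_funB => //;
    exact: measurable_hits.
(* Moving the cross term of the square to the left keeps all integrands nonnegative, so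
   integrability never has to be discussed. *)
have i1 : (\int[Pr]_w (((hits n w - n%:R * q) ^+ 2)%:E + (2 * n%:R * q * hits n w)%:E) =
   \int[Pr]_w ((\sum_(i < n) \sum_(j < n) (\1_(E i `&` E j) w)%:E) + ((n%:R * q) ^+ 2)%:E))%E.
  apply: eq_integral => w _.
  have -> : (\sum_(i < n) \sum_(j < n) (\1_(E i `&` E j) w)%:E = (hits n w ^+ 2)%:E)%E.
    under eq_bigr do rewrite sumEFin; rewrite sumEFin; congr EFin.
    rewrite expr2 /hits mulr_suml; apply: eq_bigr => i _; rewrite mulr_sumr.
    by apply: eq_bigr => j _; rewrite indicI.
  by rewrite -!EFinD; congr EFin; ring.
have mh : measurable_fun [set: T] (fun w => (2 * n%:R * q * hits n w)%:E).
  by apply/measurable_EFinP; apply: measurable_funM => //; exact: measurable_hits.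
move: i1; rewrite ge0_integralD//=; last 2 first.
- by move=> w _; rewrite lee_fin sqr_ge0.
- by move=> w _; rewrite lee_fin mulr_ge0 ?hits_ge0// !mulr_ge0.
rewrite ge0_integralD//=; last 3 first.
- by move=> w _; apply: sume_ge0 => i _; apply: sume_ge0 => j _; rewrite lee_fin indicE.
- apply: emeasurable_sum => i; apply: emeasurable_sum => j; apply/measurable_EFinP.
  by apply: measurable_indic; exact: measurableI.
- by move=> w _; rewrite lee_fin sqr_ge0.
rewrite integral_cst// [X in (_ + X)%E = _ -> _](_ : _ = (2 * (n%:R * q) ^+ 2)%:E); last first.
  under eq_integral do rewrite EFinM.
  rewrite ge0_integralZl_EFin ?mulr_ge0//; last 2 first.
  - by move=> w _; rewrite lee_fin hits_ge0.
  - by apply/measurable_EFinP; exact: measurable_hits.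
  under eq_integral do rewrite /hits -sumEFin.
  rewrite ge0_integral_sum//; last first.
  - by move=> i; apply/measurable_EFinP; exact: measurable_indic.
  rewrite (eq_bigr (fun=> q%:E)); last by move=> i _; rewrite integral_indic// setIT; exact: PE.
  by rewrite sumEFin sumr_const card_ord -EFinM; congr EFin; rewrite -mulr_natl; ring.
rewrite ge0_integral_sum//; last 2 first.
- move=> i; apply: emeasurable_sum => j; apply/measurable_EFinP.
  by apply: measurable_indic; exact: measurableI.
- by move=> i w _; apply: sume_ge0 => j _; rewrite lee_fin indicE.
have -> : (\sum_(i < n) \int[Pr]_w \sum_(j < n) (\1_(E i `&` E j) w)%:E =
   (\sum_(i < n) (q + (n%:R - 1) * (q * q)))%:E)%E.
  rewrite -sumEFin; apply: eq_bigr => i _.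
  rewrite ge0_integral_sum//; last first.
  - by move=> j; apply/measurable_EFinP; apply: measurable_indic; exact: measurableI.
  rewrite (bigD1 i)//= [X in (X + _)%E](_ : _ = q%:E); last first.
    by rewrite setIid integral_indic// setIT; exact: PE.
  rewrite EFinD; congr (_ + _)%E.
  rewrite (eq_bigr (fun=> (q * q)%:E)); last first.
    move=> j ji; rewrite integral_indic ?setIT//; last exact: measurableI.
    by apply: PEE; rewrite eq_sym.
  rewrite sumEFin sumr_const -(mulr_natl (q * q)); congr EFin; congr (_ * _).
  rewrite (_ : #|_| = n.-1); last by rewrite -[in RHS](card_ord n) -(cardC1 i); apply: eq_card.
  by case: n i {mh m2} => [[]//|m _]; rewrite -natr1 addrK.
rewrite [X in (_ * X)%E](_ : _ = 1%E); last exact: probability_setT.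
rewrite mule1.
set I := (\int[_]__ _)%E.
have I0 : (0 <= I)%E by apply: integral_ge0 => w _; rewrite lee_fin sqr_ge0.
case: I I0 => [r||]//; rewrite -!EFinD// => r0 [].
rewrite sumr_const card_ord -(mulr_natl (q + _)) lee_fin => e.
have -> : r = n%:R * q - n%:R * (q * q).
  by apply: (addIr (2 * (n%:R * q) ^+ 2)); rewrite e; ring.
have q1 : q <= 1 by rewrite -lee_fin -(PE 0); exact: probability_le1.
have n0 : 0 <= n%:R :> R by [].
by nra.
Qed.

Lemma hits_tail n e : 0 < e -> (0 < n)%N ->
  (Pr [set w | (hits n w <= n%:R * (q - e))%R] <= ((n%:R * e ^+ 2)^-1)%:E)%E.
Proof.
move=> e0 n0; set D := [set w | _].
have n0' : 0 < n%:R :> R by rewrite ltr0n.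
have mD : measurable D.
  rewrite -[D]setTI; apply: measurable_fun_le => //; exact: measurable_hits.
have m2 : measurable_fun [set: T] (fun w => ((hits n w - n%:R * q) ^+ 2)%:E).
  apply/measurable_EFinP; apply: measurable_funX; apply: measurable_funB => //;
    exact: measurable_hits.
have c0 : 0 < (n%:R * e) ^+ 2 by rewrite exprn_gt0// mulr_gt0.
have h : (((n%:R * e) ^+ 2)%:E * Pr D <= n%:R%:E)%E.
  rewrite -integral_cst//; apply: le_trans (hits_sq n).
  apply: (@le_trans _ _ (\int[Pr]_(w in D) ((hits n w - n%:R * q) ^+ 2)%:E)%E).
    apply: ge0_le_integral => //.
    - by move=> w _; rewrite lee_fin ltW.
    - exact: measurable_funTS.
    - move=> w; rewrite /D /= => wD; rewrite lee_fin -[leRHS]sqrrN opprB.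
      have h1 : n%:R * e <= n%:R * q - hits n w by move: wD; rewrite mulrBr; lra.
      have h2 : 0 <= n%:R * e by rewrite mulr_ge0// ltW.
      by rewrite ler_sqr// nnegrE; apply: le_trans h2 _.
  by apply: ge0_subset_integral => // w _; rewrite lee_fin sqr_ge0.
move: h; have : Pr D \is a fin_num by exact: fin_num_measure.
move: (Pr D) => [r _||//]; rewrite -?EFinM ?lee_fin// => h.
have ee : (n%:R * e) ^+ 2 = n%:R * (n%:R * e ^+ 2) by ring.
have c1 : 0 < n%:R * e ^+ 2 by rewrite mulr_gt0// exprn_gt0.
rewrite -[_^-1]mul1r ler_pdivlMr// -(ler_pM2l n0') mulr1 (mulrC r) mulrA -ee//.
Qed.

(** Comparison with the telescoping differences 1 / k - 1 / (k + 1). *)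
Lemma sum_inv_sq n : \sum_(k < n.+1) (k.+1%:R ^+ 2)^-1 <= 2 - (n.+1%:R)^-1 :> R.
Proof.
elim: n => [|n IH]; first by rewrite big_ord1 expr1n invr1; lra.
rewrite big_ord_recr /=; apply: le_trans (lerD IH (lexx _)) _.
rewrite -subr_ge0 [X in 0 <= X](_ : _ = ((n.+1%:R * n.+2%:R ^+ 2)^-1 : R)) ?invr_ge0//.
have -> : n.+2%:R = n.+1%:R + 1 :> R by rewrite natr1.
have : 0 < n.+1%:R :> R by []. 
by set a : R := n.+1%:R => a0; field; rewrite !gt_eqF//; lra.
Qed.

(** Along the squares the Chebyshev bound of [hits_tail] is summable, and Borel-Cantelli applies. *)
Lemma ae_hits e : 0 < e ->
  {ae Pr, forall w, \forall k \near \oo, (k.+1 ^ 2)%:R * (q - e) < hits (k.+1 ^ 2) w}.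
Proof.
move=> e0; pose F k := [set w | (hits (k.+1 ^ 2) w <= (k.+1 ^ 2)%:R * (q - e))%R].
have mF k : measurable (F k).
  by rewrite -[F k]setTI; apply: measurable_fun_le => //; exact: measurable_hits.
have l0 : Pr (lim_sup_set F) = 0%E.
  apply: lim_sup_set_cvg0 => //.
  apply: (@le_lt_trans _ _ (2 / e ^+ 2)%:E); last exact: ltry.
  apply: lime_le; first by apply: is_cvg_nneseries => *.
  apply: nearW => n.
  apply: (@le_trans _ _ (\sum_(0 <= k < n) ((k.+1%:R ^+ 2)^-1 / e ^+ 2)%:E)%E).
    apply: lee_sum => k _; apply: le_trans (hits_tail e0 _) _; first by rewrite expn_gt0.
    by rewrite lee_fin invfM natrX.
  rewrite sumEFin lee_fin -mulr_suml ler_pM2r ?invr_gt0 ?exprn_gt0// big_mkord.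
  case: n => [|n]; first by rewrite big_ord0.
  by apply: le_trans (sum_inv_sq n) _; rewrite gerBl invr_ge0.
exists (lim_sup_set F); split=> //.
  by apply: bigcap_measurable => // n _; exact: bigcup_measurable.
move=> w /= nw n _; apply: contrapT => h; apply: nw; exists n => // k /= nk.
by rewrite ltNge; apply/negP => h'; apply: h; exists k.
Qed.

(** Between two consecutive squares the counts are monotone. Only the lower half of the strong law
    is needed: it is applied to open sets and passed to closed ones by complementation. *)
Lemma ae_hits_liminf : {ae Pr, forall w e, 0 < e ->
  \forall n \near \oo, n%:R * (q - e) <= hits n w}.
Proof.
have : {ae Pr, forall w (m : nat), \forall k \near \oo,
    (k.+1 ^ 2)%:R * (q - m.+1%:R^-1) < hits (k.+1 ^ 2) w}.
  by apply: ae_foralln => m; apply: ae_hits; rewrite invr_gt0.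
apply: filterS => w h e e0.
pose m := Num.trunc (2 / e); pose dl : R := m.+1%:R^-1.
have dl0 : 0 < dl by rewrite invr_gt0.
have dle : dl <= e / 2.
  by rewrite /dl -[e / 2]invrK invfM invrK mulrC lef_pV2 ?posrE ?divr_gt0// ltW// truncnS_gt.
have [K _ hK] := h m.
pose K' := maxn K (Num.trunc (3 / dl)).
exists (K'.+1 ^ 2)%N => // n /= Kn.
have [k k1 k2] : exists2 k, (k.+1 ^ 2 <= n)%N & (n < k.+2 ^ 2)%N.
  have : exists k, (k.+1 ^ 2 <= n)%N by exists K'.
  move=> ex; have ub k : (k.+1 ^ 2 <= n)%N -> (k <= n)%N.
    move=> h'; apply: leq_trans h'; rewrite -mulnn mulSn.
    exact: leq_trans (leqnSn _) (leq_addr _ _).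
  case: (ex_maxnP ex ub) => k kn kmax; exists k => //.
  by rewrite ltnNge; apply/negP => /kmax; rewrite ltnn.
have Kk : (K' <= k)%N.
  have := leq_ltn_trans Kn k2; rewrite ltn_exp2r// ltnS; by [].
have hk := hK k (leq_trans (leq_maxl _ _) Kk).
have mono : hits (k.+1 ^ 2) w <= hits n w.
  rewrite /hits -(big_mkord xpredT (fun i => \1_(E i) w)) -(big_mkord xpredT (fun i => \1_(E i) w)).
  rewrite [leRHS](@big_cat_nat _ _ _ (k.+1 ^ 2)%N)//= lerDl sumr_ge0// => i _; by rewrite indicE.
have [q0|q0] := leP (q - dl) 0.
  apply: (@le_trans _ _ 0); last exact: hits_ge0.
  by rewrite mulr_ge0_le0// ; lra.
apply: le_trans mono; apply: le_trans (ltW hk).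
have q1 : q <= 1 by rewrite -lee_fin -(PE 0); exact: probability_le1.
(* With a = k + 1, replacing n by the square below it costs at most 2 a + 1 <= 3 a, which is
   absorbed by dl * a ^ 2 as soon as dl * a >= 3. *)
have kd : 3 <= dl * k.+1%:R.
  rewrite mulrC -ler_pdivrMr//; apply: ltW; apply: lt_le_trans (truncnS_gt _) _.
  by rewrite ler_nat ltnS (leq_trans (leq_maxr _ _) Kk).
have n2 : n%:R <= k.+2%:R ^+ 2 :> R by rewrite -natrX ler_nat ltnW.
have [qe|qe] := leP (q - e) 0.
  apply: (@le_trans _ _ 0); first by rewrite mulr_ge0_le0.
  by rewrite mulr_ge0// ltW.
apply: (@le_trans _ _ (k.+2%:R ^+ 2 * (q - e))); first by rewrite ler_pM2r.
rewrite natrX; set a : R := k.+1%:R.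
have -> : k.+2%:R = a + 1 :> R by rewrite /a natr1.
have a1 : 1 <= a by rewrite ler1n.
have h1 : 3 * a <= a * a * dl by rewrite -mulrA mulrC ler_pM2l ?(mulrC a)//; lra.
have h2 : (2 * a + 1) * (q - e) <= 2 * a + 1 by rewrite ger_pMr; lra.
have h3 : a * a * dl <= a * a * (e - dl) by rewrite ler_pM2l ?mulr_gt0//; lra.
have -> : (a + 1) ^+ 2 * (q - e) = a * a * (q - dl) - a * a * (e - dl) + (2 * a + 1) * (q - e)
  by ring.
by rewrite expr2 -/dl; lra.
Qed.

End second_moment.

Section empirical.
Import numFieldNormedType.Exports.
Context {R : realType} {p : nat}.

Definition Pn (x : nat -> 'cV[R]_p) n (B : set 'cV[R]_p) : R :=
  n%:R^-1 * \sum_(i < n) \1_B (x i).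

Lemma emp_probE x n B : emp_prob x n B = (Pn x n B)%:E.
Proof. by rewrite /emp_prob /emp_mean sumEFin. Qed.

Lemma PnS x n B C : B `<=` C -> Pn x n B <= Pn x n C.
Proof.
move=> BC; rewrite /Pn ler_wpM2l ?invr_ge0//; apply: ler_sum => i _.
by rewrite !indicE; case: (boolP (x i \in B)) => [/set_mem /BC /mem_set ->|_]//; rewrite ler0n.
Qed.

Lemma PnC x n B : (0 < n)%N -> Pn x n (~` B) = 1 - Pn x n B.
Proof.
move=> n0; have n0' : n%:R != 0 :> R by rewrite pnatr_eq0 -lt0n.
have -> : (1 : R) = n%:R^-1 * \sum_(i < n) 1 by rewrite sumr_const card_ord -mulr_natl mulr1 mulVf.
rewrite /Pn -mulrBr -sumrB; congr (_ * _); apply: eq_bigr => i _.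
by rewrite !indicE in_setC; case: (_ \in B); rewrite /= ?subrr ?subr0.
Qed.

Lemma PnU x n B C : Pn x n (B `|` C) <= Pn x n B + Pn x n C.
Proof.
rewrite /Pn -mulrDr ler_wpM2l ?invr_ge0// -big_split /=; apply: ler_sum => i _.
rewrite !indicE in_setU -natrD ler_nat; by case: (_ \in B); case: (_ \in C).
Qed.

(** The closed-set condition of the portmanteau theorem, for one sample path. The closed sets used
    later depend on that path, so they are quantified inside. *)
Definition weak_limsup (x : nat -> 'cV[R]_p) (P : set 'cV[R]_p -> \bar R) :=
  forall C, closed C -> forall e : R, 0 < e ->
    \forall n \near \oo, Pn x n C <= fine (P C) + e.

Definition rbox_union (s : seq nat) : set 'cV[R]_p := \big[setU/set0]_(i <- s) rbox_of i.

Lemma measurable_rbox_union s : measurable (rbox_union s).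
Proof.
by rewrite /rbox_union; elim/big_ind : _ => //[A B|i _];
  [exact: measurableU|exact: measurable_rbox_of].
Qed.

Lemma fin_num_probability d (T : measurableType d) (P : probability T R) B : 
  measurable B -> P B = (fine (P B))%:E.
Proof. by move=> mB; rewrite fineK// fin_num_measure. Qed.

Lemma open_rbox_union_approx (P : probability 'cV[R]_p R) O (e : R) : open O -> 0 < e ->
  exists2 s, rbox_union s `<=` O & fine (P O) - e < fine (P (rbox_union s)).
Proof.
move=> oO e0; have mO := open_measurable_col oO.
pose s N := [seq i <- iota 0 N | `[< rbox_of i `<=` O >] ].
have sO N : rbox_union (s N) `<=` O.
  rewrite /rbox_union big_filter => v.
  elim/big_ind : _ => [//|A B hA hB []//|i /asboolP iO]; exact: iO.
pose F N := rbox_union (s N).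
have FE N : F N = \big[setU/set0]_(i < N) (if `[< rbox_of i `<=` O >] then rbox_of i else set0).
  by rewrite /F /rbox_union big_filter -[X in iota 0 X]subn0 -big_mkcond /= -(big_mkord (fun i =>
    `[< rbox_of i `<=` O >]) (@rbox_of R p)).
have UF : \bigcup_N F N = O.
  apply/seteqP; split=> [v [N _] /sO//|v Ov].
  move: (Ov); rewrite [in X in X -> _](open_rbox_bigcup oO) => -[n /= nO nv].
  exists n.+1 => //; rewrite FE -(bigcup_mkord n.+1 (fun i =>
    if `[< rbox_of i `<=` O >] then rbox_of i else set0)).
  exists n => //=.
  by case: asboolP.
have : P (F N) @[N --> \oo] --> P O.
  rewrite -UF; apply: nondecreasing_cvg_mu.
  - by move=> N; exact: measurable_rbox_union.
  - by apply: bigcupT_measurable => N; exact: measurable_rbox_union.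
  - move=> m n mn; apply/subsetPset; rewrite !FE.
    rewrite -!(bigcup_mkord _ (fun i => if `[< rbox_of i `<=` O >] then rbox_of i else set0)).
    by move=> v [i /= im iv]; exists i => //=; exact: leq_trans im mn.
rewrite (fin_num_probability P mO) => /fine_cvgP[_ /cvgrPdist_lt /(_ e e0) [N _ /(_ N (leqnn _))
  /=]].
rewrite ltr_norml => /andP[_ h]; exists (s N); first exact: sO.
rewrite -/(F N); lra.
Qed.

(** There are countably many finite unions of rational boxes, so the strong law holds for all of
    them off a single null set. Such unions exhaust the complement of a closed set from inside,
    which bounds the empirical mass of the closed set from above. *)
Lemma ae_weak_limsup (P : probability 'cV[R]_p R) d (T : measurableType d)
    (Pr : probability T R) (X : nat -> {RV Pr >-> 'cV[R]_p}) :
  random_sample P X -> {ae Pr, forall w, weak_limsup (X^~ w) P}.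
Proof.
move=> [Xind Xdist].
have h s : {ae Pr, forall w (e : R), 0 < e -> \forall n \near \oo,
    n%:R * (fine (P (rbox_union s)) - e) <= \sum_(i < n) \1_(rbox_union s) (X i w)}.
  have mB := measurable_rbox_union s; set B := rbox_union s in mB *.
  pose E i := X i @^-1` B.
  have mE i : measurable (E i) by rewrite /E -[X in measurable X]setTI; exact: measurable_funP.
  have PE i : Pr (E i) = (fine (P B))%:E.
    by rewrite -fin_num_probability// -(Xdist i).
  have PEE i j : i != j -> Pr (E i `&` E j) = (fine (P B) * fine (P B))%:E.
    move=> ij; have := Xind [fset i; j]%fset (fun=> B) (fun=> mB).
    rewrite big_fsetU1/= ?inE// big_seq_fset1 -/(E i) -/(E j) !PE EFinM => <-.
    congr (Pr _); apply/seteqP; split=> w /=.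
      by move=> [wi wj] k /=; rewrite !inE => /orP[] /eqP ->.
    by move=> hk; split; apply: hk; rewrite /= !inE eqxx ?orbT.
  exact: (ae_hits_liminf mE PE PEE).
have : {ae Pr, forall w (k : nat), forall (e : R), 0 < e -> \forall n \near \oo,
    n%:R * (fine (P (rbox_union (odflt [::] (@choice.unpickle (seq nat) k)))) - e) <=
    \sum_(i < n) \1_(rbox_union (odflt [::] (@choice.unpickle (seq nat) k))) (X i w)}.
  by apply: ae_foralln => k; exact: h.
apply: filterS => w hw C cC e e0.
have oC : open (~` C) by exact: closed_openC.
have mC : measurable C by exact: closed_measurable_col.
have [s sC sP] := open_rbox_union_approx P oC (divr_gt0 e0 (ltr0n R 2)).
have := hw (choice.pickle s) (e / 2) (divr_gt0 e0 (ltr0n R 2)).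
rewrite choice.pickleK /= => hs; near=> n.
have n0 : (0 < n)%N by near: n; exists 1%N.
have n0' : 0 < n%:R :> R by rewrite ltr0n.
have h1 : fine (P (rbox_union s)) - e / 2 <= Pn (X^~ w) n (rbox_union s).
  rewrite /Pn [leRHS]mulrC ler_pdivlMr// mulrC; near: n; exact: hs.
have := le_trans h1 (PnS (X^~ w) n sC); rewrite PnC// => h2.
have : fine (P (~` C)) = 1 - fine (P C).
  rewrite probability_setC// (fin_num_probability P mC) -EFinB //=.
lra.
Unshelve. all: by end_near. Qed.

End empirical.

(** * The population ellipsoid *)

Section fine_measure.
Context d (T : measurableType d) (R : realType) (mu : {measure set T -> \bar R}).
Implicit Types B C : set T.

Lemma fine_measureDI B C : measurable B -> measurable C -> (mu B < +oo)%E ->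
  fine (mu B) = fine (mu (B `&` C)) + fine (mu (B `\` C)).
Proof.
move=> mB mC Boo.
have mI : measurable (B `&` C) by exact: measurableI.
have mD : measurable (B `\` C) by exact: measurableD.
have fI : mu (B `&` C) \is a fin_num.
  by rewrite ge0_fin_numE//; apply: le_lt_trans Boo; apply: le_measureS => //; exact: subIsetl.
have fD : mu (B `\` C) \is a fin_num.
  by rewrite ge0_fin_numE//; apply: le_lt_trans Boo; apply: le_measureS => //; exact: subDsetl.
rewrite -fineD// addeC; congr fine; exact: measureDI.
Qed.

Lemma fine_measureS B C : measurable B -> measurable C -> (mu C < +oo)%E ->
  B `<=` C -> fine (mu B) <= fine (mu C).
Proof.
move=> mB mC Coo BC; have h : (mu B <= mu C)%E by exact: le_measureS.
by apply: fine_le => //; rewrite ge0_fin_numE//; exact: le_lt_trans Coo.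
Qed.

End fine_measure.

Lemma fine_probabilityS d (T : measurableType d) (R : realType) (m : probability T R) B C :
  measurable B -> measurable C -> B `<=` C -> fine (m B) <= fine (m C).
Proof.
move=> mB mC BC; apply: fine_measureS => //.
by rewrite -ge0_fin_numE// fin_num_measure.
Qed.

Section elliptical_measure.
Import numFieldNormedType.Exports.
Context {R : realType} {p : nat} (g : R -> R).
Hypotheses (g_ell : elliptical_generator p g) (gG2 : condG2 g).
Local Notation lam := (lebesgue_col R p).
Local Notation Prec th := (invmx th.2).

(** Makes the lemmas on probabilities available by rewriting, while the set function
    [elliptical_prob] remains the one in the statements. *)
Lemma elliptical_probability th : Theta R p th ->
  exists m : probability 'cV[R]_p R, forall B, m B = elliptical_prob g th B.
Proof.
move=> pth.
have f0 x : (0 <= (elliptical_pdf g th x)%:E)%E by rewrite lee_fin; exact: elliptical_pdf_ge0.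
have mf : measurable_fun [set: 'cV[R]_p] (fun x => (elliptical_pdf g th x)%:E).
  by apply/measurable_EFinP; exact: measurable_elliptical_pdf.
have s0 : elliptical_prob g th set0 = 0%E by rewrite /elliptical_prob integral_set0.
have s1 A : (0 <= elliptical_prob g th A)%E by apply: integral_ge0.
have s2 : semi_sigma_additive (elliptical_prob g th).
  exact: semi_sigma_additive_nng_induced.
have sT : elliptical_prob g th setT = 1%E by case: g_ell => _ _; apply.
pose mm := isMeasure.Build _ _ _ (elliptical_prob g th) s0 s1 s2.
pose m : {measure set 'cV[R]_p -> \bar R} := HB.pack (elliptical_prob g th) mm.
pose pp := @Measure_isProbability.Build _ _ R m sT.
pose P : probability 'cV[R]_p R := HB.pack (elliptical_prob g th) mm pp.
by exists P.
Qed.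

Lemma elliptical_prob_ge th B (c : R) : Theta R p th -> measurable B -> 0 <= c ->
  (forall x, B x -> c <= elliptical_pdf g th x) ->
  (c%:E * lam B <= elliptical_prob g th B)%E.
Proof.
move=> pth mB c0 h; rewrite /elliptical_prob -integral_cst//.
apply: ge0_le_integral => //.
- by apply/measurable_EFinP; apply: measurable_funTS; exact: measurable_elliptical_pdf.
Qed.

Lemma elliptical_prob_le th B (c : R) : Theta R p th -> measurable B -> 
  (forall x, B x -> elliptical_pdf g th x <= c) ->
  (elliptical_prob g th B <= c%:E * lam B)%E.
Proof.
move=> pth mB h; rewrite /elliptical_prob -integral_cst//.
apply: ge0_le_integral => //.
- by move=> x _; rewrite lee_fin; exact: elliptical_pdf_ge0.
- by apply/measurable_EFinP; apply: measurable_funTS; exact: measurable_elliptical_pdf.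
Qed.

Lemma elliptical_pdf_ub th x : Theta R p th ->
  elliptical_pdf g th x <= (Num.sqrt (\det th.2))^-1 * g 0.
Proof.
by move=> pth; rewrite elliptical_pdfE// ler_wpM2l ?invr_ge0 ?sqrtr_ge0//; exact: (gabs_le0 g_ell).
Qed.

Lemma elliptical_prob_null th B : Theta R p th -> measurable B -> lam B = 0%E ->
  elliptical_prob g th B = 0%E.
Proof.
move=> pth mB B0; apply/eqP; rewrite eq_le; apply/andP; split; last first.
  by apply: integral_ge0 => x _; rewrite lee_fin; exact: elliptical_pdf_ge0.
apply: le_trans (elliptical_prob_le pth mB (fun x _ => elliptical_pdf_ub x pth)) _.
by rewrite B0 mule0.
Qed.

Lemma root_pos (c : R) : (0 < p)%N -> 0 < c -> exists2 s : R, 0 < s & s ^+ p = c.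
Proof.
move=> p0 c0; exists (c `^ p%:R^-1); first exact: powR_gt0.
rewrite -powR_mulrn ?powR_ge0// -powRrM mulVf ?powRr1 ?(ltW c0)//.
by rewrite pnatr_eq0 -lt0n.
Qed.

Lemma qball_vol th u : Theta R p th -> 0 < u ->
  lam (qball (Prec th) th.1 u) = (Num.sqrt u ^+ p * uvol th)%:E.
Proof. by move=> pth u0; rewrite qball_dilate// uvolE. Qed.

Lemma ellipsoidE (mu : 'cV[R]_p) S r : ellipsoid mu S r = qball (invmx S) mu (r ^+ 2).
Proof. by []. Qed.

Lemma is_ellipsoid_qball th u : Theta R p th -> 0 < u ->
  is_ellipsoid (qball (Prec th) th.1 u).
Proof.
move=> pth u0; exists th.1, th.2, (Num.sqrt u); split=> //; first by rewrite sqrtr_gt0.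
by rewrite ellipsoidE sqr_sqrtr// ltW.
Qed.

End elliptical_measure.

Section population.
Import numFieldNormedType.Exports.
Context {R : realType} {p : nat} (p_gt0 : (0 < p)%N) (g : R -> R).
Hypotheses (g_ell : elliptical_generator p g) (gG2 : condG2 g).
Variables (P Q : probability 'cV[R]_p R) (pi0 : R) (th0 : 'cV[R]_p * 'M[R]_p).
Hypotheses (P_gem : gross_error_model g P pi0 th0 Q) (pi0_lt : pi0 < 2^-1).
Variable A : set 'cV[R]_p.
Hypotheses (A_mve : is_mve P A) (A_unique : forall B, is_mve P B -> B = A).
Local Notation lam := (lebesgue_col R p).
Local Notation Prec th := (invmx th.2).
Local Notation P0 := (elliptical_prob g th0).
Local Notation E0 u := (qball (Prec th0) th0.1 u).
Local Notation fin B := (fine (elliptical_prob g th0 B)).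

Lemma Theta0 : Theta R p th0. Proof. by case: P_gem. Qed.
Local Notation pth0 := Theta0.

Lemma pi0_ge0 : 0 <= pi0. Proof. by case: P_gem => /andP[]. Qed.

Lemma prob0_fin B : measurable B -> P0 B = (fin B)%:E.
Proof. by have [m mE] := elliptical_probability g_ell gG2 pth0; move=> mB;
  rewrite -mE fin_num_probability. Qed.

Lemma PE B : measurable B -> fine (P B) = (1 - pi0) * fin B + pi0 * fine (Q B).
Proof.
move=> mB; have [_ _ h _] := P_gem.
by rewrite h// (prob0_fin mB) (fin_num_probability Q mB) -!EFinM -EFinD.
Qed.

Lemma prob0_ge0 B : 0 <= fin B.
Proof.
apply: fine_ge0; apply: integral_ge0 => x _; rewrite lee_fin.
exact: (elliptical_pdf_ge0 g_ell _ pth0).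
Qed.

Lemma prob0S B C : measurable B -> measurable C -> B `<=` C -> fin B <= fin C.
Proof.
have [m mE] := elliptical_probability g_ell gG2 pth0; move=> mB mC BC.
rewrite -lee_fin -!prob0_fin// -!mE; exact: le_measureS.
Qed.

Lemma prob0_split B C : measurable B -> measurable C -> fin B = fin (B `&` C) + fin (B `\` C).
Proof.
have [m mE] := elliptical_probability g_ell gG2 pth0; move=> mB mC.
by rewrite -!mE; apply: fine_measureDI => //; rewrite -ge0_fin_numE// fin_num_measure.
Qed.

Lemma prob0T : fin setT = 1.
Proof. by case: g_ell => _ _ ->//; exact: pth0. Qed.

Lemma Qfin_ge0 B : 0 <= fine (Q B).
Proof. exact: fine_ge0. Qed.

Lemma Q_A : Q A = 0%E.
Proof. by have [_ _ _] := P_gem; apply. Qed.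

Lemma prob0_ge B (c : R) : measurable B -> (lam B < +oo)%E -> 0 <= c ->
  (forall x, B x -> c <= elliptical_pdf g th0 x) -> c * fine (lam B) <= fin B.
Proof.
move=> mB Boo c0 h; rewrite -lee_fin EFinM fineK ?ge0_fin_numE// -prob0_fin//.
exact: (elliptical_prob_ge gG2 pth0 mB c0 h).
Qed.

Lemma prob0_le B (c : R) : measurable B -> (lam B < +oo)%E -> 
  (forall x, B x -> elliptical_pdf g th0 x <= c) -> fin B <= c * fine (lam B).
Proof.
move=> mB Boo h; rewrite -lee_fin -prob0_fin// EFinM fineK ?ge0_fin_numE//.
exact: (elliptical_prob_le g_ell gG2 pth0).
Qed.

Let c0 := (Num.sqrt (\det th0.2))^-1.
Let c0_gt0 : 0 < c0. Proof. by rewrite invr_gt0 (sqrt_det_gt0 g_ell pth0). Qed.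

Let pM0 : posdefmx (Prec th0). Proof. exact: pd_inv pth0. Qed.

(** Bathtub argument: let B be the central ellipsoid with the volume of A. The density of P_theta0
    is above a level on B and below it off B, so P_theta0(B) >= P_theta0(A). As Q(A) = 0, P(B) >=
    P(A) >= 1/2, hence B is an MVE too, and uniqueness gives B = A. *)
Lemma mve_central : exists2 t0, 0 < t0 & A = E0 t0.
Proof.
have [[mu [S [r [pS r0 AE]]]] PA Amin] := A_mve.
have pth : Theta R p (mu, S) by [].
(* The radius s solves s ^ p * uvol th0 = r ^ p * uvol (mu, S), the equality of the two volumes. *)
have [s s0 sE] := root_pos p_gt0 (divr_gt0 (mulr_gt0 (exprn_gt0 p r0) (uvol_gt0 pth)) (uvol_gt0
  pth0)).
have s2 : 0 < s ^+ 2 by rewrite exprn_gt0.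
have volA : lam A = (r ^+ p * uvol (mu, S))%:E.
  by rewrite AE ellipsoidE (qball_vol pth) ?exprn_gt0// sqrtr_sqr gtr0_norm.
have volB : lam (E0 (s ^+ 2)) = lam A.
  by rewrite (qball_vol pth0)// sqrtr_sqr gtr0_norm// sE divfK ?volA// gt_eqF// (uvol_gt0 pth0).
have mA : measurable A by rewrite AE; exact: measurable_qball.
set B := E0 (s ^+ 2) in volB *.
have mB : measurable B by exact: measurable_qball.
have Aoo : (lam A < +oo)%E by rewrite volA ltry.
have Boo : (lam B < +oo)%E by rewrite volB.
have e1 : fine (lam (A `\` B)) = fine (lam (B `\` A)).
  have := fine_measureDI mA mB Aoo; have := fine_measureDI mB mA Boo.
  by rewrite volB setIC => -> /addrI.
have AB : (lam (A `\` B) < +oo)%E.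
  apply: le_lt_trans Aoo; apply: le_measureS => //; by [exact: measurableD|exact: subDsetl].
have BA : (lam (B `\` A) < +oo)%E.
  apply: le_lt_trans Boo; apply: le_measureS => //; by [exact: measurableD|exact: subDsetl].
have h1 : fin (A `\` B) <= c0 * g (s ^+ 2) * fine (lam (A `\` B)).
  apply: prob0_le => //; first exact: measurableD.
  move=> x [_ /negP]; rewrite -ltNge => xB; rewrite /elliptical_pdf ler_wpM2l ?(ltW c0_gt0)//.
  by apply: (gen_le g_ell); exact: ltW.
have h2 : c0 * g (s ^+ 2) * fine (lam (B `\` A)) <= fin (B `\` A).
  apply: prob0_ge => //; first exact: measurableD.
    by rewrite mulr_ge0 ?(ltW c0_gt0)// (gen_ge0 g_ell)// ltW.
  move=> x [xB _]; rewrite /elliptical_pdf ler_wpM2l ?(ltW c0_gt0)//.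
  by apply: (gen_le g_ell) => //; exact: pd_psd.
have h3 : fin A <= fin B.
  by rewrite (prob0_split mA mB) (prob0_split mB mA) [in leRHS]setIC lerD2l;
    apply: le_trans h1 _; rewrite e1.
have PB : (2^-1%:E <= P B)%E.
  apply: le_trans PA _; rewrite (fin_num_probability P mA) (fin_num_probability P mB) lee_fin.
  rewrite !PE// Q_A /= mulr0 addr0.
  have : (1 - pi0) * fin A <= (1 - pi0) * fin B by rewrite ler_wpM2l//; have := pi0_lt; lra.
  have : 0 <= pi0 * fine (Q B) by rewrite mulr_ge0 ?pi0_ge0 ?Qfin_ge0.
  lra.
exists (s ^+ 2) => //; apply/esym/A_unique; split=> //.
  exact: (is_ellipsoid_qball pth0).
by rewrite volB.
Qed.

Definition mve_level : R := projT1 (cid2 mve_central).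
Local Notation t0 := mve_level.

Lemma mve_level_gt0 : 0 < t0. Proof. by rewrite /mve_level; case: cid2. Qed.

Lemma mve_central_qball : A = E0 t0. Proof. by rewrite /mve_level; case: cid2. Qed.

Lemma measurable_mve : measurable A. Proof. by rewrite mve_central_qball;
  exact: measurable_qball. Qed.

(** Otherwise [E0 u] would carry half of the mass of P with a volume smaller than that of A. *)
Lemma inner_prob_lt u : 0 < u -> u < t0 -> (1 - pi0) * fin (E0 u) < 2^-1.
Proof.
move=> u0 ut; have [_ _ Amin] := A_mve; have mE : measurable (E0 u) by exact: measurable_qball.
suff : fine (P (E0 u)) < 2^-1.
  rewrite PE//; have : 0 <= pi0 * fine (Q (E0 u)) by rewrite mulr_ge0 ?pi0_ge0 ?Qfin_ge0.
  lra.
rewrite ltNge; apply/negP => h.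
have := Amin (E0 u) (is_ellipsoid_qball pth0 u0).
rewrite (fin_num_probability P mE) lee_fin => /(_ h).
rewrite mve_central_qball !(qball_vol pth0) ?mve_level_gt0// lee_fin ler_pM2r ?(uvol_gt0 pth0)//.
have : Num.sqrt u < Num.sqrt t0 by rewrite ltr_sqrt ?mve_level_gt0.
by rewrite -(ltr_pXn2r p_gt0) ?nnegrE ?sqrtr_ge0// ltNge => /negP.
Qed.

Lemma fine_lam_E0 u : 0 < u -> fine (lam (E0 u)) = Num.sqrt u ^+ p * uvol th0.
Proof. by move=> u0; rewrite (qball_vol pth0). Qed.

Lemma E0_lty u : (lam (E0 u) < +oo)%E.
Proof. exact: qball_lty. Qed.

(** At least 1/2 since P(A) >= 1/2 and Q(A) = 0. At most 1/2 because the smaller concentric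
    ellipsoids have mass below 1/2, and the remaining shell has mass at most a constant times its
    volume, which tends to 0. *)
Lemma mve_prob0_half : (1 - pi0) * fin A = 2^-1.
Proof.
have [_ PA _] := A_mve; apply/eqP; rewrite eq_le; apply/andP; split; last first.
  by move: PA; rewrite (fin_num_probability P measurable_mve) lee_fin PE ?Q_A/= ?mulr0 ?addr0//;
    exact: measurable_mve.
have st0 : 0 < Num.sqrt t0 by rewrite sqrtr_gt0 mve_level_gt0.
set K := c0 * g 0 * uvol th0.
have h s : 0 < s -> s < Num.sqrt t0 ->
    (1 - pi0) * fin A <= 2^-1 + (1 - pi0) * (K * (Num.sqrt t0 ^+ p - s ^+ p)).
  move=> s0 st; have s2 : 0 < s ^+ 2 by rewrite exprn_gt0.
  have s2t : s ^+ 2 < t0 by rewrite -[X in _ < X]sqr_sqrtr ?(ltW mve_level_gt0)// ltr_pXn2r//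
    nnegrE ltW.
  have mE : measurable (E0 (s ^+ 2)) by exact: measurable_qball.
  have EA : A `&` E0 (s ^+ 2) = E0 (s ^+ 2).
    by apply: setIidr; rewrite mve_central_qball; apply: qballS; exact: ltW.
  have mD : measurable (A `\` E0 (s ^+ 2)) by apply: measurableD => //; exact: measurable_mve.
  have Aoo : (lam A < +oo)%E by rewrite mve_central_qball E0_lty.
  have Doo : (lam (A `\` E0 (s ^+ 2)) < +oo)%E.
    apply: le_lt_trans Aoo; apply: le_measureS => //; by [exact: measurable_mve|exact: subDsetl].
  have h1 : fin (A `\` E0 (s ^+ 2)) <= c0 * g 0 * fine (lam (A `\` E0 (s ^+ 2))).
    by apply: prob0_le => // x _; apply: (elliptical_pdf_ub g_ell _ pth0).
  have h2 : fine (lam (A `\` E0 (s ^+ 2))) = (Num.sqrt t0 ^+ p - s ^+ p) * uvol th0.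
    have := fine_measureDI measurable_mve mE Aoo; rewrite EA {1}mve_central_qball.
    rewrite !fine_lam_E0 ?mve_level_gt0// sqrtr_sqr (gtr0_norm s0) => h2.
    by rewrite mulrBl h2 addrAC subrr add0r.
  rewrite (prob0_split measurable_mve mE) EA mulrDr lerD ?(ltW (inner_prob_lt s2 s2t))//.
  apply: ler_wpM2l; first by have := pi0_lt; lra.
  apply: le_trans h1 _; rewrite h2 /K.
  by rewrite (mulrC _ (uvol th0)) !mulrA.
have cv : 2^-1 + (1 - pi0) * (K * (Num.sqrt t0 ^+ p - s ^+ p)) @[s --> (Num.sqrt t0)^'-] -->
   2^-1 + (1 - pi0) * (K * (Num.sqrt t0 ^+ p - Num.sqrt t0 ^+ p)).
  apply: cvg_at_left_filter; apply: cvgD; first exact: cvg_cst.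
  apply: cvgM; first exact: cvg_cst.
  apply: cvgM; first exact: cvg_cst.
  apply: cvgB; first exact: cvg_cst.
  exact: exprn_continuous.
rewrite subrr !mulr0 addr0 in cv.
apply: (cvgr_to_ge cv); near=> s; apply: h.
  by near: s; exact: nbhs_left_gt.
by near: s; exact: nbhs_left_lt.
Unshelve. all: by end_near. Qed.

Lemma prob0_A : fin A = (2 * (1 - pi0))^-1.
Proof.
have h : 1 - pi0 != 0 by rewrite gt_eqF//; have := pi0_lt; lra.
by apply: (mulfI h); rewrite mve_prob0_half invfM mulrCA divff// mulr1.
Qed.

Lemma mve_prob : fine (P A) = 2^-1.
Proof. by rewrite PE ?Q_A/= ?mulr0 ?addr0 ?mve_prob0_half//; exact: measurable_mve. Qed.

(** If g vanished beyond t0, then P_theta0(A) would be 1, whereas it is 1 / (2 (1 - pi0)) < 1. *)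
Lemma gen_pos_beyond : exists2 t1, t0 < t1 & 0 < g t1.
Proof.
apply: contrapT => h.
have g0 t : t0 < t -> g t = 0.
  move=> tt; apply/eqP; rewrite eq_le (gen_ge0 g_ell) ?andbT;
    last exact: ltW (lt_trans mve_level_gt0 tt).
  by rewrite leNgt; apply/negP => gt; apply: h; exists t.
have mA := measurable_mve.
have := prob0_split (@measurableT _ _) mA; rewrite setTI setTD prob0T.
have -> : fin (~` A) = 0.
  apply/eqP; rewrite eq_le prob0_ge0 andbT -lee_fin -prob0_fin; last exact: measurableC.
  have := @elliptical_prob_le R p g g_ell gG2 th0 (~` A) 0 pth0 (measurableC mA).
  rewrite mul0e; apply => x; rewrite mve_central_qball /qball /= => /negP; rewrite -ltNge => xt.
  rewrite /elliptical_pdf (g0 _ xt) mulr0 //.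
rewrite addr0 prob0_A => e.
have : 2 * (1 - pi0) = 1 by rewrite -[LHS]invrK -e invr1.
by have := pi0_lt; lra.
Qed.

(** Up to [t1] the density is bounded below by a positive constant, so an annulus around A adds
    positive mass to P(A) >= 1/2. *)
Lemma P_qballo_gt u : t0 < u -> 2^-1 < fine (P (qballo (Prec th0) th0.1 u)).
Proof.
move=> tu; have [t1 t01 gt1] := gen_pos_beyond.
set v := Num.min u t1; have tv : t0 < v by rewrite lt_min tu t01.
have v0 := lt_trans mve_level_gt0 tv.
set B := qballo (Prec th0) th0.1 v.
have mA := measurable_mve.
have mB : measurable B by exact: measurable_qballo.
have AB : A `<=` B by rewrite mve_central_qball; exact: qball_qballo.
have volB : fine (lam B) = Num.sqrt v ^+ p * uvol th0.
  by rewrite qballo_dilate// qballo1// (uvolE pth0).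
have Boo : (lam B < +oo)%E.
  by apply: le_lt_trans (E0_lty v); apply: le_measureS; [| exact: measurable_qball|exact: qballoW].
have mD : measurable (B `\` A) by exact: measurableD.
have Doo : (lam (B `\` A) < +oo)%E.
  apply: le_lt_trans Boo; apply: le_measureS => //; exact: subDsetl.
have BA : B `&` A = A by exact: setIidr.
have volD : 0 < fine (lam (B `\` A)).
  have := fine_measureDI mB mA Boo; rewrite BA volB {1}mve_central_qball fine_lam_E0
    ?mve_level_gt0// => e.
  have : Num.sqrt t0 ^+ p * uvol th0 < Num.sqrt v ^+ p * uvol th0.
    rewrite ltr_pM2r ?(uvol_gt0 pth0)// ltr_pXn2r ?nnegrE ?sqrtr_ge0//.
    by rewrite ltr_sqrt.
  lra.
have h1 : c0 * g t1 * fine (lam (B `\` A)) <= fin (B `\` A).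
  apply: prob0_ge => //; first by rewrite mulr_ge0 ?(ltW c0_gt0)// ltW.
  move=> x [xB _]; rewrite /elliptical_pdf ler_wpM2l ?(ltW c0_gt0)//.
  apply: (gen_le g_ell); first exact: pd_psd.
  by apply: ltW; apply: lt_le_trans xB _; rewrite ge_min lexx orbT.
have h2 : 0 < fin (B `\` A).
  by apply: lt_le_trans h1; rewrite !mulr_gt0.
have h3 : 2^-1 < fine (P B).
  rewrite PE// (prob0_split mB mA) BA mulrDr mve_prob0_half -addrA ltrDl.
  apply: ltr_wpDr; first by rewrite mulr_ge0 ?pi0_ge0 ?Qfin_ge0.
  by rewrite mulr_gt0//; have := pi0_lt; lra.
apply: lt_le_trans h3 _; apply: fine_measureS => //.
- exact: measurable_qballo.
- by rewrite -ge0_fin_numE// fin_num_measure//; exact: measurable_qballo.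
- by move=> x /lt_le_trans; apply; rewrite ge_min lexx.
Qed.

End population.

(** * Convergence of the empirical ellipsoids *)

Section ultrafilters.
Import numFieldNormedType.Exports.
Context {R : realType}.

Lemma ultra_fin (T : Type) (U : set_system T) p (f : T -> 'I_p) :
  UltraFilter U -> exists i, \forall t \near U, f t = i.
Proof.
move=> UU; apply: contrapT => /forallNP h.
have h' i : U [set t | f t <> i].
  by have [hi|//] := in_ultra_setVsetC [set t | f t = i] UU; case: (h i).
have : U (\bigcap_(i in [set: 'I_p]) [set t | f t <> i]).
  have -> : [set: 'I_p] = [set` [fset x in predT]%fset].
    by apply/seteqP; split=> x //= _; rewrite !inE.
  by apply: filter_bigI => i _; exact: h'.
by move=> /filter_ex [t ht]; exact: (ht (f t) I).
Qed.

Lemma cvgr_uniq (T : Type) (F : set_system T) (f : T -> R) (a b : R) :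
  ProperFilter F -> f t @[t --> F] --> a -> f t @[t --> F] --> b -> a = b.
Proof. by move=> FF ha hb; exact: (@cvg_unique _ (@Rhausdorff R) (f @ F) _ a b ha hb). Qed.

(** Bounded diagonals and determinants away from 0 keep the matrices and their inverses bounded. The
    points [z n], in a fixed box and at bounded distance for the forms, prevent the centers from
    escaping. *)
Lemma posdef_limit (U : set_system nat) p (N : nat -> 'M[R]_p) (nu z : nat ->
  'cV[R]_p) (B b C K : R) :
  UltraFilter U -> 0 < b ->
  (\forall n \near U, posdefmx (N n)) ->
  (\forall n \near U, forall i, N n i i <= B) ->
  (\forall n \near U, b <= \det (N n)) ->
  (\forall n \near U, cbox K (z n) /\ qball (N n) (nu n) C (z n)) ->
  exists (nu' : 'cV[R]_p) (N' : 'M[R]_p), [/\ posdefmx N', nu n @[n --> U] --> nu',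
   N n @[n --> U] --> N' & invmx (N n) @[n --> U] --> invmx N'].
Proof.
move=> UU b0 pN dB detb hz.
have NB : \forall n \near U, forall i j, `|N n i j| <= B.
  near=> n => i j; have pn : posdefmx (N n) by near: n.
  apply: (psd_entry pn.1 (fun y => pd_psd y pn)).
  by move: i j; near: n; move: dB; apply: filterS => n h _ _.
have [N' NN'] := ultra_bounded_cvg_mx UU NB.
pose B' := (p.-1)`!%:R * B ^+ p.-1 / b.
have SB : \forall n \near U, forall i j, `|invmx (N n) i j| <= B'.
  near=> n => i j; have pn : posdefmx (N n) by near: n.
  have hN : forall i j, `|N n i j| <= B by near: n.
  apply: le_trans (invmx_bound i j (pd_unit pn) hN) _.
  have B0 : 0 <= B := le_trans (normr_ge0 _) (hN i j).
  apply: ler_wpM2l; first by rewrite mulr_ge0// exprn_ge0.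
  have d0 : b <= \det (N n) by near: n.
  rewrite ger0_norm ?(le_trans (ltW b0) d0)// lef_pV2// posrE//; exact: lt_le_trans d0.
have [S' SS'] := ultra_bounded_cvg_mx UU SB.
have NS : N' *m S' = 1%:M.
  have h1 : N n *m invmx (N n) @[n --> U] --> N' *m S' by exact: cvg_mulmx.
  have h2 : N n *m invmx (N n) @[n --> U] --> (1%:M : 'M[R]_p).
    apply: (@cvg_trans _ ((fun=> 1%:M) n @[n --> U])); last exact: cvg_cst.
    apply: near_eq_cvg; near=> n; rewrite mulmxV// pd_unit//; near: n; exact: pN.
  apply/matrixP => i j; apply: (@cvgr_uniq _ U (fun n => (N n *m invmx (N n)) i j)).
    exact: cvg_coord h1.
  exact: cvg_coord h2.
have [uN eS] : N' \in unitmx /\ invmx N' = S'.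
  have [uN uS] := mulmx1_unit NS; split=> //.
  by rewrite -[RHS](mulKmx uN) NS mulmx1.
have sN : N'^T = N'.
  apply/matrixP => i j; rewrite mxE.
  have hji : N n j i @[n --> U] --> N' j i by exact: cvg_coord.
  have hij : N n i j @[n --> U] --> N' i j by exact: cvg_coord.
  apply: cvgr_uniq hji _; apply: cvg_trans hij.
  apply: near_eq_cvg; near=> n; have pn : posdefmx (N n) by near: n.
  by rewrite -[in RHS]pn.1 mxE.
have psdN y : 0 <= qf N' y.
  have h : qf (N n) y @[n --> U] --> qf N' y by apply: cvg_qf => //; exact: cvg_cst.
  apply: (cvgr_to_ge h); near=> n; apply: pd_psd; near: n; exact: pN.
have pN' : posdefmx N'.
  by split=> // y y0; exact: (psd_unit_pos sN psdN uN y0).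
have [nu' hnu] : exists nu' : 'cV[R]_p, nu n @[n --> U] --> nu'.
  apply: (@ultra_bounded_cvg_mx _ _ _ _ _ _ (K + (1 + B' * `|C|)) UU).
  near=> n => i j; rewrite (ord1 j).
  have pn : posdefmx (N n) by near: n.
  have [zK zC] : cbox K (z n) /\ qball (N n) (nu n) C (z n) by near: n.
  have hS : forall i j, `|invmx (N n) i j| <= B' by near: n.
  have := @pd_coord R p (invmx (N n)) (z n - nu n) i (pd_inv pn); rewrite invmxK => h.
  have h2 : (z n - nu n) i ord0 ^+ 2 <= B' * `|C|.
    apply: le_trans h _; apply: ler_pM; [|exact: pd_psd| |].
    - exact: psd_diag (fun y => pd_psd y (pd_inv pn)) _.
    - by apply: le_trans (hS i i); rewrite ler_norm.
    - by apply: le_trans zC _; rewrite ler_norm.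
  have h3 : `|(z n - nu n) i ord0| <= 1 + B' * `|C|.
    apply: le_trans (_ : 1 + (z n - nu n) i ord0 ^+ 2 <= _); last by rewrite lerD2l.
    by rewrite -real_normK ?num_real//; have := normr_ge0 ((z n - nu n) i ord0); nra.
  have -> : nu n i ord0 = z n i ord0 - (z n - nu n) i ord0 by rewrite !mxE; ring.
  apply: le_trans (ler_normB _ _) _; exact: lerD (zK i) h3.
by exists nu', N'; split=> //; rewrite eS.
Unshelve. all: by end_near. Qed.

Lemma qf_uniform (U : set_system nat) p (N : nat -> 'M[R]_p) (nu : nat ->
  'cV[R]_p) (N' : 'M[R]_p) (nu' : 'cV[R]_p) K :
  UltraFilter U -> nu n @[n --> U] --> nu' -> N n @[n --> U] --> N' ->
  forall e, 0 < e -> \forall n \near U, forall y, @cbox R p K y ->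
    `|qf (N n) (y - nu n) - qf N' (y - nu')| < e.
Proof.
move=> UU hnu hN; apply: (@uniform_near R nat U p K (fun n y => qf (N n) (y - nu n)) (fun y =>
  qf N' (y - nu'))).
move=> y _.
have h1 : qf (N z.2) (z.1 - nu z.2) @[z --> (nbhs y, U)] --> qf N' (y - nu').
  apply: cvg_qf_sub; [exact: (cvg_comp _ _ cvg_snd hN)|exact: (cvg_comp _ _ cvg_snd hnu)|exact:
    cvg_fst].
have h2 : qf N' (z.1 - nu') @[z --> (nbhs y, U)] --> qf N' (y - nu').
  apply: cvg_qf_sub; [exact: cvg_cst|exact: cvg_cst|exact: cvg_fst].
by rewrite -(subrr (qf N' (y - nu'))); exact: cvgB.
Qed.

End ultrafilters.

Section max_precision.
Import numFieldNormedType.Exports.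
Context {R : realType} {p : nat}.

Lemma exists_max_diag (p_gt0 : (0 < p)%N) (N : 'M[R]_p) : exists i, forall k, N k k <= N i i.
Proof.
have i0 : 'I_p by exact: (Ordinal p_gt0).
exists [arg max_(i > i0) N i i]%O => k.
by case: arg_maxP => // i _ /(_ k); apply.
Qed.

(** Dividing a row by the largest diagonal entry gives a direction of sup norm 1 with a coordinate
    equal to 1, so limits of such directions are never zero. *)
Lemma posdef_dir (p_gt0 : (0 < p)%N) (N : 'M[R]_p) : posdefmx N ->
  exists (i : 'I_p) (w : 'I_p -> R), [/\ forall k, N k k <= N i i, 0 < N i i, w i = 1, forall j,
    `|w j| <= 1 &
   forall y : 'cV[R]_p, N i i * (\sum_j w j * y j ord0) ^+ 2 <= qf N y].
Proof.
move=> pN; have [i hi] := exists_max_diag p_gt0 N.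
have Ni : 0 < N i i.
  have e0 : delta_mx i ord0 != 0 :> 'cV[R]_p.
    by apply/eqP => /matrixP /(_ i ord0); rewrite !mxE !eqxx => /eqP; rewrite oner_eq0.
  by have := pN.2 _ e0; rewrite -[X in _ < X]/(bform _ _ _) bform_delta2.
exists i, (fun j => N i j / N i i); split=> //.
- by rewrite divff// gt_eqF.
- move=> j; rewrite normrM normfV (gtr0_norm Ni) ler_pdivrMr// mul1r.
  exact: (psd_entry pN.1 (fun y => pd_psd y pN)).
- by move=> y; apply: (psd_slab pN.1 (fun y => pd_psd y pN)).
Qed.

Lemma decreasing_limit (m : probability 'cV[R]_p R) (F : nat -> set 'cV[R]_p) B e : 0 < e ->
  (forall k, measurable (F k)) -> measurable B -> (forall i j, (i <= j)%N -> F j `<=` F i) -> 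
  \bigcap_k F k `<=` B ->
  exists k, fine (m (F k)) <= fine (m B) + e.
Proof.
move=> e0 mF mB dF FB.
have mC : measurable (\bigcap_k F k) by exact: bigcapT_measurable.
have : m (F k) @[k --> \oo] --> m (\bigcap_k F k).
  apply: nonincreasing_cvg_mu => //; first by rewrite -ge0_fin_numE// fin_num_measure.
  by move=> i j ij; apply/subsetPset; exact: dF.
rewrite (fin_num_probability m mC) => /fine_cvgP[_ /cvgrPdist_lt /(_ e e0) [k _ /(_ k (leqnn _))
  /=]].
rewrite ltr_norml => /andP[h _]; exists k.
have : fine (m (\bigcap_k F k)) <= fine (m B).
  by apply: fine_measureS => //; rewrite -ge0_fin_numE// fin_num_measure.
lra.
Qed.

Definition slab (w : 'I_p -> R) c (d : R) : set 'cV[R]_p :=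
  [set y | `|\sum_j w j * y j ord0 - c| <= d].

Lemma closed_slab w c d : closed (slab w c d).
Proof.
apply: (@preimage_closed _ _ (fun y : 'cV[R]_p =>
  `|\sum_j w j * y j ord0 - c|) [set t | t <= d]) => [y _|].
  have h : \sum_j w j * (v : 'cV[R]_p) j ord0 @[v --> y] --> \sum_j w j * y j ord0.
    apply: (@cvg_sumr R _ _ (nbhs y)) => i; apply: cvgM; first exact: cvg_cst.
    exact: coord_continuous.
  exact: cvg_norm (cvgB h (cvg_cst c)).
exact: closed_le.
Qed.

End max_precision.

Section thin_slabs.
Import numFieldNormedType.Exports.
Context {R : realType} {p : nat} (p_gt0 : (0 < p)%N) (g : R -> R).
Hypotheses (g_ell : elliptical_generator p g) (gG2 : condG2 g).
Variables (P Q : probability 'cV[R]_p R) (pi0 : R) (th0 : 'cV[R]_p * 'M[R]_p).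
Hypotheses (P_gem : gross_error_model g P pi0 th0 Q) (pi0_lt : pi0 < 2^-1).
Variable A : set 'cV[R]_p.
Hypotheses (A_mve : is_mve P A) (A_unique : forall B, is_mve P B -> B = A).
Local Notation Prec th := (invmx th.2).
Local Notation O0 u := (qballo (Prec th0) th0.1 u).
Local Notation fin B := (fine (elliptical_prob g th0 B)).
Local Notation pth0 := (Theta0 P_gem).

Variable x : nat -> 'cV[R]_p.
Hypothesis x_weak : weak_limsup x P.
Variable U : set_system nat.
Hypotheses (UU : UltraFilter U) (Uoo : \oo `<=` U).

Let pM0 : posdefmx (Prec th0). Proof. exact: pd_inv pth0. Qed.

Let n_pos : \forall n \near U, (0 < n)%N.
Proof. by apply: Uoo; exists 1%N. Qed.

Lemma Pn_closed C : closed C -> forall e : R, 0 < e ->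
  \forall n \near U, Pn x n C <= fine (P C) + e.
Proof. by move=> cC e e0; apply: Uoo; exact: x_weak. Qed.

Lemma Pn_open O : open O -> forall e : R, 0 < e -> \forall n \near U, fine (P O) - e <= Pn x n O.
Proof.
move=> oO e e0; have cC : closed (~` O) by exact: open_closedC.
have h := Pn_closed cC e0.
have mO := open_measurable_col oO.
near=> n; have : Pn x n (~` O) <= fine (P (~` O)) + e by near: n.
rewrite PnC; last by near: n.
by rewrite probability_setC// (fin_num_probability P mO) -EFinB /=; lra.
Unshelve. all: by end_near. Qed.

Lemma tight e : 0 < e -> exists k : nat, fine (P (~` O0 k.+1%:R)) < e.
Proof.
move=> e0.
have mO k : measurable (O0 k.+1%:R) by exact: measurable_qballo.
have UO : \bigcup_k (O0 k.+1%:R) = setT.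
  apply/seteqP; split=> // y _.
  by exists (Num.trunc (qf (Prec th0) (y - th0.1))) => //; rewrite /qballo /=; exact: truncnS_gt.
have : P (O0 k.+1%:R) @[k --> \oo] --> P (\bigcup_k (O0 k.+1%:R)).
  apply: nondecreasing_cvg_mu => //; first by rewrite UO.
  move=> m n mn; apply/subsetPset => y; rewrite /qballo /= => /lt_le_trans; apply.
  by rewrite ler_nat ltnS.
rewrite UO probability_setT => /fine_cvgP[_ /cvgrPdist_lt /(_ e e0) [k _ /(_ k (leqnn _)) /=]].
move=> h; exists k; rewrite probability_setC// (fin_num_probability P (mO k)) -EFinB /=.
exact: le_lt_trans (ler_norm _) h.
Qed.

(** The slabs shrink to a hyperplane, which is null for P_theta0, so only the contribution of Q
    survives. *)
Lemma prob_thin_slab w c i0 F eta : w i0 != 0 -> closed F -> 0 < eta ->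
  exists2 d, 0 < d & fine (P (F `&` slab w c d)) <= pi0 * fine (Q F) + eta.
Proof.
move=> wi0 cF eta0; have mF := closed_measurable_col cF.
pose G k := F `&` slab w c k.+1%:R^-1.
have mG k : measurable (G k).
  by apply: measurableI => //; apply: closed_measurable_col; exact: closed_slab.
have dG i j : (i <= j)%N -> G j `<=` G i.
  move=> ij y [Fy /= h]; split=> //=; apply: le_trans h _.
  by rewrite lef_pV2 ?posrE// ler_nat ltnS.
have mH : measurable (F `&` slab w c 0).
  by apply: measurableI => //; apply: closed_measurable_col; exact: closed_slab.
have capG : \bigcap_k G k `<=` F `&` slab w c 0.
  move=> y h; split; first by have [] := h 0%N I.
  rewrite /slab /=; apply/ler_addgt0Pr => e e0; rewrite add0r.
  have [_ /=] := h (Num.trunc (e^-1)) I; move/le_trans; apply.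
  by rewrite -[leRHS]invrK lef_pV2 ?posrE ?invr_gt0//; exact: ltW (truncnS_gt _).
have [k hk] := decreasing_limit P eta0 mG mH dG capG.
exists k.+1%:R^-1; first by rewrite invr_gt0.
apply: le_trans hk _; rewrite lerD2r (PE g_ell gG2 P_gem)//.
have -> : fin (F `&` slab w c 0) = 0.
  rewrite (elliptical_prob_null g_ell gG2 pth0)//.
  apply/eqP; rewrite eq_le measure_ge0 andbT -(@hyperplane_null R p w c i0 wi0).
  apply: le_measureS => //.
    rewrite (_ : [set _ | _] = slab w c 0); first by apply: closed_measurable_col;
      exact: closed_slab.
    by apply/seteqP; split=> y; rewrite /slab /= normr_le0 subr_eq0 => /eqP.
  by move=> y [_]; rewrite /slab /= normr_le0 subr_eq0 => /eqP.
rewrite mulr0 add0r ler_wpM2l ?(pi0_ge0 P_gem)//.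
by apply: fine_probabilityS => //; exact: subIsetl.
Qed.

(** The slabs move with n but their directions converge. On a bounded set of large mass the moving
    slab lies in a slightly wider fixed one if the offsets converge, and misses the set if they
    diverge. *)
Lemma Pn_thin_slab (w : nat -> 'I_p -> R) (c : nat -> R) (i : nat -> 'I_p) F eta :
  (\forall n \near U, w n (i n) = 1 /\ forall j, `|w n j| <= 1) ->
  closed F -> 0 < eta ->
  exists2 d, 0 < d & \forall n \near U, Pn x n (F `&` slab (w n) (c n) d) <= pi0 * fine (Q F) + eta.
Proof.
move=> hw cF eta0.
have [i0 hi0] := ultra_fin i UU.
have hwj j : exists l : R, w n j @[n --> U] --> l.
  by apply: (@ultra_bounded_cvg R nat U _ 1 UU); move: hw; apply: filterS => n [_]; exact.
pose w' j := projT1 (cid (hwj j)).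
have ww' j : w n j @[n --> U] --> w' j by exact: (projT2 (cid (hwj j))).
have w'i0 : w' i0 = 1.
  apply: (@cvgr_uniq R _ U (fun n => w n i0)); first exact: ww'.
  apply: cvg_near_cst; near=> n; have [<- _] : w n (i n) = 1 /\ forall j, `|w n j| <= 1 by near: n.
  congr (w n _); apply/esym; near: n; exact: hi0.
(* The four quarters of eta: the mass outside a large ellipsoid and its empirical excess, the excess
   of the limit slab over the contribution of Q and its empirical excess. *)
have e4 : 0 < eta / 4 by rewrite divr_gt0.
have [k hk] := tight e4.
have cO : closed (~` O0 k.+1%:R) by apply: open_closedC; exact: open_qballo.
have hC := Pn_closed cO e4.
have [K hK] := @qball_bounded R p (Prec th0) th0.1 k.+1%:R pM0.
have [hb|hinf] := ultra_bounded_or (fun n => `|c n|) UU; last first.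
  exists 1 => //; near=> n.
  have sub : F `&` slab (w n) (c n) 1 `<=` ~` O0 k.+1%:R.
    move=> y [_ ys] yO; have yK := hK _ (qballoW yO).
    have h1 : `|\sum_j w n j * y j ord0| <= \sum_(j < p) K.
      apply: le_trans (ler_norm_sum _ _ _) _; apply: ler_sum => j _; rewrite normrM.
      have [_ hj] : w n (i n) = 1 /\ forall j, `|w n j| <= 1 by near: n.
      by rewrite -[leRHS]mul1r; apply: ler_pM.
    have : 1 + \sum_(j < p) K < `|c n| by near: n; exact: hinf.
    rewrite ltNge => /negP; apply.
    have -> : c n = \sum_j w n j * y j ord0 - (\sum_j w n j * y j ord0 - c n) by rewrite subKr.
    by apply: le_trans (ler_normB _ _) _; rewrite addrC; exact: lerD.
  apply: le_trans (PnS x n sub) _.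
  have : Pn x n (~` O0 k.+1%:R) <= fine (P (~` O0 k.+1%:R)) + eta / 4 by near: n.
  have : 0 <= pi0 * fine (Q F) by rewrite mulr_ge0 ?(pi0_ge0 P_gem) ?Qfin_ge0.
  lra.
have [B hB] := hb.
have [c' cc'] := ultra_bounded_cvg UU hB.
have w'n0 : w' i0 != 0 by rewrite w'i0 oner_eq0.
have [d d0 hd] := prob_thin_slab c' w'n0 cF e4.
have d2 : 0 < d / 2 by rewrite divr_gt0.
have hunif : \forall n \near U, forall y, @cbox R p K y ->
    `|(\sum_j w n j * y j ord0 - c n) - (\sum_j w' j * y j ord0 - c')| < d / 2.
  apply: (@uniform_near R nat U p K (fun n y => \sum_j w n j * y j ord0 - c n) (fun y =>
    \sum_j w' j * y j ord0 - c')) => //.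
  move=> y _.
  have h1 : \sum_j w z.2 j * (z.1 : 'cV[R]_p) j ord0 - c z.2 @[z --> (nbhs y,
    U)] --> \sum_j w' j * y j ord0 - c'.
    apply: cvgB; last exact: (cvg_comp _ _ cvg_snd cc').
    apply: cvg_sumr => j; apply: cvgM; first exact: (cvg_comp _ _ cvg_snd (ww' j)).
    apply: cvg_coord; exact: cvg_fst.
  have h2 : \sum_j w' j * (z.1 : 'cV[R]_p) j ord0 - c' @[z --> (nbhs y,
    U)] --> \sum_j w' j * y j ord0 - c'.
    apply: cvgB; last exact: cvg_cst.
    apply: cvg_sumr => j; apply: cvgM; first exact: cvg_cst.
    apply: cvg_coord; exact: cvg_fst.
  exact: cvg_sub0 h1 h2.
exists (d / 2) => //.
have cFs : closed (F `&` slab w' c' d) by apply: closedI => //; exact: closed_slab.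
have hFs := Pn_closed cFs e4.
near=> n.
have hn : forall y, @cbox R p K y ->
    `|(\sum_j w n j * y j ord0 - c n) - (\sum_j w' j * y j ord0 - c')| < d / 2.
  by near: n.
have sub : F `&` slab (w n) (c n) (d / 2) `<=` (F `&` slab w' c' d) `|` ~` O0 k.+1%:R.
  move=> y [Fy ys]; have [yO|] := pselect (O0 k.+1%:R y); last by right.
  left; split=> //; have yK := hK _ (qballoW yO).
  have := hn y yK.
  move: ys; rewrite /slab /=; set a := _ - c n; set b := _ - c' => ha hab.
  have -> : b = a - (a - b) by rewrite subKr.
  by apply: le_trans (ler_normB _ _) _; lra.
apply: le_trans (PnS x n sub) _; apply: le_trans (PnU x n _ _) _.
have : Pn x n (~` O0 k.+1%:R) <= fine (P (~` O0 k.+1%:R)) + eta / 4 by near: n.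
have : Pn x n (F `&` slab w' c' d) <= fine (P (F `&` slab w' c' d)) + eta / 4 by near: n.
lra.
Unshelve. all: by end_near. Qed.

End thin_slabs.

Section qball_more.
Import numFieldNormedType.Exports.
Context {R : realType} {p : nat}.

Lemma qball_scale (M : 'M[R]_p) mu a u : 0 < a -> qball M mu (a * u) = qball (a^-1 *: M) mu u.
Proof.
move=> a0; have h q : (a^-1 * q <= u) = (q <= a * u) by rewrite mulrC ler_pdivrMr// mulrC.
by apply/seteqP; split=> y; rewrite /qball /= qfZl h.
Qed.

Lemma is_ellipsoidP (E : set 'cV[R]_p) : is_ellipsoid E ->
  exists (N : 'M[R]_p) (nu : 'cV[R]_p), posdefmx N /\ E = qball N nu 1.
Proof.
move=> [mu [S [r [pS r0 ->]]]]; have r2 : 0 < r ^+ 2 by rewrite exprn_gt0.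
exists ((r ^+ 2)^-1 *: invmx S), mu; split.
  by apply: pdZ; [rewrite invr_gt0|exact: pd_inv].
by rewrite -qball_scale// mulr1.
Qed.

Lemma cvg_bounded_mx (T : Type) (F : set_system T) m n (f : T -> 'M[R]_(m, n)) (l : 'M[R]_(m, n)) :
  Filter F -> f t @[t --> F] --> l -> exists B, \forall t \near F, forall i j, `|f t i j| <= B.
Proof.
move=> FF fl; exists (1 + \sum_i \sum_j `|l i j|).
have : \forall t \near F, ball l 1 (f t).
  by apply: fl; exact: nbhsx_ballx.
apply: filterS => t [_ h] i j.
have := h i j; rewrite /ball /= => hij.
have -> : f t i j = l i j - (l i j - f t i j) by rewrite subKr.
apply: le_trans (ler_normB _ _) _; rewrite addrC; apply: lerD; first exact: ltW.
rewrite (bigD1 i)//= (bigD1 j)//= -addrA lerDl addr_ge0// sumr_ge0// => k _.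
by rewrite sumr_ge0.
Qed.

End qball_more.

Section empirical_mve.
Import numFieldNormedType.Exports.
Context {R : realType} {p : nat} (p_gt0 : (0 < p)%N) (g : R -> R).
Hypotheses (g_ell : elliptical_generator p g) (gG2 : condG2 g).
Variables (P Q : probability 'cV[R]_p R) (pi0 : R) (th0 : 'cV[R]_p * 'M[R]_p).
Hypotheses (P_gem : gross_error_model g P pi0 th0 Q) (pi0_lt : pi0 < 2^-1).
Variable A : set 'cV[R]_p.
Hypotheses (A_mve : is_mve P A) (A_unique : forall B, is_mve P B -> B = A).
Local Notation lam := (lebesgue_col R p).
Local Notation Prec th := (invmx th.2).
Local Notation E0 u := (qball (Prec th0) th0.1 u).
Local Notation O0 u := (qballo (Prec th0) th0.1 u).
Local Notation pth0 := (Theta0 P_gem).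
Local Notation t0 := (mve_level p_gt0 g_ell gG2 P_gem pi0_lt A_mve A_unique).

Variable x : nat -> 'cV[R]_p.
Hypothesis x_weak : weak_limsup x P.
Variable U : set_system nat.
Hypotheses (UU : UltraFilter U) (Uoo : \oo `<=` U).

Let pM0 : posdefmx (Prec th0). Proof. exact: pd_inv pth0. Qed.

Let n_pos : \forall n \near U, (0 < n)%N.
Proof. by apply: Uoo; exists 1%N. Qed.

Variable An : nat -> set 'cV[R]_p.
Hypothesis hAn : \forall n \near \oo, is_mve (emp_prob x n) (An n).

Let UAn : \forall n \near U, is_mve (emp_prob x n) (An n).
Proof. exact: Uoo. Qed.

Lemma emp_mve_half : \forall n \near U, 2^-1 <= Pn x n (An n).
Proof. by apply: filterS UAn => n [_ + _]; rewrite emp_probE lee_fin. Qed.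

(** [E0 u] has more than half of the mass of P, hence eventually at least half of the sample, and
    competes with [An n]. *)
Lemma emp_mve_vol u : t0 < u -> \forall n \near U, (lam (An n) <= lam (E0 u))%E.
Proof.
move=> tu; have u0 : 0 < u by exact: lt_trans (mve_level_gt0 _ _ _ _ _ _ _) tu.
have Pu := P_qballo_gt tu.
have e0 : 0 < fine (P (O0 u)) - 2^-1 by rewrite subr_gt0.
have h := Pn_open x_weak UU Uoo (@open_qballo R p (Prec th0) th0.1 u) e0.
apply: filterS2 h UAn => n hn [_ _]; apply; first exact: (is_ellipsoid_qball pth0).
rewrite emp_probE lee_fin; apply: le_trans (PnS x n (@qballoW R p (Prec th0) th0.1 u)).
by lra.
Qed.

Lemma emp_mve_cvg : exists (N : nat -> 'M[R]_p) (nu : nat -> 'cV[R]_p),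
  [/\ \forall n \near U, posdefmx (N n) /\ An n = qball (N n) (nu n) 1,
      nu n @[n --> U] --> th0.1, N n @[n --> U] --> t0^-1 *: Prec th0 &
      exists K, \forall n \near U, An n `<=` cbox K].
Proof.
have t00 : 0 < t0 := mve_level_gt0 p_gt0 g_ell gG2 P_gem pi0_lt A_mve A_unique.
have AE : A = E0 t0 := mve_central_qball p_gt0 g_ell gG2 P_gem pi0_lt A_mve A_unique.
(* The values chosen where [An n] is not an ellipsoid are arbitrary; only the eventual behaviour
   matters. *)
have ex n : exists Nnu : 'M[R]_p * 'cV[R]_p, is_ellipsoid (An n) ->
    posdefmx Nnu.1 /\ An n = qball Nnu.1 Nnu.2 1.
  have [hE|hE] := pselect (is_ellipsoid (An n)); last by exists (0, 0).
  by have [N [nu h]] := is_ellipsoidP hE; exists (N, nu).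
pose N n := (projT1 (cid (ex n))).1; pose nu n := (projT1 (cid (ex n))).2.
have hN : \forall n \near U, posdefmx (N n) /\ An n = qball (N n) (nu n) 1.
  by apply: filterS UAn => n [hE _ _]; exact: (projT2 (cid (ex n))) hE.
pose th n : 'cV[R]_p * 'M[R]_p := (nu n, invmx (N n)).
have pth : \forall n \near U, Theta R p (th n).
  by apply: filterS hN => n [pn _]; exact: pd_inv.
have exw n : exists iw : 'I_p * ('I_p -> R), posdefmx (N n) ->
  [/\ forall k, N n k k <= N n iw.1 iw.1, 0 < N n iw.1 iw.1, iw.2 iw.1 = 1, forall j,
    `|iw.2 j| <= 1 &
   forall y : 'cV[R]_p, N n iw.1 iw.1 * (\sum_j iw.2 j * y j ord0) ^+ 2 <= qf (N n) y].
  have [pn|pn] := pselect (posdefmx (N n)); last by exists (Ordinal p_gt0, fun=> 0).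
  by have [i [w h]] := posdef_dir p_gt0 pn; exists (i, w).
pose i n := (projT1 (cid (exw n))).1; pose w n := (projT1 (cid (exw n))).2.
have hw : \forall n \near U, [/\ forall k, N n k k <= N n (i n) (i n), 0 < N n (i n) (i n),
  w n (i n) = 1, forall j, `|w n j| <= 1 &
   forall y : 'cV[R]_p, N n (i n) (i n) * (\sum_j w n j * y j ord0) ^+ 2 <= qf (N n) y].
  by apply: filterS hN => n [pn _]; exact: (projT2 (cid (exw n)) pn).
have hw' : \forall n \near U, w n (i n) = 1 /\ forall j, `|w n j| <= 1.
  by apply: filterS hw => n [].
have [B hB] : exists B, \forall n \near U, N n (i n) (i n) <= B.
  have [//|hinf] := ultra_bounded_or (fun n => N n (i n) (i n)) UU.
  exfalso.
  (* pi0 plus this margin is still below 1/2, so a set with half of the sample does not fit into the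
     slab. *)
  have eta0 : 0 < (2^-1 - pi0) / 2 by rewrite divr_gt0// subr_gt0.
  have [d d0 hd] := Pn_thin_slab g_ell gG2 P_gem x_weak UU Uoo
    (fun n => \sum_j w n j * nu n j ord0) hw' (@closedT _) eta0.
  have d2 : 0 < d ^+ 2 by rewrite exprn_gt0.
  have : \forall n \near U, False; last by move=> /filter_ex [].
  near=> n.
  have [pn AnE] : posdefmx (N n) /\ An n = qball (N n) (nu n) 1 by near: n.
  have [_ Npos _ _ hq] : [/\ forall k, N n k k <= N n (i n) (i n), 0 < N n (i n) (i n),
    w n (i n) = 1, forall j, `|w n j| <= 1 &
    forall y : 'cV[R]_p, N n (i n) (i n) * (\sum_j w n j * y j ord0) ^+ 2 <= qf (N n) y] by near: n.
  have Nbig : (d ^+ 2)^-1 < N n (i n) (i n) by near: n; exact: hinf.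
  have sub : An n `<=` setT `&` slab (w n) (\sum_j w n j * nu n j ord0) d.
    move=> y; rewrite AnE => yA; split=> //; rewrite /slab /=.
    have -> : \sum_j w n j * y j ord0 - \sum_j w n j * nu n j ord0 =
      \sum_j w n j * (y - nu n) j ord0.
      by rewrite -sumrB; apply: eq_bigr => j _; rewrite !mxE mulrBr.
    have h1 := le_trans (hq (y - nu n)) yA.
    rewrite -ler_sqr ?nnegrE ?(ltW d0)// real_normK ?num_real//.
    rewrite -(ler_pM2l Npos); apply: le_trans h1 _.
    by rewrite -ler_pdivrMr// div1r ltW.
  have h1 : 2^-1 <= Pn x n (An n) by near: n; exact: emp_mve_half.
  have h2 := PnS x n sub.
  have : Pn x n (setT `&` slab (w n) (\sum_j w n j * nu n j ord0) d) <=
    pi0 * fine (Q setT) + (2^-1 - pi0) / 2.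
    by near: n.
  by rewrite probability_setT /= mulr1; have := pi0_lt; lra.
have dB : \forall n \near U, forall k, N n k k <= B.
  near=> n => k; apply: (@le_trans _ _ (N n (i n) (i n))).
    by move: k; near: n; apply: filterS hw => n [].
  by near: n.
(* The ratio of volume to sqrt (det Sigma), common to all parameters by [uvol_prop]. *)
pose kap := uvol th0 / Num.sqrt (\det th0.2).
have kap0 : 0 < kap by rewrite divr_gt0 ?(uvol_gt0 pth0)// (sqrt_det_gt0 g_ell pth0).
have uvE n : Theta R p (th n) -> uvol (th n) = kap * Num.sqrt (\det (invmx (N n))).
  move=> pn; have := uvol_prop g_ell gG2 pn pth0; rewrite -/kap => <-.
  by rewrite divfK// gt_eqF// (sqrt_det_gt0 g_ell pn).
have AnVol : \forall n \near U, lam (An n) = (kap * Num.sqrt (\det (invmx (N n))))%:E.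
  near=> n; have [pn AnE] : posdefmx (N n) /\ An n = qball (N n) (nu n) 1 by near: n.
  have ptn : Theta R p (th n) by near: n.
  by rewrite -uvE// -(uvolE ptn) /= invmxK AnE.
have volb u : t0 < u -> \forall n \near U, kap * Num.sqrt (\det (invmx (N n))) <=
  Num.sqrt u ^+ p * uvol th0.
  move=> tu; have u0 := lt_trans t00 tu; have h := emp_mve_vol tu.
  by apply: filterS2 AnVol h => n ->; rewrite (qball_vol pth0)// lee_fin.
(* Bound on sqrt (det (N n)^-1) given by the volume of [E0 (t0 + 1)]; it keeps the determinants of
   the precision matrices away from 0. *)
pose C := Num.sqrt (t0 + 1) ^+ p * uvol th0 / kap.
have C0 : 0 < C.
  by rewrite divr_gt0// mulr_gt0 ?(uvol_gt0 pth0)// exprn_gt0// sqrtr_gt0 addr_gt0.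
have detb : \forall n \near U, (C ^+ 2)^-1 <= \det (N n).
  have h := volb _ (ltr_pwDr ltr01 (lexx t0)).
  near=> n; have ptn : Theta R p (th n) by near: n.
  have [pn _] : posdefmx (N n) /\ An n = qball (N n) (nu n) 1 by near: n.
  have := det_gt0 g_ell ptn; rewrite /= det_inv invr_gt0 => dn.
  rewrite -[leRHS]invrK lef_pV2 ?posrE ?invr_gt0 ?exprn_gt0//.
  have : kap * Num.sqrt (\det (invmx (N n))) <= Num.sqrt (t0 + 1) ^+ p * uvol th0 by near: n.
  rewrite mulrC -ler_pdivlMr// -/C det_inv => hC.
  rewrite -[leLHS]sqr_sqrtr ?invr_ge0 ?(ltW dn)//.
  by rewrite ler_sqr ?nnegrE ?sqrtr_ge0 ?(ltW C0).
have C2 : 0 < (C ^+ 2)^-1 by rewrite invr_gt0 exprn_gt0.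
have t1 : t0 < t0 + 1 by rewrite ltrDl.
have [K hK] := @qball_bounded R p (Prec th0) th0.1 (t0 + 1) pM0.
have Pu := P_qballo_gt t1.
(* [An n] has at least half of the sample and the bounded set [O0 (t0 + 1)] more than half, so they
   meet. A common point anchors the center. *)
have meet : \forall n \near U, exists z, cbox K z /\ qball (N n) (nu n) 1 z.
  pose e := (fine (P (O0 (t0 + 1))) - 2^-1) / 2.
  have e0 : 0 < e by rewrite divr_gt0// subr_gt0.
  have h := Pn_open x_weak UU Uoo (@open_qballo R p (Prec th0) th0.1 (t0 + 1)) e0.
  near=> n; apply: contrapT => /forallNP hz.
  have [pn AnE] : posdefmx (N n) /\ An n = qball (N n) (nu n) 1 by near: n.
  have sub : O0 (t0 + 1) `<=` ~` An n.
    move=> y yO; rewrite AnE => yA; apply: (hz y); split=> //; apply: hK; exact: qballoW.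
  have := PnS x n sub; rewrite PnC; last by near: n; exact: n_pos.
  have h1 : 2^-1 <= Pn x n (An n) by near: n; exact: emp_mve_half.
  have : fine (P (O0 (t0 + 1))) - e <= Pn x n (O0 (t0 + 1)) by near: n.
  by rewrite /e; lra.
have exz n : exists z, (exists z, cbox K z /\ qball (N n) (nu n) 1 z) -> cbox K z /\
  qball (N n) (nu n) 1 z.
  by have [[z hz]|hn] := pselect (exists z, cbox K z /\ qball (N n) (nu n) 1 z);
    [exists z|exists 0].
pose z n := projT1 (cid (exz n)).
have hz : \forall n \near U, cbox K (z n) /\ qball (N n) (nu n) 1 (z n).
  by apply: filterS meet => n; exact: (projT2 (cid (exz n))).
have pN : \forall n \near U, posdefmx (N n) by apply: filterS hN => n [].
have [nu' [N' [pN' hnu hN' hS]]] := posdef_limit UU C2 pN dB detb hz.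
have [K' hK'] : exists K', \forall n \near U, An n `<=` cbox K'.
  have [B1 hB1] := @cvg_bounded_mx R nat U p p (fun n => invmx (N n)) (invmx N') _ hS.
  have [B2 hB2] := @cvg_bounded_mx R nat U p 1 nu nu' _ hnu.
  exists (B2 + 1 + B1 * `|1|); near=> n.
  have [pn ->] : posdefmx (N n) /\ An n = qball (N n) (nu n) 1 by near: n.
  have b1 : forall i j, `|invmx (N n) i j| <= B1 by near: n.
  have b2 : forall i j, `|nu n i j| <= B2 by near: n.
  by apply: qball_cbox => // j; apply: le_trans (ler_norm _) _.
suff [e1 e2] : th0.1 = nu' /\ t0^-1 *: Prec th0 = N'.
  by exists N, nu; split=> //; [rewrite e1|rewrite e2|exists K'].
have pth' : Theta R p (nu', invmx N') by exact: pd_inv.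
have mq u : measurable (qball N' nu' u) by exact: measurable_qball.
(* By uniform convergence of the forms, [An n] is eventually contained in this closed enlargement of
   the limit, to which the closed-set bound applies. *)
have Pq e : 0 < e -> 2^-1 <= fine (P (qball N' nu' (1 + e))).
  move=> e0; apply/ler_addgt0Pr => d d0.
  have h := Pn_closed x_weak Uoo (@closed_qball R p N' nu' (1 + e)) d0.
  have hu := qf_uniform K' UU hnu hN' e0.
  have : \forall n \near U, 2^-1 <= fine (P (qball N' nu' (1 + e))) + d;
    last by move=> /filter_ex [].
  near=> n.
  have h1 : 2^-1 <= Pn x n (An n) by near: n; exact: emp_mve_half.
  have h2 : Pn x n (qball N' nu' (1 + e)) <= fine (P (qball N' nu' (1 + e))) + d by near: n.
  apply: le_trans h1 (le_trans _ h2); apply: PnS => y yA.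
  have [_ AnE] : posdefmx (N n) /\ An n = qball (N n) (nu n) 1 by near: n.
  have yK : An n `<=` cbox K' by near: n.
  have hy : forall y, @cbox R p K' y -> `|qf (N n) (y - nu n) - qf N' (y - nu')| < e by near: n.
  have := hy y (yK y yA); move: yA; rewrite AnE /qball /= => yA.
  by rewrite ltr_norml => /andP[]; lra.
have P1 : (2^-1%:E <= P (qball N' nu' 1))%E.
  rewrite (fin_num_probability P (mq 1)) lee_fin; apply/ler_addgt0Pr => d d0.
  have dF i1 j1 : (i1 <= j1)%N -> qball N' nu' (1 + j1.+1%:R^-1) `<=` qball N' nu' (1 +
    i1.+1%:R^-1).
    by move=> ij; apply: qballS; rewrite lerD2l lef_pV2 ?posrE// ler_nat ltnS.
  have capF : \bigcap_k qball N' nu' (1 + k.+1%:R^-1) `<=` qball N' nu' 1.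
    move=> y hy; apply/ler_addgt0Pr => e e0.
    apply: le_trans (hy (Num.trunc e^-1) I) _; rewrite lerD2l.
    by rewrite -[leRHS]invrK lef_pV2 ?posrE ?invr_gt0//; exact: ltW (truncnS_gt _).
  have [k hk] := decreasing_limit P d0 (fun k => mq _) (mq 1) dF capF.
  by apply: le_trans hk; apply: Pq; rewrite invr_gt0.
(* The volume passes to the limit through the determinant, and the bounds of [emp_mve_vol] are used
   with u decreasing to t0. *)
have vol1 : (lam (qball N' nu' 1) <= lam A)%E.
  have := uvolE pth'; rewrite /= invmxK => ->; rewrite AE (qball_vol pth0)// lee_fin.
  have ptn' : uvol (nu', invmx N') = kap * Num.sqrt (\det (invmx N')).
    have := uvol_prop g_ell gG2 pth' pth0; rewrite -/kap => <-.
    by rewrite divfK// gt_eqF// (sqrt_det_gt0 g_ell pth').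
  rewrite ptn'.
  have cv : kap * Num.sqrt (\det (invmx (N n))) @[n --> U] --> kap * Num.sqrt (\det (invmx N')).
    apply: cvgM; first exact: cvg_cst.
    apply: (@continuous_cvg _ _ _ U _ (fun n => \det (invmx (N n))) (@Num.sqrt R));
      first exact: sqrt_continuous.
    exact: cvg_det.
  have hu u : t0 < u -> kap * Num.sqrt (\det (invmx N')) <= Num.sqrt u ^+ p * uvol th0.
    by move=> tu; apply: (cvgr_to_le cv); exact: volb.
  have cu : Num.sqrt u ^+ p * uvol th0 @[u --> t0^'+] --> Num.sqrt t0 ^+ p * uvol th0.
    apply: cvg_at_right_filter; apply: cvgM; last exact: cvg_cst.
    apply: (@continuous_cvg _ _ _ (nbhs t0) _ (@Num.sqrt R) (fun s => s ^+ p));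
      first exact: exprn_continuous.
    exact: sqrt_continuous.
  by apply: (cvgr_to_ge cu); near=> u; apply: hu; near: u; exact: nbhs_right_gt.
have A'mve : is_mve P (qball N' nu' 1).
  have [_ _ Amin] := A_mve; split=> //; last by move=> B' eB' PB';
    exact: le_trans vol1 (Amin B' eB' PB').
  by have := is_ellipsoid_qball pth' (ltr01 : 0 < 1 :> R); rewrite /= invmxK.
have eA : qball N' nu' 1 = E0 t0 by exact: etrans (A_unique A'mve) AE.
have h y : (qf (t0^-1 *: Prec th0) (y - th0.1) <= 1) = (qf N' (y - nu') <= 1).
  have e2 : E0 t0 = qball (t0^-1 *: Prec th0) th0.1 1 by rewrite -qball_scale// mulr1.
  rewrite e2 in eA.
  by apply/idP/idP => [|]; [change (qball (t0^-1 *: Prec th0) th0.1 1 y -> qball N' nu' 1 y);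
    rewrite eA|
     change (qball N' nu' 1 y -> qball (t0^-1 *: Prec th0) th0.1 1 y); rewrite eA].
apply: (@ellipsoid_inj R p _ _ _ _ 1) => //.
by apply: pdZ => //; rewrite invr_gt0.
Unshelve. all: by end_near. Qed.

End empirical_mve.

Section empirical_mve_bounds.
Import numFieldNormedType.Exports.
Context {R : realType} {p : nat} (p_gt0 : (0 < p)%N) (g : R -> R).
Hypotheses (g_ell : elliptical_generator p g) (gG2 : condG2 g).
Variables (P Q : probability 'cV[R]_p R) (pi0 : R) (th0 : 'cV[R]_p * 'M[R]_p).
Hypotheses (P_gem : gross_error_model g P pi0 th0 Q) (pi0_lt : pi0 < 2^-1).
Variable A : set 'cV[R]_p.
Hypotheses (A_mve : is_mve P A) (A_unique : forall B, is_mve P B -> B = A).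
Local Notation lam := (lebesgue_col R p).
Local Notation Prec th := (invmx th.2).
Local Notation E0 u := (qball (Prec th0) th0.1 u).
Local Notation fin B := (fine (elliptical_prob g th0 B)).
Local Notation pth0 := (Theta0 P_gem).
Local Notation t0 := (mve_level p_gt0 g_ell gG2 P_gem pi0_lt A_mve A_unique).
Local Notation mve_central_qball := (mve_central_qball p_gt0 g_ell gG2 P_gem pi0_lt A_mve A_unique).
Local Notation mve_level_gt0 := (mve_level_gt0 p_gt0 g_ell gG2 P_gem pi0_lt A_mve A_unique).

Let pM0 : posdefmx (Prec th0). Proof. exact: pd_inv pth0. Qed.
Let t00 : 0 < t0. Proof. exact: mve_level_gt0. Qed.

Lemma mve_shrink (m : probability 'cV[R]_p R) e v : t0 < v -> 0 < e ->
  exists u, [/\ t0 < u, u < v & fine (m (E0 u)) <= fine (m A) + e].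
Proof.
move=> tv e0; pose AE : A = E0 t0 := mve_central_qball.
have -> : m A = m (E0 t0) by exact: congr1 AE.
(* [k.+2] keeps the level strictly below v even for k = 0. *)
pose F k := E0 (t0 + (v - t0) * k.+2%:R^-1).
have vt : 0 < v - t0 by rewrite subr_gt0.
have dF i j : (i <= j)%N -> F j `<=` F i.
  by move=> ij; apply: qballS; rewrite lerD2l ler_pM2l// lef_pV2 ?posrE// ler_nat !ltnS.
have capF : \bigcap_k F k `<=` E0 t0.
  move=> y hy; apply/ler_addgt0Pr => d d0.
  apply: le_trans (hy (Num.trunc ((v - t0) / d)) I) _; rewrite lerD2l.
  rewrite ler_pdivrMr// mulrC -ler_pdivrMr//; apply: ltW; apply: lt_trans (truncnS_gt _) _.
  by rewrite ltr_nat.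
have [k hk] := decreasing_limit m e0 (fun k =>
  measurable_qball _ _ _) (measurable_qball _ _ _) dF capF.
exists (t0 + (v - t0) * k.+2%:R^-1); split=> //.
  by rewrite ltrDl mulr_gt0// invr_gt0.
by rewrite -ltrBDl ltr_pdivrMr// ltr_pMr// ltr1n.
Qed.

(** The volume of [E0 u] is continuous in u. The shell eventually contains the symmetric difference
    of A and [An n]. *)
Lemma mve_annulus e v : t0 < v -> 0 < e ->
  exists u' u, [/\ 0 < u', u' < t0, t0 < u, u < v & fine (lam (E0 u `\` E0 u')) <= e].
Proof.
move=> tv e0; pose f (u : R) := Num.sqrt u ^+ p * uvol th0.
have cf : {for t0, continuous f}.
  apply: cvgM; last exact: cvg_cst.
  apply: (@continuous_cvg _ _ _ (nbhs t0) _ (@Num.sqrt R) (fun s => s ^+ p));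
    first exact: exprn_continuous.
  exact: sqrt_continuous.
have e2 : 0 < e / 2 by rewrite divr_gt0.
have h : \forall u \near t0, `|f t0 - f u| < e / 2
  by exact: (@cvgr_dist_lt _ _ _ (nbhs t0) _ f (f t0)).
have [u [u1 u2 u3]] : exists u, [/\ t0 < u, u < v & `|f t0 - f u| < e / 2].
  have hr : \forall u \near t0^'+, [/\ t0 < u, u < v & `|f t0 - f u| < e / 2].
    near=> u; split; near: u; [exact: nbhs_right_gt|exact: nbhs_right_lt|apply: cvg_within;
      exact: h].
  by have [u hu] := filter_ex hr; exists u.
have [u' [u1' u2' u3']] : exists u, [/\ 0 < u, u < t0 & `|f t0 - f u| < e / 2].
  have hr : \forall u \near t0^'-, [/\ 0 < u, u < t0 & `|f t0 - f u| < e / 2].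
    near=> s; split; near: s; [exact: nbhs_left_gt|exact: nbhs_left_lt|apply: cvg_within; exact: h].
  by have [u' hu] := filter_ex hr; exists u'.
exists u', u; split=> //.
have mE w : measurable (E0 w) by exact: measurable_qball.
have h1 := fine_measureDI (mu := lam) (mE u) (mE u') (qball_lty th0.1 u pM0).
have e1 : E0 u `&` E0 u' = E0 u'.
  by rewrite setIC; apply/setIidPl; apply: qballS; apply: ltW (lt_trans u2' u1).
rewrite e1 (qball_vol pth0 u1') (qball_vol pth0 (lt_trans t00 u1)) /= in h1.
have : f u = f u' + fine (lam (E0 u `\` E0 u')) by exact: h1.
by move: u3 u3'; rewrite !ltr_norml => /andP[] + + /andP[]; lra.
Unshelve. all: by end_near. Qed.

Variable x : nat -> 'cV[R]_p.
Hypothesis x_weak : weak_limsup x P.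
Variable U : set_system nat.
Hypotheses (UU : UltraFilter U) (Uoo : \oo `<=` U).
Variable An : nat -> set 'cV[R]_p.
Hypothesis hAn : \forall n \near \oo, is_mve (emp_prob x n) (An n).

Lemma emp_mve_sub u : t0 < u -> \forall n \near U, An n `<=` E0 u.
Proof.
move=> tu.
have [N [nu [hN hnu hN' [K hK]]]] := emp_mve_cvg p_gt0 g_ell gG2 P_gem pi0_lt A_mve A_unique
  x_weak UU Uoo hAn.
have e0 : 0 < (u - t0) / t0 by rewrite divr_gt0// subr_gt0.
have h := qf_uniform K UU hnu hN' e0.
near=> n => y yA.
have yK : An n `<=` cbox K by near: n.
have [_ AnE] : posdefmx (N n) /\ An n = qball (N n) (nu n) 1 by near: n.
have hy : forall y, @cbox R p K y ->
  `|qf (N n) (y - nu n) - qf (t0^-1 *: Prec th0) (y - th0.1)| < (u - t0) / t0 by near: n.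
have := hy y (yK y yA); move: yA; rewrite AnE /qball /= => yA.
rewrite qfZl ltr_norml => /andP[h1 _].
have : t0^-1 * qf (Prec th0) (y - th0.1) < 1 + (u - t0) / t0 by lra.
rewrite mulrC ltr_pdivrMr// mulrDl divfK ?gt_eqF// => h2.
by apply: ltW; apply: lt_le_trans h2 _; lra.
Unshelve. all: by end_near. Qed.

Lemma emp_mve_sup u : 0 < u -> u < t0 -> \forall n \near U, E0 u `<=` An n.
Proof.
move=> u0 ut.
have [N [nu [hN hnu hN' _]]] := emp_mve_cvg p_gt0 g_ell gG2 P_gem pi0_lt A_mve A_unique x_weak UU
  Uoo hAn.
have e0 : 0 < (t0 - u) / t0 by rewrite divr_gt0// subr_gt0.
have [K hK] := @qball_bounded R p (Prec th0) th0.1 u pM0.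
have h := qf_uniform K UU hnu hN' e0.
near=> n => y yE.
have [_ AnE] : posdefmx (N n) /\ An n = qball (N n) (nu n) 1 by near: n.
have hy : forall y, @cbox R p K y ->
  `|qf (N n) (y - nu n) - qf (t0^-1 *: Prec th0) (y - th0.1)| < (t0 - u) / t0 by near: n.
have := hy y (hK y yE); rewrite AnE /qball /= qfZl ltr_norml => /andP[_].
have : t0^-1 * qf (Prec th0) (y - th0.1) <= u / t0 by rewrite mulrC ler_pM2r ?invr_gt0.
have -> : (t0 - u) / t0 = 1 - u / t0 by rewrite mulrBl divff// gt_eqF.
lra.
Unshelve. all: by end_near. Qed.

(** The lower bound is part of the definition of an empirical MVE. The upper one comes from a closed
    ellipsoid [E0 u], slightly larger than A, which eventually contains [An n]. *)
Lemma Pn_emp_mve_cvg : Pn x n (An n) @[n --> U] --> (2^-1 : R).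
Proof.
apply/cvgrPdist_le => e e0.
have e2 : 0 < e / 2 by rewrite divr_gt0.
have [u [u1 _ hu]] := mve_shrink P (ltr_pwDr ltr01 (lexx t0)) e2.
have h := Pn_closed x_weak Uoo (@closed_qball R p (Prec th0) th0.1 u) e2.
have h2 := emp_mve_sub u1.
have h3 := emp_mve_half UU Uoo hAn.
have PA : fine (P A) = 2^-1 := mve_prob p_gt0 g_ell gG2 P_gem pi0_lt A_mve A_unique.
near=> n.
have k1 : An n `<=` E0 u by near: n.
have k2 : Pn x n (E0 u) <= fine (P (E0 u)) + e / 2 by near: n.
have k3 : 2^-1 <= Pn x n (An n) by near: n.
have k4 := PnS x n k1.
by rewrite distrC ler_distl; apply/andP; split; lra.
Unshelve. all: by end_near. Qed.

Lemma measurable_emp_mve : \forall n \near U, measurable (An n).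
Proof.
apply: Uoo; apply: filterS hAn => n [/is_ellipsoidP [N [nu [_ ->]]] _ _].
exact: measurable_qball.
Qed.

Lemma prob0_emp_mve_cvg : fin (An n) @[n --> U] --> (2 * (1 - pi0))^-1.
Proof.
rewrite -(prob0_A p_gt0 g_ell gG2 P_gem pi0_lt A_mve A_unique).
apply/cvgrPdist_le => e e0.
pose C := (Num.sqrt (\det th0.2))^-1 * g 0 + 1.
have C0 : 0 < C.
  by apply: ltr_wpDl => //; apply: mulr_ge0; [rewrite invr_ge0 sqrtr_ge0|exact: (gen_ge0 g_ell)].
have [u' [u [a1 a2 a3 a4 a5]]] := mve_annulus (ltr_pwDr ltr01 (lexx t0)) (divr_gt0 e0 C0).
have h1 := emp_mve_sub a3; have h2 := emp_mve_sup a1 a2; have h3 := measurable_emp_mve.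
have mE w : measurable (E0 w) by exact: measurable_qball.
have fS B B' : measurable B -> measurable B' -> B `<=` B' -> fin B <= fin B'.
  exact: (prob0S g_ell gG2 P_gem).
have mid B : measurable B -> E0 u' `<=` B -> B `<=` E0 u -> fin (E0 u') <= fin B <= fin (E0 u).
  by move=> mB s1 s2; rewrite !fS.
have w : fin (E0 u) - fin (E0 u') <= e.
  have := prob0_split g_ell gG2 P_gem (mE u) (mE u').
  have -> : E0 u `&` E0 u' = E0 u'.
    by rewrite setIC; apply/setIidPl; apply: qballS; apply: ltW (lt_trans a2 a3).
  have mD : measurable (E0 u `\` E0 u') by exact: measurableD.
  have lD : (lam (E0 u `\` E0 u') < +oo)%E.
    by apply: le_lt_trans (qball_lty th0.1 u pM0); exact: le_measureS.
  have : fin (E0 u `\` E0 u') <= C * fine (lam (E0 u `\` E0 u')).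
    apply: (prob0_le g_ell gG2 P_gem) => // y _.
    by apply: le_trans (elliptical_pdf_ub g_ell _ pth0) _; rewrite lerDl.
  have : C * fine (lam (E0 u `\` E0 u')) <= e.
    by rewrite mulrC -ler_pdivlMr.
  lra.
near=> n.
have k1 : An n `<=` E0 u by near: n.
have k2 : E0 u' `<=` An n by near: n.
have k3 : measurable (An n) by near: n.
have /andP[b1 b2] := mid _ k3 k2 k1.
have mA : measurable A by rewrite mve_central_qball.
have /andP[b3 b4] : fin (E0 u') <= fin A <= fin (E0 u).
  by apply: mid => //; rewrite mve_central_qball; apply: qballS; apply: ltW.
by rewrite ler_distl; apply/andP; split; lra.
Unshelve. all: by end_near. Qed.

End empirical_mve_bounds.

(** * Decay of the generator *)

Section tail.
Import numFieldNormedType.Exports.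
Context {R : realType} {p : nat} (p_gt0 : (0 < p)%N) (g : R -> R).
Hypotheses (g_ell : elliptical_generator p g) (gG2 : condG2 g).
Local Notation lam := (lebesgue_col R p).
Local Notation Prec th := (invmx th.2).

(* This is g r = O(r^-gamma) with gamma = p / 2 + p / (2 N), at r = T^2. *)
Definition tail_bound := exists (N : nat) (C T1 : R), [/\ (0 < N)%N, 0 < T1 &
  forall T, T1 <= T -> (T ^+ p * g (T ^+ 2)) ^+ N * T ^+ p <= C].

(* The three criteria are logarithms of such products, up to a constant factor. *)
Definition lik (E : set 'cV[R]_p) (c b : R) th (x : nat -> 'cV[R]_p) n : R :=
  \prod_(i < n) (if x i \in E then c * elliptical_pdf g th (x i) else b).

Definition spike (a : 'cV[R]_p) (s : R) : 'cV[R]_p * 'M[R]_p := (a, s ^+ 2 *: 1%:M).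

Lemma spike_Theta a s : 0 < s -> Theta R p (spike a s).
Proof. by move=> s0; apply: pdZ; [rewrite exprn_gt0|exact: pd1]. Qed.

Lemma spike_prec a s : 0 < s -> Prec (spike a s) = s ^- 2 *: 1%:M.
Proof.
move=> s0; rewrite /= invmxZ ?invmx1 //.
by rewrite unitmxZ ?unitmx1// unitfE gt_eqF// exprn_gt0.
Qed.

Lemma spike_pdf a s y : 0 < s ->
  elliptical_pdf g (spike a s) y = s^-1 ^+ p * g (qf 1%:M (y - a) / s ^+ 2).
Proof.
move=> s0; have s2 : 0 < s ^+ 2 by rewrite exprn_gt0.
rewrite (elliptical_pdfE g y (spike_Theta a s0)) spike_prec// qfZl.
rewrite /spike /= detZ det1 mulr1 -exprM mulnC exprM sqrtr_sqr.
rewrite ger0_norm ?exprn_ge0 ?(ltW s0)// exprVn /gabs ger0_norm ?mulr_ge0 ?invr_ge0 ?(ltW s2)//;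
  last exact: (pd_psd _ (pd1 _ _)).
by rewrite (mulrC (s ^- 2)).
Qed.

Lemma gen0_gt0 : 0 < g 0.
Proof.
have pT : Theta R p (spike 0 1) by exact: spike_Theta.
rewrite lt_neqAle (gen_ge0 g_ell)// andbT; apply/eqP => g0.
have := elliptical_prob_le g_ell gG2 (c := 0) pT (@measurableT _ _).
case: g_ell => _ _ -> // h.
have : (1 <= 0 * lam setT)%E.
  by apply: h => y _; apply: le_trans (elliptical_pdf_ub g_ell _ pT) _; rewrite -g0 mulr0.
by rewrite mul0e lee_fin ler10.
Qed.

(** What a law concentrated at scale s around an observation gives: the peak, a common lower bound
    at all observations, a mass outside E of the same order, and half of the mass inside E. *)
Lemma spike_bounds (E O : set 'cV[R]_p) (x : nat -> 'cV[R]_p) n (i : 'I_n) K0 :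
  measurable E -> E `<=` cbox K0 -> open O -> O `<=` E -> O (x i) ->
  exists D K s1, [/\ 0 < D, 0 < K, 0 < s1 & forall s, 0 < s -> s < s1 ->
    [/\ elliptical_pdf g (spike (x i) s) (x i) = s^-1 ^+ p * g 0,
     forall j : 'I_n, s^-1 ^+ p * g (D ^+ 2 / s ^+ 2) <= elliptical_pdf g (spike (x i) s) (x j),
     K * (s^-1 ^+ p * g (D ^+ 2 / s ^+ 2)) <= fine (elliptical_prob g (spike (x i) s) (~` E)) &
     2^-1 <= fine (elliptical_prob g (spike (x i) s) E)]].
Proof.
move=> mE EK oO OE Oi; set a := x i.
have pI : posdefmx (1%:M : 'M[R]_p) by exact: pd1.
have q0 y : 0 <= qf (1%:M : 'M[R]_p) y := pd_psd _ pI.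
have pT1 := spike_Theta a ltr01.
have lamE : (lam E < +oo)%E by exact: lebesgue_bounded_lty EK.
pose V : R := fine (lam (qball 1%:M a 1)).
have VE : lam (qball 1%:M a 1) = V%:E by rewrite fineK// fin_numElt (qball_lty _ _ pI)//
  (lt_le_trans (ltNyr 0)).
have V0 : 0 < V.
  by have := qball_gt0 (1%:M : 'M[R]_p) a; rewrite VE lte_fin.
(* The ball of radius D about the observation contains the whole sample and has more volume than E;
   the summand 1 gives D <= D ^ 2 and D <= D ^ p. *)
pose D := 1 + fine (lam E) / V + \sum_(j < n) qf 1%:M (x j - a).
have D1 : 1 <= D.
  rewrite /D -addrA lerDl addr_ge0 ?divr_ge0 ?fine_ge0 ?(ltW V0)//.
  by apply: sumr_ge0.
have D0 : 0 < D by exact: lt_le_trans D1.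
have DD : D <= D ^+ 2 by rewrite expr2 ler_peMr// ltW.
have xD (j : 'I_n) : qf 1%:M (x j - a) <= D ^+ 2.
  apply: le_trans DD; rewrite /D (bigD1 j)//=.
  have s1 : 0 <= \sum_(k < n | k != j) qf 1%:M (x k - a) by exact: sumr_ge0.
  have s2 : 0 <= fine (lam E) / V by rewrite divr_ge0 ?fine_ge0 ?(ltW V0).
  by move: s1 s2; lra.
pose Big := qball 1%:M a (D ^+ 2).
have mB : measurable Big by exact: measurable_qball.
have lB : (lam Big < +oo)%E by exact: qball_lty.
have BigE : fine (lam Big) = D ^+ p * V.
  by rewrite /Big qball_dilate ?exprn_gt0// VE /= sqrtr_sqr ger0_norm// ltW.
pose K := fine (lam Big) - fine (lam E).
have K_gt0 : 0 < K.
  rewrite subr_gt0 BigE -ltr_pdivrMr//; apply: (@lt_le_trans _ _ D).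
    rewrite /D addrAC addrC ltrDl ltr_wpDr//.
    exact: sumr_ge0.
  by rewrite -{1}(expr1 D); apply: ler_weXn2l.
have KD : K <= fine (lam (Big `\` E)).
  rewrite /K (fine_measureDI mB mE lB).
  have := fine_measureS (measurableI _ _ mB mE) mE lamE (@subIsetr _ Big E); lra.
have [e e0 he] : exists2 e : R, 0 < e & qball 1%:M a e `<=` E.
  have [e e0 he] := nbhs_qball (open_nbhs_nbhs (conj oO Oi)).
  by exists e => //; exact: subset_trans he OE.
have [m1 hm1] := elliptical_probability g_ell gG2 pT1.
have [u u0 hu] : exists2 u : R, 0 < u & 2^-1 <=
  fine (elliptical_prob g (spike a 1) (qball 1%:M a u)).
  have mQ k : measurable (qball (1%:M : 'M[R]_p) a k.+1%:R) by exact: measurable_qball.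
  have dF (k l : nat) : (k <= l)%N -> ~` qball (1%:M : 'M[R]_p) a l.+1%:R `<=` ~` qball (1%:M :
    'M[R]_p) a k.+1%:R.
    by move=> kl; apply: subsetC; apply: qballS; rewrite ler_nat.
  have cap : \bigcap_k ~` qball (1%:M : 'M[R]_p) a k.+1%:R `<=` set0.
    by rewrite -setC_bigcup bigcup_qball setCT.
  have h2 : (0 : R) < 2^-1 by rewrite invr_gt0.
  have [k hk] := decreasing_limit m1 h2 (fun k => measurableC (mQ k)) measurable0 dF cap.
  exists k.+1%:R => //; rewrite -hm1.
  move: hk; rewrite measure0 /= add0r probability_setC// (fin_num_probability m1 (mQ k)) /=.
  lra.
(* For s < s1 the ball of level s ^ 2 * u, which carries at least half of the mass of the spike,
   lies within E. *)
pose s1 := Num.sqrt (e / u).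
have s10 : 0 < s1 by rewrite sqrtr_gt0 divr_gt0.
exists D, K, s1; split=> // s s0 ss1.
have pTs := spike_Theta a s0.
have s2 : 0 < s ^+ 2 by rewrite exprn_gt0.
have ge_pdf y : qf 1%:M (y - a) <= D ^+ 2 ->
    s^-1 ^+ p * g (D ^+ 2 / s ^+ 2) <= elliptical_pdf g (spike a s) y.
  move=> hy; rewrite spike_pdf// ler_wpM2l ?exprn_ge0 ?invr_ge0 ?(ltW s0)//.
  apply: (gen_le g_ell); first by rewrite divr_ge0// ltW.
  by rewrite ler_pM2r// invr_gt0.
have [ms hms] := elliptical_probability g_ell gG2 pTs.
have c0 : 0 <= s^-1 ^+ p * g (D ^+ 2 / s ^+ 2).
  by rewrite mulr_ge0 ?exprn_ge0 ?invr_ge0 ?(ltW s0)// (gen_ge0 g_ell)// divr_ge0 ?exprn_ge0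
    ?(ltW s0) ?(ltW D0).
have mBE : measurable (Big `\` E) by exact: measurableD.
have lBE : (lam (Big `\` E) < +oo)%E by apply: le_lt_trans lB; exact: le_measureS.
split.
- by rewrite spike_pdf// /a subrr qf0 mul0r.
- by move=> j; exact: ge_pdf.
- apply: (@le_trans _ _ (fine (elliptical_prob g (spike a s) (Big `\` E)))); last first.
    rewrite -!hms; apply: fine_probabilityS => //; exact: measurableC.
  have := elliptical_prob_ge gG2 pTs mBE c0 (fun y hy => ge_pdf y hy.1).
  rewrite -hms (fin_num_probability ms mBE).
  rewrite -(@fineK _ (lam (Big `\` E))); last by rewrite fin_numElt lBE (lt_le_trans (ltNyr 0)).
  rewrite -EFinM lee_fin /=; apply: le_trans.
  by rewrite mulrC ler_wpM2l.
- apply: le_trans hu _.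
  have eq1 : (fun y => qf (Prec (spike a 1)) (y - (spike a 1).1)) @^-1` `]-oo, u] = qball 1%:M a u.
    by rewrite spike_prec// expr1n invr1 scale1r; apply/seteqP; split=> y; rewrite /= in_itv.
  have mI : measurable (`]-oo, u] : set (measurableTypeR R)) by exact: measurable_itv.
  have := radial_prob_eq g_ell gG2 pTs pT1 mI; rewrite eq1 => <-.
  rewrite -!hms; apply: fine_probabilityS => //.
    by rewrite -[X in measurable X]setTI; exact: measurable_qf.
  move=> y /=; rewrite in_itv /= spike_prec// qfZl => hy; apply: he; rewrite /qball /=.
  rewrite mulrC ler_pdivrMr// in hy; apply: le_trans hy _.
  rewrite mulrC -ler_pdivlMr//; apply: ltW.
  rewrite -(@sqr_sqrtr _ (e / u)) ?divr_ge0 ?(ltW e0) ?(ltW u0)//.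
  by rewrite ltr_sqr ?nnegrE ?(ltW s0) ?(ltW s10).
Qed.

(* At a parameter of scale s concentrated at an observation of E, one factor is of
   order s^-p and the others are at least of order s^-p g(D^2 / s^2). *)
Lemma tail_of_spikes (E O : set 'cV[R]_p) (x : nat -> 'cV[R]_p) n (i : 'I_n) K0 M :
  measurable E -> E `<=` cbox K0 -> open O -> O `<=` E -> O (x i) ->
  (forall th, Theta R p th -> 2^-1 <= fine (elliptical_prob g th E) ->
     exists c b, [/\ 2^-1 <= c, Num.min 2^-1 (fine (elliptical_prob g th (~` E))) <= b &
       lik E c b th x n <= M]) ->
  tail_bound.
Proof.
move=> mE EK oO OE Oi hM.
have [D [K [s1 [D0 K_gt0 s10 hs]]]] := spike_bounds mE EK oO OE Oi.
have g0 := gen0_gt0.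
have n0 : (0 < n)%N by exact: leq_ltn_trans (ltn_ord i).
have h2 : (0 : R) < 2^-1 by rewrite invr_gt0.
pose k := Num.min 2^-1 K; have k0 : 0 < k by rewrite lt_min h2.
pose W := k * D ^- p; have W0 : 0 < W by rewrite mulr_gt0// invr_gt0 exprn_gt0.
pose M1 := 2 * M * D ^+ p / g 0.
(* The first summand makes s = D / T smaller than [s1]; the second excludes that the minimum [mn]
   below equals 1/2. *)
pose T1 := D / s1 + `|M1| * 2 ^+ n + 1.
have T10 : 1 <= T1 by rewrite lerDr; apply: addr_ge0; [apply/ltW/divr_gt0|apply: mulr_ge0 => //;
  exact: exprn_ge0].
(* The exponent N of the tail bound is the size of the sample for which the criterion is bounded. *)
exists n, (M1 / W ^+ n), (T1 + 1); split=> //; first by rewrite ltr_pwDr// (le_trans ler01).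
move=> T T1T.
have T_gt : T1 < T by apply: lt_le_trans T1T; rewrite ltrDl.
have Tge1 : 1 <= T by rewrite (le_trans T10)// ltW.
have T0 : 0 < T by exact: lt_le_trans Tge1.
pose s := D / T; have s0 : 0 < s by rewrite divr_gt0.
have ss1 : s < s1.
  rewrite ltr_pdivrMr// mulrC -ltr_pdivrMr//; apply: le_lt_trans T_gt.
  by rewrite /T1 -addrA lerDl addr_ge0// mulr_ge0// exprn_ge0.
have [e1 e2 e3 e4] := hs s s0 ss1.
have [c [b [c2 hb hl]]] := hM _ (spike_Theta (x i) s0) e4.
have Ds : D ^+ 2 / s ^+ 2 = T ^+ 2.
  rewrite -expr_div_n /s; congr (_ ^+ 2); rewrite invf_div mulrC mulfVK// gt_eqF//.
have sT : s^-1 ^+ p = T ^+ p * D ^- p by rewrite /s invf_div expr_div_n.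
rewrite Ds in e2 e3.
have gT : 0 <= g (T ^+ 2) by rewrite (gen_ge0 g_ell)// exprn_ge0// ltW.
pose h := T ^+ p * g (T ^+ 2).
have h0 : 0 <= h by rewrite mulr_ge0// exprn_ge0// ltW.
have Yh : s^-1 ^+ p * g (T ^+ 2) = D ^- p * h by rewrite sT /h mulrAC mulrC.
pose mn := Num.min 2^-1 (W * h).
have mn0 : 0 <= mn by rewrite le_min (ltW h2) mulr_ge0// ltW.
have mn1 : mn <= 1 by rewrite ge_min; apply/orP; left; rewrite invf_le1// ler1n.
have Wh z : k <= z -> W * h <= z * (s^-1 ^+ p * g (T ^+ 2)).
  by move=> kz; rewrite Yh /W -mulrA ler_wpM2r// mulr_ge0// invr_ge0 exprn_ge0// ltW.
have k2 : k <= 2^-1 by rewrite ge_min lexx.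
have kK : k <= K by rewrite ge_min lexx orbT.
pose v (j : 'I_n) := if x j \in E then c * elliptical_pdf g (spike (x i) s) (x j) else b.
have Y0 : 0 <= s^-1 ^+ p * g (T ^+ 2) by rewrite Yh mulr_ge0// invr_ge0 exprn_ge0// ltW.
have vj (j : 'I_n) : mn <= v j.
  rewrite /v; case: ifP => _.
    rewrite ge_min; apply/orP; right; apply: le_trans (Wh _ k2) _.
    by apply: ler_pM => //; rewrite ltW.
  apply: le_trans hb; rewrite le_min; apply/andP; split; first by rewrite ge_min lexx.
  by rewrite ge_min; apply/orP; right; apply: le_trans (Wh _ kK) _.
have vi : 2^-1 * (s^-1 ^+ p * g 0) <= v i.
  rewrite /v; have -> : x i \in E by rewrite inE; exact: OE.
  rewrite e1; apply: ler_wpM2r => //; rewrite mulr_ge0 ?(ltW g0)//.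
  by rewrite exprn_ge0// invr_ge0 ltW.
have low : 2^-1 * (s^-1 ^+ p * g 0) * mn ^+ n <= M.
  apply: le_trans hl; rewrite /lik (bigD1 i)//=; apply: ler_pM.
  - by rewrite !mulr_ge0 ?(ltW h2) ?(ltW g0)// exprn_ge0// invr_ge0 ltW.
  - by rewrite exprn_ge0.
  - exact: vi.
  - apply: (@le_trans _ _ (\prod_(j < n | j != i) mn)).
      rewrite prodr_const; apply: ler_wiXn2l => //.
      by apply: leq_trans (max_card _) _; rewrite card_ord.
    by apply: ler_prod => j _; rewrite mn0 /=; exact: vj.
have lowT : T ^+ p * mn ^+ n <= M1.
  rewrite /M1 ler_pdivlMr// -ler_pdivrMr ?exprn_gt0//.
  move: low; rewrite sT; set u := T ^+ p; set w := D ^- p; set z := mn ^+ n.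
  by move=> hh; rewrite -ler_pdivrMl//; apply: le_trans hh; rewrite le_eqVlt; apply/orP; left;
    apply/eqP; ring.
(* Otherwise no factor would fall below 1/2, and the peak T ^ p alone would exceed the bound on the
   criterion. *)
have Wlt : W * h < 2^-1.
  rewrite ltNge; apply/negP => hge.
  have mnE : mn = 2^-1 by rewrite /mn; apply/min_idPl.
  move: lowT; rewrite mnE exprVn; rewrite ler_pdivrMr ?exprn_gt0// => h3.
  have : T <= T ^+ p by rewrite -{1}(expr1 T); apply: ler_weXn2l.
  have : M1 * 2 ^+ n <= `|M1| * 2 ^+ n by rewrite ler_wpM2r ?exprn_ge0 ?ler_norm.
  have : 0 < D / s1 by rewrite divr_gt0.
  move: T_gt; rewrite /T1; lra.
have mnE : mn = W * h by rewrite /mn; apply/min_idPr/ltW.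
by rewrite ler_pdivlMr ?exprn_gt0// mulrC mulrA -exprMn -mulrC -mnE.
Qed.

(** If g (T ^ 2) >= e, the tail bound gives e ^ N * T <= C, which fails for large T. *)
Lemma tail_vanish e : tail_bound -> 0 < e -> exists2 r : R, 0 < r & g r < e.
Proof.
move=> [N [C [T1 [N0 T10 h]]]] e0.
pose T := T1 + 1 + (`|C| + 1) / e ^+ N.
have eN : 0 < e ^+ N by rewrite exprn_gt0.
have T1T : T1 + 1 <= T by rewrite lerDl divr_ge0 ?(ltW eN)// addr_ge0.
have Tge1 : 1 <= T by apply: le_trans T1T; rewrite lerDr ltW.
have T0 : 0 < T by exact: lt_le_trans Tge1.
exists (T ^+ 2); first by rewrite exprn_gt0.
have gT : 0 <= g (T ^+ 2) by rewrite (gen_ge0 g_ell)// exprn_ge0// ltW.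
rewrite ltNge; apply/negP => hge.
have h1 : (T ^+ p * g (T ^+ 2)) ^+ N * T ^+ p <= C.
  by apply: h; apply: le_trans T1T; rewrite lerDl.
have Tp : T <= T ^+ p by rewrite -{1}(expr1 T); apply: ler_weXn2l.
have Tp1 : 1 <= T ^+ p by exact: le_trans Tp.
have : e ^+ N * T <= C.
  apply: le_trans h1; apply: ler_pM => //; rewrite ?(ltW eN) ?(ltW T0)//.
  apply: lerXn2r; rewrite ?nnegrE ?(ltW e0) ?mulr_ge0 ?(le_trans ler01 Tp1)//.
  by apply: le_trans hge _; rewrite ler_peMl.
rewrite mulrC -ler_pdivlMr// => h2.
have : C / e ^+ N <= (`|C| + 1) / e ^+ N.
  by rewrite ler_pM2r ?invr_gt0//; apply: le_trans (ler_norm _) _; rewrite lerDl.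
move: h2; rewrite {1}/T; lra.
Qed.

End tail.

(** * Compactness of the estimates *)

Section counting.
Context {R : realType}.

Lemma count_ineq (n m s a : R) : 0 <= n -> 4 * (m * s) <= 1 -> 2^-1 <= a ->
  4 * (m * (s * n)) + n <= 4 * (a * n).
Proof.
by move=> n0 h1 h2; have := ler_wpM2r n0 h1; have := ler_wpM2r n0 h2; lra.
Qed.

(* [a i] and [s i] stand for the i-th observation being in A_n and in A_n and the
   slab, and X for the square root of the order of the determinant of the precision. *)
Lemma count_bound n (v : 'I_n -> R) (a s : 'I_n -> bool) (k X C : R) N :
  (0 < n)%N -> 0 < k -> (forall i, 0 <= v i) -> k ^+ n <= \prod_i v i -> 1 <= X -> 0 <= C ->
  (forall i, v i ^+ N * X ^+ a i <= C * X ^+ (N.+1 * s i)) ->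
  (4 * (N.+1 * \sum_i s i) + n <= 4 * \sum_i a i)%N ->
  k ^+ (4 * N) * X <= C ^+ 4.
Proof.
move=> n0 k0 v0 kv X1 C0 h hn.
have X0 : 0 < X by exact: lt_le_trans X1.
have h1 : (\prod_i v i) ^+ N * X ^+ (\sum_i a i) <= C ^+ n * X ^+ (N.+1 * \sum_i s i).
  have -> : C ^+ n = \prod_(i < n) C by rewrite prodr_const card_ord.
  rewrite big_distrr/= -!prodrXr -prodrXl -!big_split /=.
  by apply: ler_prod => i _; rewrite h mulr_ge0 ?exprn_ge0// ltW.
have h2 : (k ^+ n) ^+ N * X ^+ (\sum_i a i) <= C ^+ n * X ^+ (N.+1 * \sum_i s i).
  apply: le_trans h1; apply: ler_wpM2r; first by rewrite exprn_ge0// ltW.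
  by apply: lerXn2r => //; rewrite nnegrE ?exprn_ge0 ?(ltW k0)//; apply: prodr_ge0.
(* With fourth powers the counting hypothesis compares integer exponents and leaves X ^ n on the
   left; an n-th root then removes the sample size. *)
have h3 : ((k ^+ n) ^+ N * X ^+ (\sum_i a i)) ^+ 4 <= (C ^+ n * X ^+ (N.+1 * \sum_i s i)) ^+ 4.
  by apply: lerXn2r => //; rewrite nnegrE mulr_ge0 ?exprn_ge0 ?(ltW k0) ?(ltW X0).
have h4 : k ^+ (4 * N * n) * X ^+ n <= C ^+ (4 * n).
  rewrite -(ler_pM2r (exprn_gt0 (4 * (N.+1 * \sum_i s i)) X0)).
  apply: (@le_trans _ _ (k ^+ (4 * N * n) * X ^+ (4 * \sum_i a i))).
    rewrite -mulrA -exprD; apply: ler_wpM2l; first by rewrite exprn_ge0// ltW.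
    by apply: ler_weXn2l => //; rewrite addnC.
  move: h3; rewrite !exprMn -!exprM.
  have -> : (n * N * 4 = 4 * N * n)%N by ring.
  have -> : (N.+1 * (\sum_i s i) * 4 = 4 * (N.+1 * \sum_i s i))%N by ring.
  by rewrite (mulnC n 4) (mulnC _ 4).
rewrite -(@ler_pXn2r _ n) ?nnegrE ?mulr_ge0 ?exprn_ge0 ?(ltW k0) ?(ltW X0)//.
by rewrite exprMn -!exprM.
Qed.

(** Used by contraposition: if d < k ^ 2, the fitted values on A_n, which has half of the sample,
    cannot all be at most d. *)
Lemma half_bound n (v : 'I_n -> R) (a : 'I_n -> bool) (k d : R) :
  (0 < n)%N -> 0 < k -> (forall i, 0 <= v i) -> k ^+ n <= \prod_i v i ->
  0 <= d -> d <= 1 -> (forall i, v i <= if a i then d else 1) ->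
  (n <= 2 * \sum_i a i)%N -> k ^+ 2 <= d.
Proof.
move=> n0 k0 v0 kv d0 d1 h hn.
have h1 : k ^+ n <= d ^+ (\sum_i a i).
  apply: le_trans kv _; rewrite -prodrXr; apply: ler_prod => i _; rewrite v0 /=.
  by have := h i; case: (a i); rewrite ?expr1 ?expr0.
have h2 : (k ^+ n) ^+ 2 <= (d ^+ (\sum_i a i)) ^+ 2.
  by apply: lerXn2r => //; rewrite nnegrE ?exprn_ge0 ?(ltW k0).
rewrite -(@ler_pXn2r _ n) ?nnegrE ?exprn_ge0 ?(ltW k0)//.
rewrite -exprM mulnC exprM; apply: le_trans h2 _; rewrite -exprM mulnC.
exact: ler_wiXn2l.
Qed.

End counting.

Section fit.
Import numFieldNormedType.Exports.
Context {R : realType} {p : nat} (p_gt0 : (0 < p)%N) (g : R -> R).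
Hypotheses (g_ell : elliptical_generator p g) (gG2 : condG2 g).
Variables (P Q : probability 'cV[R]_p R) (pi0 : R) (th0 : 'cV[R]_p * 'M[R]_p).
Hypotheses (P_gem : gross_error_model g P pi0 th0 Q) (pi0_lt : pi0 < 2^-1).
Variable A : set 'cV[R]_p.
Hypotheses (A_mve : is_mve P A) (A_unique : forall B, is_mve P B -> B = A).
Local Notation Prec th := (invmx th.2).
Local Notation E0 u := (qball (Prec th0) th0.1 u).
Local Notation pth0 := (Theta0 P_gem).
Local Notation t0 := (mve_level p_gt0 g_ell gG2 P_gem pi0_lt A_mve A_unique).
Local Notation mve_level_gt0 := (mve_level_gt0 p_gt0 g_ell gG2 P_gem pi0_lt A_mve A_unique).

Let pM0 : posdefmx (Prec th0). Proof. exact: pd_inv pth0. Qed.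
Let t00 : 0 < t0. Proof. exact: mve_level_gt0. Qed.

Variable x : nat -> 'cV[R]_p.
Hypothesis x_weak : weak_limsup x P.
Variable U : set_system nat.
Hypotheses (UU : UltraFilter U) (Uoo : \oo `<=` U).
Variable An : nat -> set 'cV[R]_p.
Hypothesis hAn : \forall n \near \oo, is_mve (emp_prob x n) (An n).

Lemma Pn_count n E : Pn x n E * n%:R = (\sum_(i < n) (x i \in E))%:R.
Proof.
have [->|n0] := posnP n; first by rewrite mulr0 big_ord0.
rewrite /Pn mulrAC mulVf ?pnatr_eq0 -?lt0n// mul1r natr_sum.
by apply: eq_bigr => i _; rewrite indicE.
Qed.

Variables (th : nat -> 'cV[R]_p * 'M[R]_p) (c b c0 b0 : nat -> R) (Cm : R).
Hypothesis th_Theta : \forall n \near U, Theta R p (th n).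
Hypothesis c_bound : \forall n \near U, 0 <= c n <= Cm.
Hypothesis b_bound : \forall n \near U, 0 <= b n <= 1.
Hypothesis c0_cvg : c0 n @[n --> U] --> 1 - pi0.
Hypothesis b0_cvg : b0 n @[n --> U] --> (2^-1 : R).
Hypothesis lik_le : \forall n \near U,
  lik g (An n) (c0 n) (b0 n) th0 x n <= lik g (An n) (c n) (b n) (th n) x n.

(** The product at the true parameter is bounded below factor by factor: [An n] is eventually inside
    [E0 t1] with g t1 > 0, and [b0 n] is near 1/2. *)
Lemma lik_lower : exists k : R, 0 < k /\ \forall n \near U,
  k ^+ n <= lik g (An n) (c n) (b n) (th n) x n.
Proof.
have [t1 t01 gt1] := gen_pos_beyond p_gt0 g_ell gG2 P_gem pi0_lt A_mve A_unique.
pose D := (Num.sqrt (\det th0.2))^-1 * g t1.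
have D0 : 0 < D by rewrite mulr_gt0// invr_gt0 (sqrt_det_gt0 g_ell pth0).
have pi1 : 0 < 1 - pi0 by have := pi0_lt; lra.
have b0h : \forall n \near U, 4^-1 <= b0 n.
  by apply: (cvgr_ge _ b0_cvg); lra.
have c0h : \forall n \near U, (1 - pi0) / 2 <= c0 n.
  by apply: (cvgr_ge _ c0_cvg); lra.
pose k := Num.min 4^-1 ((1 - pi0) / 2 * D).
have k0 : 0 < k by rewrite lt_min invr_gt0 ltr0n/= mulr_gt0// divr_gt0.
exists k; split=> //.
have hs := emp_mve_sub x_weak UU Uoo hAn t01.
near=> n; have hl : lik g (An n) (c0 n) (b0 n) th0 x n <= lik g (An n) (c n) (b n) (th n) x n
  by near: n.
apply: le_trans hl; rewrite /lik.
have -> : k ^+ n = \prod_(i < n) k by rewrite prodr_const card_ord.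
have h1 : (1 - pi0) / 2 <= c0 n by near: n.
have h2 : 4^-1 <= b0 n by near: n.
have h3 : An n `<=` E0 t1 by near: n.
apply: ler_prod => i _; rewrite (ltW k0) /=; case: ifPn => [|_]; last first.
  by apply: le_trans h2; rewrite /k ge_min lexx.
rewrite inE => xA; apply: (@le_trans _ _ ((1 - pi0) / 2 * D)).
  by rewrite /k ge_min lexx orbT.
apply: ler_pM => //; rewrite ?(ltW D0) ?divr_ge0 ?(ltW pi1)//.
rewrite (elliptical_pdfE g _ pth0) /D; apply: ler_wpM2l.
  by rewrite invr_ge0 sqrtr_ge0.
have q0 : 0 <= qf (Prec th0) (x i - th0.1) by exact: pd_psd.
by rewrite /gabs ger0_norm//; apply: (gen_le g_ell) => //; exact: h3.
Unshelve. all: by end_near. Qed.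

Let UAn_half : \forall n \near U, 2^-1 <= Pn x n (An n).
Proof. exact: emp_mve_half. Qed.

Let n_pos : \forall n \near U, (0 < n)%N.
Proof. by apply: Uoo; exists 1%N. Qed.

Lemma pdf_det (th1 : 'cV[R]_p * 'M[R]_p) y : Theta R p th1 ->
  elliptical_pdf g th1 y = Num.sqrt (\det (Prec th1)) * gabs g (qf (Prec th1) (y - th1.1)).
Proof.
move=> pt; rewrite (elliptical_pdfE _ _ pt) det_inv -sqrtrV// ltW//.
exact: (det_gt0 g_ell pt).
Qed.

Lemma sqrt_det_le (N : 'M[R]_p) T : posdefmx N -> 0 <= T -> (forall k, N k k <= T ^+ 2) ->
  Num.sqrt (\det N) <= Num.sqrt (p`!%:R) * T ^+ p.
Proof.
move=> pN T0 hT.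
have h := det_bound (fun i j => psd_entry pN.1 (fun y => pd_psd y pN) i j hT).
rewrite -(ger0_norm (exprn_ge0 p T0)) -sqrtr_sqr -sqrtrM//.
rewrite ler_sqrt ?mulr_ge0 ?exprn_ge0//; apply: le_trans (ler_norm _) _.
by rewrite -exprM mulnC exprM.
Qed.

Hypothesis tail : @tail_bound R p g.

(** Let T ^ 2 be the largest diagonal entry. If T grew, a factor could gain the order T ^ p only in
    a thin slab, which takes a small share of A_n: P_theta0 does not charge hyperplanes and Q(A) =
    0. The decay of g makes the rest of A_n pay more than the slab gains. *)
Lemma prec_bound : exists B : R, \forall n \near U, forall k, Prec (th n) k k <= B.
Proof.
have [kap [k0 hk]] := lik_lower.
have [N [C [T1 [N0 T10 hC]]]] := tail.
have pN : \forall n \near U, posdefmx (Prec (th n)).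
  by apply: filterS th_Theta => n; exact: pd_inv.
have exw n : exists iw : 'I_p * ('I_p -> R), posdefmx (Prec (th n)) ->
  [/\ forall k, Prec (th n) k k <= Prec (th n) iw.1 iw.1, 0 < Prec (th n) iw.1 iw.1, iw.2 iw.1 =
    1, forall j, `|iw.2 j| <= 1 &
   forall y : 'cV[R]_p, Prec (th n) iw.1 iw.1 * (\sum_j iw.2 j * y j ord0) ^+ 2 <=
     qf (Prec (th n)) y].
  have [pn|pn] := pselect (posdefmx (Prec (th n))); last by exists (Ordinal p_gt0, fun=> 0).
  by have [i [w h]] := posdef_dir p_gt0 pn; exists (i, w).
pose i n := (projT1 (cid (exw n))).1; pose w n := (projT1 (cid (exw n))).2.
pose m n := Prec (th n) (i n) (i n).
have hw : \forall n \near U, [/\ forall k, Prec (th n) k k <= m n, 0 < m n, w n (i n) = 1,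
  forall j, `|w n j| <= 1 &
   forall y : 'cV[R]_p, m n * (\sum_j w n j * y j ord0) ^+ 2 <= qf (Prec (th n)) y].
  by apply: filterS pN => n pn; exact: (projT2 (cid (exw n)) pn).
have [[B hB]|hinf] := ultra_bounded_or m UU.
  by exists B; apply: filterS2 hw hB => n [h _ _ _ _] mB k; exact: le_trans (h k) mB.
exfalso.
have hw' : \forall n \near U, w n (i n) = 1 /\ forall j, `|w n j| <= 1.
  by apply: filterS hw => n [].
(* Spent twice, on the Q-mass of [E0 u] and on the excess of the slab. The slab then has at most 1 /
   (4 (N + 1)) of the sample within A_n, and A_n at least 1/2, as [count_bound] requires. *)
have eta0 : 0 < (8 * N.+1%:R)^-1 :> R by rewrite invr_gt0 mulr_gt0.
have [u [u1 _ Qu]] := mve_shrink Q (ltr_pwDr ltr01 (lexx t0) : t0 < t0 + 1) eta0.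
rewrite (Q_A P_gem A_mve) /= add0r in Qu.
have [d d0 hd] := Pn_thin_slab g_ell gG2 P_gem x_weak UU Uoo
    (fun n => \sum_j w n j * (th n).1 j ord0) hw' (@closed_qball R p (Prec th0) th0.1 u) eta0.
have hs := emp_mve_sub x_weak UU Uoo hAn u1.
pose G0 := `|Cm| * Num.sqrt (p`!%:R).
have G00 : 0 <= G0 by rewrite mulr_ge0.
have g0 : 0 <= g 0 by exact: (gen_ge0 g_ell).
(* One summand for each position of an observation: off A_n, in A_n and in the slab, in A_n off the
   slab. *)
pose C3 := 1 + (G0 * g 0) ^+ N + G0 ^+ N * d^-1 ^+ (p * N) * (`|C| * d^-1 ^+ p).
have d1 : 0 < d^-1 by rewrite invr_gt0.
have C3a : 0 <= (G0 * g 0) ^+ N by rewrite exprn_ge0// mulr_ge0.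
have C3b : 0 <= G0 ^+ N * d^-1 ^+ (p * N) * (`|C| * d^-1 ^+ p).
  by apply: mulr_ge0; apply: mulr_ge0 => //; rewrite exprn_ge0// ltW.
have C31 : 1 <= C3 by rewrite /C3 -addrA lerDl addr_ge0.
have C30 : 0 <= C3 by exact: le_trans C31.
(* T > Tb ensures 1 <= T, makes the tail bound applicable at T * d, and contradicts the bound on X
   >= T obtained at the end. *)
pose Tb := 1 + T1 / d + C3 ^+ 4 / kap ^+ (4 * N).
have kN : 0 < kap ^+ (4 * N) by rewrite exprn_gt0.
have Ta : 0 <= T1 / d := ltW (divr_gt0 T10 d0).
have Tc : 0 <= C3 ^+ 4 / kap ^+ (4 * N) by apply: divr_ge0; [exact: exprn_ge0|exact: ltW].
have Tb1 : 1 <= Tb by rewrite /Tb -addrA lerDl addr_ge0.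
have : \forall n \near U, False; last by move=> /filter_ex [].
near=> n.
have [mmax m0 _ _ hq] : [/\ forall k, Prec (th n) k k <= m n, 0 < m n, w n (i n) = 1, forall j,
  `|w n j| <= 1 &
   forall y : 'cV[R]_p, m n * (\sum_j w n j * y j ord0) ^+ 2 <= qf (Prec (th n)) y] by near: n.
have mbig : Tb ^+ 2 < m n by near: n; exact: hinf.
have pn : Theta R p (th n) by near: n.
have pNn : posdefmx (Prec (th n)) by near: n.
have n0 : (0 < n)%N by near: n.
have /andP[c00 cC] : 0 <= c n <= Cm by near: n.
have /andP[b00 b1] : 0 <= b n <= 1 by near: n.
have sub : An n `<=` E0 u by near: n.
have hl : kap ^+ n <= lik g (An n) (c n) (b n) (th n) x n by near: n.
have hhalf : 2^-1 <= Pn x n (An n) by near: n.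
have hslab : Pn x n (E0 u `&` slab (w n) (\sum_j w n j * (th n).1 j ord0) d) <=
  pi0 * fine (Q (E0 u)) + (8 * N.+1%:R)^-1 by near: n.
pose S := slab (w n) (\sum_j w n j * (th n).1 j ord0) d.
pose T := Num.sqrt (m n).
have TT : T ^+ 2 = m n by rewrite sqr_sqrtr// ltW.
have T0 : 0 <= T by rewrite sqrtr_ge0.
have TbT : Tb < T by rewrite -ltr_sqr ?nnegrE ?(le_trans ler01 Tb1)// TT.
have Tge1 : 1 <= T by apply: le_trans Tb1 _; exact: ltW.
have Tgt0 : 0 < T by exact: lt_le_trans Tge1.
have Td : T1 <= T * d.
  rewrite -ler_pdivrMr//; apply: le_trans (ltW TbT); rewrite /Tb addrAC lerDr.
  by rewrite addr_ge0.
have sdet : Num.sqrt (\det (Prec (th n))) <= Num.sqrt (p`!%:R) * T ^+ p.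
  by apply: sqrt_det_le => // k; rewrite TT.
pose v (j : 'I_n) := if x j \in An n then c n * elliptical_pdf g (th n) (x j) else b n.
have v0 j : 0 <= v j.
  rewrite /v; case: ifP => // _; apply: mulr_ge0 => //.
  exact: (elliptical_pdf_ge0 g_ell _ pn).
pose X := T ^+ p.
have X1 : 1 <= X by rewrite exprn_ege1.
have X0 : 0 < X by exact: lt_le_trans X1.
have TX : T <= X by rewrite -{1}(expr1 T); apply: ler_weXn2l.
have vA y : c n * elliptical_pdf g (th n) y <= G0 * X * gabs g (qf (Prec (th n)) (y - (th n).1)).
  rewrite (pdf_det _ pn) mulrA; apply: ler_wpM2r; first exact: (gabs_ge0 g_ell).
  rewrite /G0 -mulrA; apply: ler_pM => //.
  by apply: le_trans cC _; exact: ler_norm.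
(* In the slab a factor is at most of order X. Off the slab the form is at least (T d) ^ 2, and
   there the tail bound makes v ^ N * X bounded. *)
have vN (j : 'I_n) : v j ^+ N * X ^+ (x j \in An n) <= C3 * X ^+ (N.+1 * (x j \in An n `&` S)).
  rewrite in_setI; have [jA|jA] := boolP (x j \in An n); last first.
    rewrite /= muln0 !expr0 !mulr1 /v (negbTE jA); apply: le_trans C31.
    by rewrite exprn_ile1.
  have [jS|jS] := boolP (x j \in S) => /=.
    rewrite muln1 expr1 exprSr mulrA; apply: ler_wpM2r; first exact: ltW.
    apply: (@le_trans _ _ ((G0 * X * g 0) ^+ N)).
      apply: lerXn2r; rewrite ?nnegrE ?mulr_ge0 ?(ltW X0)//.
      rewrite /v jA; apply: le_trans (vA _) _; apply: ler_wpM2l; last exact: (gabs_le0 g_ell).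
      by rewrite mulr_ge0// ltW.
    rewrite mulrAC exprMn; apply: ler_wpM2r; first by rewrite exprn_ge0// ltW.
    by rewrite /C3 -addrA addrCA lerDl addr_ge0.
  rewrite muln0 expr0 mulr1 expr1.
  pose q := qf (Prec (th n)) (x j - (th n).1).
  have qge : (T * d) ^+ 2 <= q.
    apply: le_trans (hq _); rewrite exprMn TT; apply: ler_wpM2l; first exact: ltW.
    have -> : \sum_j0 w n j0 * (x j - (th n).1) j0 ord0 =
      \sum_j0 w n j0 * x j j0 ord0 - \sum_j0 w n j0 * (th n).1 j0 ord0.
      by rewrite -sumrB; apply: eq_bigr => k _; rewrite !mxE mulrBr.
    move: jS; rewrite notin_setE /S /slab /= => /negP; rewrite -ltNge => /ltW hd'.
    by rewrite -[leRHS]real_normK ?num_real//; apply: lerXn2r; rewrite ?nnegrE ?(ltW d0).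
  have Td0 : 0 <= (T * d) ^+ 2 by rewrite exprn_ge0// mulr_ge0// ltW.
  have gq : gabs g q <= g ((T * d) ^+ 2).
    by rewrite /gabs ger0_norm ?(le_trans Td0)//; apply: (gen_le g_ell).
  pose h := (T * d) ^+ p * g ((T * d) ^+ 2).
  have gTd : 0 <= g ((T * d) ^+ 2) by exact: (gen_ge0 g_ell).
  have vj : v j <= G0 * d^-1 ^+ p * h.
    rewrite /v jA; apply: le_trans (vA _) _.
    apply: (@le_trans _ _ (G0 * X * g ((T * d) ^+ 2))).
      by apply: ler_wpM2l => //; rewrite mulr_ge0// ltW.
    rewrite le_eqVlt; apply/orP; left; apply/eqP.
    rewrite /h /X; move: (g ((T * d) ^+ 2)) => gg; rewrite exprMn exprVn.
    by field; rewrite expf_neq0// gt_eqF.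
  have h0 : 0 <= h by rewrite mulr_ge0// exprn_ge0// mulr_ge0// ltW.
  have hh : h ^+ N * (T * d) ^+ p <= `|C| by apply: le_trans (hC _ Td) (ler_norm _).
  have hX : h ^+ N * X <= `|C| * d^-1 ^+ p.
    by rewrite exprVn ler_pdivlMr ?exprn_gt0// -mulrA -exprMn.
  apply: (@le_trans _ _ ((G0 * d^-1 ^+ p * h) ^+ N * X)).
    apply: ler_wpM2r; first exact: ltW.
    apply: lerXn2r => //; rewrite nnegrE; first exact: v0.
    by apply: mulr_ge0 => //; apply: mulr_ge0 => //; exact: exprn_ge0 (ltW d1).
  apply: (@le_trans _ _ (G0 ^+ N * d^-1 ^+ (p * N) * (`|C| * d^-1 ^+ p)));
    last by rewrite /C3 lerDr addr_ge0.
  have -> : (G0 * d^-1 ^+ p * h) ^+ N * X = G0 ^+ N * d^-1 ^+ (p * N) * (h ^+ N * X).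
    by rewrite exprM; clearbody h X; rewrite !exprMn mulrA.
  apply: ler_wpM2l => //; apply: mulr_ge0; apply: exprn_ge0 => //; exact: ltW.
have cnt : (4 * (N.+1 * \sum_(j < n) (x j \in An n `&` S)) + n <=
  4 * \sum_(j < n) (x j \in An n))%N.
  rewrite -(ler_nat R) natrD !natrM -!Pn_count.
  have k1 : Pn x n (An n `&` S) <= Pn x n (E0 u `&` S) by apply: PnS => y [yA yS]; split=> //;
    exact: sub.
  have k2 : pi0 * fine (Q (E0 u)) <= (8 * N.+1%:R)^-1.
    apply: le_trans Qu; rewrite ler_piMl ?fine_ge0//.
    by rewrite ltW// (lt_trans pi0_lt)// invf_lt1// ltr1n.
  have k3 : Pn x n (An n `&` S) <= (4 * N.+1%:R)^-1.
    have dbl (r : R) : r != 0 -> (4 * r)^-1 = (8 * r)^-1 + (8 * r)^-1 by move=> r0; field.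
    by apply: le_trans k1 (le_trans hslab _); rewrite dbl ?pnatr_eq0// lerD2r.
  have k4 : 4 * (N.+1%:R * Pn x n (An n `&` S)) <= 1.
    by rewrite mulrA mulrC -ler_pdivlMr ?mulr_gt0// div1r.
  have nn : 0 < n%:R :> R by rewrite ltr0n.
  exact: count_ineq (ltW nn) k4 hhalf.
have := count_bound n0 k0 v0 hl X1 C30 vN cnt.
rewrite mulrC -ler_pdivlMr// => hX.
have C3Tb : C3 ^+ 4 / kap ^+ (4 * N) <= Tb by rewrite /Tb lerDr addr_ge0.
by have := lt_le_trans TbT (le_trans TX (le_trans hX C3Tb)); rewrite ltxx.
Unshelve. all: by end_near. Qed.

(** With the precision matrices bounded, it remains to keep their determinants from 0 and the
    centers from infinity. Both follow from a point of A_n where the fitted density is bounded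
    below. *)
Lemma fit_limit : exists (mu' : 'cV[R]_p) (N' : 'M[R]_p) (c' b' : R),
  [/\ posdefmx N', (th n).1 @[n --> U] --> mu', Prec (th n) @[n --> U] --> N' &
   [/\ (th n).2 @[n --> U] --> invmx N', c n @[n --> U] --> c', b n @[n --> U] --> b', 0 <=
     c' & 0 <= b']].
Proof.
have [kap [k0 hk]] := lik_lower.
have [B hB] := prec_bound.
have pN : \forall n \near U, posdefmx (Prec (th n)).
  by apply: filterS th_Theta => n; exact: pd_inv.
pose G1 := `|Cm| * (Num.sqrt (p`!%:R) * Num.sqrt `|B| ^+ p) + 1.
have G10 : 0 < G1 by rewrite ltr_pwDr// !mulr_ge0 ?exprn_ge0.
(* Strictly below the threshold [kap ^+ 2] of [half_bound], and at most 1. *)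
pose d := Num.min (kap ^+ 2 / 2) 2^-1.
have d0 : 0 < d by rewrite lt_min divr_gt0 ?exprn_gt0//= invr_gt0.
have dk : d < kap ^+ 2.
  by rewrite gt_min ltr_pdivrMr// ltr_pMr ?exprn_gt0// ltr1n.
have d1 : d <= 1 by rewrite ge_min; apply/orP; right; rewrite invf_le1// ler1n.
have exz n : exists z, (exists2 z, An n z & d <= c n * elliptical_pdf g (th n) z) ->
    An n z /\ d <= c n * elliptical_pdf g (th n) z.
  by have [[z h1 h2]|hn] := pselect (exists2 z, An n z & d <= c n * elliptical_pdf g (th n) z);
    [exists z|exists 0].
pose z n := projT1 (cid (exz n)).
have hz : \forall n \near U, An n (z n) /\ d <= c n * elliptical_pdf g (th n) (z n).
  near=> n; apply: (projT2 (cid (exz n))).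
  have n0 : (0 < n)%N by near: n.
  have hhalf : 2^-1 <= Pn x n (An n) by near: n.
  have hl : kap ^+ n <= lik g (An n) (c n) (b n) (th n) x n by near: n.
  have pn : Theta R p (th n) by near: n.
  have /andP[c00 cC] : 0 <= c n <= Cm by near: n.
  have /andP[b00 b1] : 0 <= b n <= 1 by near: n.
  apply: contrapT => hno.
  have hlt y : An n y -> c n * elliptical_pdf g (th n) y <= d.
    by move=> yA; rewrite leNgt; apply/negP => /ltW hd; apply: hno; exists y.
  pose v (j : 'I_n) := if x j \in An n then c n * elliptical_pdf g (th n) (x j) else b n.
  have v0 j : 0 <= v j.
    rewrite /v; case: ifP => // _; apply: mulr_ge0 => //.
    exact: (elliptical_pdf_ge0 g_ell _ pn).
  have vd (j : 'I_n) : v j <= if x j \in An n then d else 1.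
    by rewrite /v; case: ifPn => // /set_mem; exact: hlt.
  have cnt : (n <= 2 * \sum_(j < n) (x j \in An n))%N.
    rewrite -(ler_nat R) natrM -Pn_count.
    have nn : 0 < n%:R :> R by rewrite ltr0n.
    by have := ler_wpM2r (ltW nn) hhalf; lra.
  have := half_bound n0 k0 v0 hl (ltW d0) d1 vd cnt.
  by rewrite leNgt dk.
have sd : \forall n \near U, c n * Num.sqrt (\det (Prec (th n))) <= G1.
  near=> n.
  have pNn : posdefmx (Prec (th n)) by near: n.
  have /andP[c00 cC] : 0 <= c n <= Cm by near: n.
  have hBn : forall k, Prec (th n) k k <= B by near: n.
  apply: (@le_trans _ _ (`|Cm| * (Num.sqrt (p`!%:R) * Num.sqrt `|B| ^+ p))); last by rewrite lerDl.
  apply: ler_pM => //; first exact: le_trans cC (ler_norm _).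
  apply: sqrt_det_le => // k; rewrite sqr_sqrtr//; exact: le_trans (hBn k) (ler_norm _).
have e0 : 0 < d / G1 by rewrite divr_gt0.
(* Beyond level r the fitted density is below d, so [z n] stays within that level of the fitted
   center. *)
have [r r0 hr] := tail_vanish p_gt0 g_ell tail e0.
have g0 := gen0_gt0 g_ell gG2.
(* Lower bound for sqrt (det precision), from d <= c sqrt (det precision) g 0. *)
pose s := d / ((`|Cm| + 1) * g 0).
have C10 : 0 < `|Cm| + 1 by rewrite ltr_pwDr.
have s0 : 0 < s by rewrite divr_gt0// mulr_gt0.
have hq : \forall n \near U, qf (Prec (th n)) (z n - (th n).1) <= r.
  near=> n.
  have pn : Theta R p (th n) by near: n.
  have [zA zd] : An n (z n) /\ d <= c n * elliptical_pdf g (th n) (z n) by near: n.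
  have h1 : c n * Num.sqrt (\det (Prec (th n))) <= G1 by near: n.
  rewrite leNgt; apply/negP => hlt.
  have : d <= G1 * gabs g (qf (Prec (th n)) (z n - (th n).1)).
    apply: le_trans zd _; rewrite (pdf_det _ pn) mulrA; apply: ler_wpM2r => //.
    exact: (gabs_ge0 g_ell).
  rewrite mulrC -ler_pdivrMr// => h2.
  have : gabs g (qf (Prec (th n)) (z n - (th n).1)) <= g r.
    by rewrite /gabs ger0_norm ?(le_trans (ltW r0) (ltW hlt))//; apply: (gen_le g_ell); exact: ltW.
  by move=> h3; have := lt_le_trans hr (le_trans h2 h3); rewrite ltxx.
have hdet : \forall n \near U, s ^+ 2 <= \det (Prec (th n)).
  near=> n.
  have pn : Theta R p (th n) by near: n.
  have [zA zd] : An n (z n) /\ d <= c n * elliptical_pdf g (th n) (z n) by near: n.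
  have /andP[c00 cC] : 0 <= c n <= Cm by near: n.
  have dp : 0 < \det (Prec (th n)) by rewrite det_inv invr_gt0 (det_gt0 g_ell pn).
  rewrite -[leRHS]sqr_sqrtr ?(ltW dp)//; apply: lerXn2r; rewrite ?nnegrE ?(ltW s0)//.
  rewrite /s ler_pdivrMr ?mulr_gt0//; apply: le_trans zd _.
  rewrite (pdf_det _ pn) mulrCA; apply: ler_wpM2l => //.
  apply: ler_pM => //; first exact: (gabs_ge0 g_ell).
    by apply: le_trans cC _; apply: le_trans (ler_norm _) _; rewrite lerDl.
  exact: (gabs_le0 g_ell).
have s20 : 0 < s ^+ 2 by rewrite exprn_gt0.
have t1 : t0 < t0 + 1 by rewrite ltrDl.
have [K hK] := @qball_bounded R p (Prec th0) th0.1 (t0 + 1) pM0.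
have hs := emp_mve_sub x_weak UU Uoo hAn t1.
have hzK : \forall n \near U, cbox K (z n) /\ qball (Prec (th n)) (th n).1 r (z n).
  near=> n; split; last by near: n.
  have [zA zd] : An n (z n) /\ d <= c n * elliptical_pdf g (th n) (z n) by near: n.
  have sub : An n `<=` E0 (t0 + 1) by near: n.
  by apply/hK/sub.
have [mu' [N' [pN' hmu hN hS]]] := posdef_limit UU s20 pN hB hdet hzK.
have [c' hc'] : exists c' : R, c n @[n --> U] --> c'.
  apply: (@ultra_bounded_cvg _ _ _ _ Cm UU).
  by apply: filterS c_bound => n /andP[h1 h2]; rewrite ger0_norm.
have [b' hb'] : exists b' : R, b n @[n --> U] --> b'.
  apply: (@ultra_bounded_cvg _ _ _ _ 1 UU).
  by apply: filterS b_bound => n /andP[h1 h2]; rewrite ger0_norm.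
exists mu', N', c', b'; split=> //; split=> //.
- apply: cvg_trans hS; apply: near_eq_cvg; near=> n; by rewrite invmxK.
- by apply: (cvgr_to_ge hc'); apply: filterS c_bound => n /andP[].
- by apply: (cvgr_to_ge hb'); apply: filterS b_bound => n /andP[].
Unshelve. all: by end_near. Qed.

End fit.

(** * Identification of the limit *)

Section layers.
Context {R : realType}.

(** The sum is e times the number of the first J multiples of e not exceeding t. With [layers_ge] it
    approximates t from below within e, and its terms become indicators of superlevel sets. *)
Lemma layers_le (e t : R) J : 0 <= e -> 0 <= t -> \sum_(j < J) e * (j.+1%:R * e <= t)%R%:R <= t.
Proof.
move=> e0 t0; elim: J => [|J IH]; first by rewrite big_ord0.
rewrite big_ord_recr /=; have [h|h] := leP (J.+1%:R * e) t; last by rewrite mulr0 addr0.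
apply: le_trans h; rewrite mulr1 -natr1 mulrDl mul1r lerD2r.
apply: (@le_trans _ _ (\sum_(j < J) e)); last by rewrite sumr_const card_ord mulr_natl.
by apply: ler_sum => j _; rewrite ler_piMr// lern1 leq_b1.
Qed.

Lemma layers_ge (e t : R) J : 0 <= e -> t <= J%:R * e -> 
  t <= e + \sum_(j < J) e * (j.+1%:R * e <= t)%R%:R.
Proof.
move=> e0; elim: J => [|J IH] tJ; first by rewrite big_ord0 addr0 (le_trans tJ)// mul0r.
have [h|h] := leP t (J%:R * e).
  apply: le_trans (IH h) _; rewrite lerD2l big_ord_recr /= lerDl.
  by rewrite mulr_ge0.
rewrite big_ord_recr /=; apply: le_trans tJ _.
rewrite -natr1 mulrDl mul1r [leLHS]addrC lerD2l.
apply: (@le_trans _ _ (\sum_(j < J) e)); first by rewrite sumr_const card_ord mulr_natl.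
rewrite -[leLHS]addr0; apply: lerD; last by rewrite mulr_ge0.
apply: ler_sum => j _; rewrite (_ : _ <= t) ?mulr1//; apply: le_trans (ltW h).
by rewrite ler_wpM2r// ler_nat.
Qed.

(** Square roots of the ratios are averaged rather than logarithms: they stay finite where the
    fitted density vanishes, and their mean tends to a Hellinger affinity. *)
Lemma sqrt_AGM n (u v : 'I_n -> R) : (0 < n)%N ->
  (forall i, 0 <= u i) -> (forall i, 0 < v i) -> \prod_i v i <= \prod_i u i ->
  1 <= n%:R^-1 * \sum_i Num.sqrt (u i / v i).
Proof.
move=> n0 u0 v0 huv; pose E (i : 'I_n) := Num.sqrt (u i / v i).
have E0 i : 0 <= E i by exact: sqrtr_ge0.
have nn : 0 < n%:R :> R by rewrite ltr0n.
rewrite leNgt; apply/negP => h.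
have AG : \prod_i E i <= (n%:R^-1 * \sum_i E i) ^+ n.
  have [+ _] := @leif_AGM R 'I_n (fun=> true) E (fun i _ => E0 i).
  by rewrite (@eq_card _ _ 'I_n)// card_ord mulrC.
have P1 : 1 <= \prod_i E i.
  have pE : (\prod_i E i) ^+ 2 = \prod_i u i / \prod_i v i.
    rewrite -prodrXl -prodf_div; apply: eq_bigr => i _.
    by rewrite sqr_sqrtr// divr_ge0// ltW.
  rewrite -ler_sqr ?nnegrE ?ler01 ?prodr_ge0// pE expr1n ler_pdivlMr ?mul1r//.
  by apply: prodr_gt0.
have m0 : 0 <= n%:R^-1 * \sum_i E i by rewrite mulr_ge0 ?invr_ge0 ?sumr_ge0 ?(ltW nn).
have : (n%:R^-1 * \sum_i E i) ^+ n < 1 by rewrite exprn_ilt1 -?lt0n.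
by rewrite ltNge (le_trans P1 AG).
Qed.

End layers.

Section integrals.
Import numFieldNormedType.Exports.
Context {R : realType} {p : nat}.
Local Notation lam := (lebesgue_col R p).
Variable A : set 'cV[R]_p.
Hypotheses (mA : measurable A) (A_lty : (lam A < +oo)%E).

Definition rint (F : 'cV[R]_p -> R) : R := fine (\int[lam]_(y in A) (F y)%:E).

Lemma measurable_cont (F : 'cV[R]_p -> R) (B : set 'cV[R]_p) : continuous F ->
  measurable_fun B (fun y => (F y)%:E).
Proof.
move=> cF; apply/measurable_EFinP; apply: measurable_funTS.
exact: continuous_measurable_col.
Qed.

Lemma rintE (F : 'cV[R]_p -> R) C : measurable_fun A (fun y => (F y)%:E) -> 0 <= C ->
  (forall y, A y -> 0 <= F y <= C) ->
  (\int[lam]_(y in A) (F y)%:E)%E = (rint F)%:E.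
Proof.
move=> cF C0 hF; rewrite /rint fineK// fin_numElt; apply/andP; split.
  apply: (@lt_le_trans _ _ 0%E) => //; apply: integral_ge0 => y /hF /andP[h _].
  by rewrite lee_fin.
apply: (@le_lt_trans _ _ (\int[lam]_(y in A) C%:E)%E).
  apply: ge0_le_integral => //.
  - by move=> y /hF /andP[h _]; rewrite lee_fin.
  - by move=> y /hF /andP[_ h]; rewrite lee_fin.
by rewrite integral_cst// lte_mul_pinfty// ?lee_fin.
Qed.

Lemma rintD (F G : 'cV[R]_p -> R) C : continuous F -> continuous G -> 0 <= C ->
  (forall y, 0 <= F y <= C) -> (forall y, 0 <= G y <= C) ->
  rint (fun y => F y + G y) = rint F + rint G.
Proof.
move=> cF cG C0 hF hG.
have mF := measurable_cont (B := A) cF; have mG := measurable_cont (B := A) cG.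
have F0 y : A y -> (0 <= (F y)%:E)%E by move=> _; have /andP[] := hF y; rewrite lee_fin.
have G0 y : A y -> (0 <= (G y)%:E)%E by move=> _; have /andP[] := hG y; rewrite lee_fin.
have := ge0_integralD lam mA F0 mF G0 mG.
rewrite (rintE mF C0 (fun y _ => hF y)) (rintE mG C0 (fun y _ => hG y)) => h.
have h' : (\int[lam]_(y in A) (F y + G y)%:E = (rint F + rint G)%:E)%E by exact: h.
by rewrite {1}/rint h'.
Qed.

Lemma rintZ (F : 'cV[R]_p -> R) k : continuous F -> 0 <= k ->
  (forall y, 0 <= F y) -> rint (fun y => k * F y) = k * rint F.
Proof.
move=> cF k0 hF; rewrite /rint.
under eq_integral do rewrite EFinM.
rewrite ge0_integralZl_EFin//; last first.
  exact: measurable_cont.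
  by move=> y _; rewrite lee_fin.
have h : (0 <= \int[lam]_(y in A) (F y)%:E)%E by apply: integral_ge0 => y _; rewrite lee_fin.
case: (integral lam A _) h => [r| |] // _; have := k0; rewrite le_eqVlt => /orP[/eqP <-|kp].
  by rewrite mul0e mulr0.
by rewrite gt0_muley//= mulr0.
Qed.

Lemma rint_ge_qball (F : 'cV[R]_p -> R) C (e : R) y0 r : continuous F -> 0 <= C ->
  (forall y, 0 <= F y <= C) -> 0 <= e -> qball 1%:M y0 r `<=` A -> 
  (forall y, qball 1%:M y0 r y -> e <= F y) -> e * fine (lam (qball 1%:M y0 r)) <= rint F.
Proof.
move=> cF C0 hF e0 sub hB.
have mF := measurable_cont (B := A) cF.
have mB : measurable (qball (1%:M : 'M[R]_p) y0 r) by exact: measurable_qball.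
have lB := qball_lty y0 r (pd1 R p).
rewrite -lee_fin -(rintE mF C0 (fun y _ => hF y)) EFinM fineK; last first.
  by rewrite fin_numElt lB (lt_le_trans (ltNyr 0)).
rewrite -integral_cst//; apply: (@le_trans _ _ (\int[lam]_(y in qball 1%:M y0 r) (F y)%:E)%E).
  apply: ge0_le_integral => //.
  exact: measurable_cont.
apply: ge0_subset_integral => // y _; rewrite lee_fin.
by have /andP[] := hF y.
Qed.

(* One half of a layer-cake formula, the [C_ j] being superlevel sets of S / f. *)
Lemma rint_layers J (C_ : 'I_J -> set 'cV[R]_p) (w C : R) (f S : 'cV[R]_p -> R) :
  (forall j, measurable (C_ j)) -> 0 <= w -> continuous f -> (forall y, 0 <= f y) -> 0 <= C ->
  continuous S -> (forall y, 0 <= S y <= C) ->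
  (forall y, A y -> \sum_(j < J) w * (y \in C_ j)%:R * f y <= S y) ->
  \sum_(j < J) w * fine (\int[lam]_(y in A `&` C_ j) (f y)%:E) <= rint S.
Proof.
move=> mC w0 cf f0 C0 cS hS hle.
have mS := measurable_cont (B := A) cS.
pose G (j : 'I_J) (y : 'cV[R]_p) : \bar R := (w%:E * ((fun z => (f z)%:E) \_ (C_ j)) y)%E.
have mf B := measurable_cont (B := B) cf.
have mr (j : 'I_J) : measurable_fun A ((fun z => (f z)%:E) \_ (C_ j)).
  apply: measurable_funTS; have [h _] := measurable_restrictT (fun z => (f z)%:E) (mC j).
  exact: h (mf _).
have r0 (j : 'I_J) y : (0 <= ((fun z => (f z)%:E) \_ (C_ j)) y)%E.
  by rewrite patchE; case: ifP => // _; rewrite lee_fin.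
have mG (j : 'I_J) : measurable_fun A (G j) by apply: measurable_funeM; exact: mr.
have G0 (j : 'I_J) y : A y -> (0 <= G j y)%E by move=> _; apply: mule_ge0.
have GE y : (\sum_(j < J) G j y)%E = (\sum_(j < J) w * (y \in C_ j)%:R * f y)%:E.
  rewrite -sumEFin; apply: eq_bigr => j _; rewrite /G patchE.
  by case: ifP => _; rewrite /= -EFinM ?mulr1// !mulr0 mul0r.
have e1 (j : 'I_J) : (\int[lam]_(y in A) G j y = w%:E * \int[lam]_(y in A `&` C_ j) (f y)%:E)%E.
  by rewrite integral_mkcondr ge0_integralZl_EFin.
have i0 (j : 'I_J) : (0 <= \int[lam]_(y in A `&` C_ j) (f y)%:E)%E.
  by apply: integral_ge0 => y _; rewrite lee_fin.
have := ge0_integral_sum lam mA mG G0 (index_enum 'I_J).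
have le1 : (\int[lam]_(y in A) \sum_(j < J) G j y <= (rint S)%:E)%E.
  rewrite -(rintE mS C0 (fun y _ => hS y)); apply: ge0_le_integral => //.
  - by move=> y Ay; apply: sume_ge0 => j _; exact: G0.
  - exact: emeasurable_sum.
  - by move=> y Ay; rewrite GE lee_fin; exact: hle.
move=> es; rewrite es in le1.
rewrite -lee_fin -sumEFin; apply: le_trans le1; apply: lee_sum => j _.
(* For an infinite integral [fine] gives 0, and the inequality still holds. *)
rewrite e1; have [->|w1] := eqVneq w 0; first by rewrite mul0r mul0e.
have := i0 j; case: (integral lam _ _) => [r| |] //= _.
by rewrite mulr0 gt0_muley ?leey// lte_fin lt0r w1.
Qed.

End integrals.

Section generator_identifies.
Import numFieldNormedType.Exports.
Context {R : realType} {p : nat} (g : R -> R).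
Hypotheses (g_ell : elliptical_generator p g) (gG1 : condG1 g) (gG2 : condG2 g).

(** Some term t_k of the sequence in G1 lies below t, and g (t_k) < g (t_(k+1)) <= g 0. *)
Lemma gen_lt0 t : 0 < t -> g t < g 0.
Proof.
move=> t_gt0; have [s [s_dec s_cvg s_g]] := gG1.
have smono m n : (m <= n)%N -> s n <= s m.
  elim: n => [|n IH]; first by rewrite leqn0 => /eqP ->.
  rewrite leq_eqVlt => /orP[/eqP ->//|]; rewrite ltnS => /IH.
  by apply: le_trans; apply: ltW; exact: s_dec.
have s0 m : 0 <= s m.
  by apply: (cvgr_to_le s_cvg); exists m => // n /= mn; exact: smono.
have [k hk] : exists k, s k < t.
  have : \forall k \near \oo, s k < t by exact: (cvgr_lt _ s_cvg).
  by move=> /filter_ex.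
apply: (@le_lt_trans _ _ (g (s k))); first by apply: (gen_le g_ell) => //; exact: ltW.
by apply: lt_le_trans (s_g k) _; exact: (gen_le g_ell).
Qed.

(** Iteration gives g (r ^ j * t) = g t for all j, and continuity at 0 gives g 0 = g t, against
    [gen_lt0]. *)
Lemma no_contraction r t0 : 0 < t0 -> 0 < r -> r < 1 ->
  ~ (forall t, 0 <= t -> t < t0 -> g (r * t) = g t).
Proof.
move=> t00 r0 r1 h; pose t := t0 / 2.
have t_gt0 : 0 < t by rewrite divr_gt0.
have tt0 : t < t0 by rewrite ltr_pdivrMr// ltr_pMr// ltr1n.
have hj j : g (r ^+ j * t) = g t.
  elim: j => [|j IH]; first by rewrite mul1r.
  have tj : 0 <= r ^+ j * t by rewrite mulr_ge0 ?exprn_ge0 ?(ltW r0) ?(ltW t_gt0).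
  have tj0 : r ^+ j * t < t0.
    by apply: le_lt_trans tt0; rewrite ler_piMl ?(ltW t_gt0)// exprn_ile1 ?(ltW r0) ?(ltW r1).
  by rewrite exprS -mulrA h.
have c1 : gabs g (r ^+ j * t) @[j --> \oo] --> gabs g (0 * t).
  apply: (@continuous_cvg _ _ _ \oo _ (fun j => r ^+ j * t) (gabs g)).
    exact: continuous_gabs.
  apply: cvgMl; apply: cvg_expr; rewrite ger0_norm//; exact: ltW.
have c2 : gabs g (r ^+ j * t) @[j --> \oo] --> g t.
  have -> : (fun j => gabs g (r ^+ j * t)) = (fun=> g t).
    apply/funext => j; rewrite /gabs ger0_norm ?hj// mulr_ge0 ?exprn_ge0 ?(ltW r0)//.
    exact: ltW.
  exact: cvg_cst.
have := cvgr_uniq _ c1 c2; rewrite mul0r /gabs normr0 => e.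
by have := gen_lt0 t_gt0; rewrite e ltxx.
Qed.

Lemma ratio1 r t0 : 0 < t0 -> 0 < r ->
  (forall t, 0 <= t -> t < t0 -> g (r * t) = g t) -> r = 1.
Proof.
move=> t00 r0 h; case: (ltgtP r 1) => // r1.
  by case: (no_contraction t00 r0 r1 h).
have ri : 0 < r^-1 by rewrite invr_gt0.
have r1' : r^-1 < 1 by rewrite invf_lt1.
case: (no_contraction t00 ri r1') => t tge0 tt0.
have tr : r * (r^-1 * t) = t by rewrite mulVKf// gt_eqF.
have t1 : 0 <= r^-1 * t by rewrite mulr_ge0// ltW.
have t2 : r^-1 * t < t0 by apply: le_lt_trans tt0; rewrite ler_piMl// ltW.
by rewrite -[in RHS]tr h.
Qed.

Lemma generator_identifies (M N : 'M[R]_p) (mu nu : 'cV[R]_p) (c d t0 : R) :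
  posdefmx M -> posdefmx N -> 0 < g 0 -> 0 < t0 -> 0 <= c -> 0 < d ->
  (forall y, qf M (y - mu) < t0 -> c * g (qf N (y - nu)) = d * g (qf M (y - mu))) ->
  [/\ nu = mu, N = M & c = d].
Proof.
move=> pM pN g0 t00 c0 d0 h.
have enu : nu = mu.
  apply/eqP; apply/negPn/negP => ne.
  pose z := nu - mu.
  have z0 : z != 0 by rewrite subr_eq0.
  have Q0 : 0 < qf M z by case: pM => _; exact.
  (* A step from mu towards nu that stays below level t0. It does not increase the N-distance to nu,
     so the left side does not drop, while the right side is strictly below its value at mu. *)
  pose s := t0 / (t0 + qf M z).
  have tQ : 0 < t0 + qf M z by rewrite addr_gt0.
  have s0 : 0 < s by rewrite divr_gt0.
  have s1 : s <= 1 by rewrite ler_pdivrMr// mul1r lerDl ltW.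
  have qs : qf M (mu + s *: z - mu) = s ^+ 2 * qf M z by rewrite addrC addKr qfZ.
  have qs0 : 0 < s ^+ 2 * qf M z by rewrite mulr_gt0// exprn_gt0.
  have qst : s ^+ 2 * qf M z < t0.
    apply: (@le_lt_trans _ _ (s * qf M z)).
      by rewrite expr2 ler_wpM2r ?(ltW Q0)// ler_piMr// ltW.
    by rewrite /s mulrAC ltr_pdivrMr// ltr_pM2l// ltrDr.
  have qN : qf N (mu + s *: z - nu) <= qf N (mu - nu).
    have -> : mu + s *: z - nu = (s - 1) *: z.
      by apply/matrixP => i j; rewrite !mxE; ring.
    rewrite -(qfN N (mu - nu)) opprB -/z qfZ ler_piMl ?(pd_psd _ pN)//.
    rewrite -sqrrN opprB exprn_ile1 ?subr_ge0// gerBl ltW//.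
  have e1 := h (mu + s *: z); rewrite qs in e1.
  have e2 := h mu; rewrite subrr qf0 in e2.
  have := ler_wpM2l c0 (gen_le g_ell (pd_psd _ pN) qN).
  by rewrite e1// e2// ler_pM2l// leNgt gen_lt0.
rewrite enu in h *.
have ec : c = d.
  have := h mu; rewrite subrr !qf0 => /(_ t00) /eqP.
  by rewrite -subr_eq0 -mulrBl mulf_eq0 subr_eq0 (gt_eqF g0) orbF => /eqP.
split=> //.
have hz z : qf M z < t0 -> g (qf N z) = g (qf M z).
  move=> hz; have := h (z + mu); rewrite !addrK ec => /(_ hz) /eqP.
  by rewrite -subr_eq0 -mulrBr mulf_eq0 (gt_eqF d0) /= subr_eq0 => /eqP.
have hq z : qf N z = qf M z.
  have [->|z0] := eqVneq z 0; first by rewrite !qf0.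
  have Q0 : 0 < qf M z by case: pM => _; exact.
  have Q1 : 0 < qf N z by case: pN => _; exact.
  suff e : qf N z / qf M z = 1 by rewrite -[LHS](divfK (lt0r_neq0 Q0)) e mul1r.
  apply: (@ratio1 _ t0) => // [|t tge0 tt0]; first by rewrite divr_gt0.
  have tQ : 0 <= t / qf M z by rewrite divr_ge0// ltW.
  have sq : Num.sqrt (t / qf M z) ^+ 2 = t / qf M z by rewrite sqr_sqrtr.
  have e1 : qf M (Num.sqrt (t / qf M z) *: z) = t by rewrite qfZ sq divfK ?gt_eqF.
  have := hz (Num.sqrt (t / qf M z) *: z); rewrite e1 => /(_ tt0) <-.
  by rewrite qfZ sq; congr g; ring.
have [_ //] := @ellipsoid_inj R p N M mu mu 1 pN pM ltr01 (fun y => congr1 (fun u =>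
  u <= 1) (hq (y - mu))).
Qed.

End generator_identifies.

Section limit.
Import numFieldNormedType.Exports.
Context {R : realType} {p : nat} (p_gt0 : (0 < p)%N) (g : R -> R).
Hypotheses (g_ell : elliptical_generator p g) (gG1 : condG1 g) (gG2 : condG2 g).
Variables (P Q : probability 'cV[R]_p R) (pi0 : R) (th0 : 'cV[R]_p * 'M[R]_p).
Hypotheses (P_gem : gross_error_model g P pi0 th0 Q) (pi0_lt : pi0 < 2^-1).
Variable A : set 'cV[R]_p.
Hypotheses (A_mve : is_mve P A) (A_unique : forall B, is_mve P B -> B = A).
Local Notation lam := (lebesgue_col R p).
Local Notation Prec th := (invmx th.2).
Local Notation E0 u := (qball (Prec th0) th0.1 u).
Local Notation O0 u := (qballo (Prec th0) th0.1 u).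
Local Notation fin B := (fine (elliptical_prob g th0 B)).
Local Notation pth0 := (Theta0 P_gem).
Local Notation t0 := (mve_level p_gt0 g_ell gG2 P_gem pi0_lt A_mve A_unique).
Local Notation mve_central_qball := (mve_central_qball p_gt0 g_ell gG2 P_gem pi0_lt A_mve A_unique).
Local Notation mve_level_gt0 := (mve_level_gt0 p_gt0 g_ell gG2 P_gem pi0_lt A_mve A_unique).

Let pM0 : posdefmx (Prec th0). Proof. exact: pd_inv pth0. Qed.
Let t00 : 0 < t0. Proof. exact: mve_level_gt0. Qed.
Let pi1 : 0 < 1 - pi0. Proof. by have := pi0_lt; lra. Qed.
Let mA : measurable A. Proof. exact: (measurable_mve p_gt0 g_ell gG2 P_gem pi0_lt A_mve
  A_unique). Qed.
Let A_lty : (lam A < +oo)%E.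
Proof. by have AE : A = E0 t0 := mve_central_qball; rewrite (congr1 (fun B => lam B) AE);
  exact: qball_lty. Qed.

Variable x : nat -> 'cV[R]_p.
Hypothesis x_weak : weak_limsup x P.
Variable U : set_system nat.
Hypotheses (UU : UltraFilter U) (Uoo : \oo `<=` U).
Variable An : nat -> set 'cV[R]_p.
Hypothesis hAn : \forall n \near \oo, is_mve (emp_prob x n) (An n).

Let n_pos : \forall n \near U, (0 < n)%N.
Proof. by apply: Uoo; exists 1%N. Qed.

Variables (th : nat -> 'cV[R]_p * 'M[R]_p) (c b c0 b0 : nat -> R).
Hypothesis th_Theta : \forall n \near U, Theta R p (th n).
Hypothesis c_ge0 : \forall n \near U, 0 <= c n.
Hypothesis b_ge0 : \forall n \near U, 0 <= b n.
Hypothesis mass : \forall n \near U, c n * fine (elliptical_prob g (th n) (An n)) + b n <= 1.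
Hypothesis c0_cvg : c0 n @[n --> U] --> 1 - pi0.
Hypothesis b0_cvg : b0 n @[n --> U] --> (2^-1 : R).
Hypothesis lik_le : \forall n \near U,
  lik g (An n) (c0 n) (b0 n) th0 x n <= lik g (An n) (c n) (b n) (th n) x n.

Variables (mu' : 'cV[R]_p) (N' : 'M[R]_p) (c' b' : R).
Hypotheses (pN' : posdefmx N') (hmu : (th n).1 @[n --> U] --> mu')
  (hN : Prec (th n) @[n --> U] --> N') (hc : c n @[n --> U] --> c')
  (hb : b n @[n --> U] --> b') (c'0 : 0 <= c') (b'0 : 0 <= b').

Let th' : 'cV[R]_p * 'M[R]_p := (mu', invmx N').
Let pth' : Theta R p th'. Proof. exact: pd_inv. Qed.
Local Notation f' := (elliptical_pdf g th').
Local Notation f0 := (elliptical_pdf g th0).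

Let pdf_joint y :
  Num.sqrt (\det (Prec (th z.2))) * gabs g (qf (Prec (th z.2)) (z.1 - (th z.2).1))
    @[z --> (nbhs y, U)] --> f' y.
Proof.
rewrite (pdf_det g_ell _ pth') /= invmxK; apply: cvgM.
  apply: (@continuous_cvg _ _ _ (filter_prod (nbhs y) U) _ (fun z =>
    \det (Prec (th z.2))) (@Num.sqrt R)).
    exact: sqrt_continuous.
  by apply: cvg_det; exact: (cvg_comp _ _ cvg_snd hN).
apply: (@continuous_cvg _ _ _ (filter_prod (nbhs y) U) _ (fun z =>
  qf (Prec (th z.2)) (z.1 - (th z.2).1)) (gabs g)).
  exact: continuous_gabs.
apply: cvg_qf_sub; [exact: (cvg_comp _ _ cvg_snd hN)|exact: (cvg_comp _ _ cvg_snd hmu)|exact: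
  cvg_fst].
Qed.

Lemma pdf_uniform K e : 0 < e -> \forall n \near U, forall y, @cbox R p K y ->
  `|elliptical_pdf g (th n) y - f' y| < e.
Proof.
move=> e0.
have := @uniform_near R nat U p K (fun n y => Num.sqrt (\det (Prec (th n))) *
  gabs g (qf (Prec (th n)) (y - (th n).1))) f' _ _ e e0.
have hu y : @cbox R p K y ->
  Num.sqrt (\det (Prec (th z.2))) * gabs g (qf (Prec (th z.2)) (z.1 - (th z.2).1)) - f' z.1
    @[z --> (nbhs y, U)] --> (0 : R).
  move=> _; have h2 : f' z.1 @[z --> (nbhs y, U)] --> f' y.
    apply: (cvg_comp _ _ cvg_fst); exact: (continuous_elliptical_pdf gG2 pth').
  exact: cvg_sub0 (@pdf_joint y) h2.
move=> /(_ _ hu); apply: filterS2 th_Theta => n pn h y yK.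
by rewrite (pdf_det g_ell _ pn); exact: h.
Qed.

(** Only a lower bound on the mass of [An n] is needed, so [An n] is replaced by an inner ellipsoid
    [E0 u'] on which the densities converge uniformly; the part of A outside it has small mass under
    the limit law. *)
Lemma limit_mass : c' * fine (elliptical_prob g th' A) + b' <= 1.
Proof.
have [m' hm'] := elliptical_probability g_ell gG2 pth'.
suff main e : 0 < e -> c' * (fine (elliptical_prob g th' A) - e) + b' <= 1.
  apply/ler_addgt0Pr => e e0; have e1 : 0 < e / (c' + 1) by rewrite divr_gt0// ltr_pwDr.
  have := main _ e1; have : c' * (e / (c' + 1)) <= e.
    by rewrite mulrCA ler_piMr ?(ltW e0)// ler_pdivrMr ?ltr_pwDr// mul1r lerDl.
  by rewrite mulrBr; lra.
move=> e0.
pose C := (Num.sqrt (\det th'.2))^-1 * g 0 + 1.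
have C0 : 0 < C.
  by apply: ltr_wpDl => //; apply: mulr_ge0; [rewrite invr_ge0 sqrtr_ge0|exact: (gen_ge0 g_ell)].
have e2 : 0 < e / 2 / C by rewrite !divr_gt0.
have [u' [u [a1 a2 a3 _ a5]]] := mve_annulus (ltr_pwDr ltr01 (lexx t0) : t0 < t0 + 1) e2.
have [K hK] := @qball_bounded R p (Prec th0) th0.1 u' pM0.
have mE w : measurable (E0 w) by exact: measurable_qball.
have lE w : (lam (E0 w) < +oo)%E by exact: qball_lty.
pose L := fine (lam (E0 u')) + 1.
have L0 : 0 < L by rewrite ltr_pwDr// fine_ge0.
have e3 : 0 < e / 2 / L by rewrite !divr_gt0.
have hu := pdf_uniform K e3.
have hs := emp_mve_sup x_weak UU Uoo hAn a1 a2.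
have hmA := measurable_emp_mve Uoo hAn.
have lower : \forall n \near U, fine (elliptical_prob g th' A) - e <=
  fine (elliptical_prob g (th n) (An n)).
  near=> n.
  have pn : Theta R p (th n) by near: n.
  have sub : E0 u' `<=` An n by near: n.
  have mAn : measurable (An n) by near: n.
  have un : forall y, @cbox R p K y -> `|elliptical_pdf g (th n) y - f' y| < e / 2 / L by near: n.
  have [mn hmn] := elliptical_probability g_ell gG2 pn.
  have h1 : fine (elliptical_prob g th' A) <= fine (elliptical_prob g th' (E0 u')) + e / 2.
    rewrite -!hm'; have AE : A = E0 t0 := mve_central_qball;
      have e4 : m' A = m' (E0 t0) := congr1 m' AE.
    rewrite e4 (fine_measureDI (mE t0) (mE u'));
      last exact: le_lt_trans (probability_le1 m' (mE t0)) (ltry 1).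
    apply: lerD; first by apply: fine_probabilityS => //; exact: measurableI.
    have mD : measurable (E0 u `\` E0 u') by exact: measurableD.
    apply: (@le_trans _ _ (fine (m' (E0 u `\` E0 u')))).
      apply: fine_probabilityS => //; first exact: measurableD.
      by apply: setSD; apply: qballS; exact: ltW.
    have lD : (lam (E0 u `\` E0 u') < +oo)%E by apply: le_lt_trans (lE u); exact: le_measureS.
    have := elliptical_prob_le (c := C) g_ell gG2 pth' mD.
    rewrite -hm' (fin_num_probability m' mD) => h.
    have {}h := h (fun y _ => le_trans (elliptical_pdf_ub g_ell y pth') (ler_wpDr ler01 (lexx _))).
    rewrite -(@fineK _ (lam (E0 u `\` E0 u'))) in h;
      last by rewrite fin_numElt lD (lt_le_trans (ltNyr 0)).
    rewrite -EFinM lee_fin in h; apply: le_trans h _.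
    by rewrite mulrC -ler_pdivlMr.
  have h2 : fine (elliptical_prob g th' (E0 u')) <= fine (elliptical_prob g (th n) (E0 u')) + e / 2.
    have F0 y : 0 <= elliptical_pdf g (th n) y by exact: (elliptical_pdf_ge0 g_ell _ pn).
    have cF := continuous_elliptical_pdf gG2 pn.
    have F'0 y : 0 <= f' y by exact: (elliptical_pdf_ge0 g_ell _ pth').
    have cF' := continuous_elliptical_pdf gG2 pth'.
    have mF : measurable_fun (E0 u') (fun y => (elliptical_pdf g (th n) y)%:E)
      by exact: measurable_cont.
    have mF' : measurable_fun (E0 u') (fun y => (f' y)%:E) by exact: measurable_cont.
    have : (elliptical_prob g th' (E0 u') <= elliptical_prob g (th n) (E0 u') + (e / 2 / L)%:E *
      lam (E0 u'))%E.
      rewrite -integral_cst// /elliptical_prob -ge0_integralD//; last 2 first.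
      - by move=> y _; rewrite lee_fin.
      - by move=> y _; rewrite lee_fin ltW.
      apply: ge0_le_integral => //.
      - by move=> y _; rewrite lee_fin.
      - by apply: emeasurable_funD => //; exact: measurable_cst.
      - move=> y yE; rewrite -EFinD lee_fin.
        by have := un y (hK y yE); rewrite ltr_norml => /andP[]; lra.
    rewrite -hm' -hmn (fin_num_probability m' (mE u')) (fin_num_probability mn (mE u')).
    rewrite -(@fineK _ (lam (E0 u'))); last by rewrite fin_numElt lE (lt_le_trans (ltNyr 0)).
    rewrite -EFinM -EFinD lee_fin => h; apply: le_trans h _; rewrite lerD2l.
    by rewrite mulrAC ler_pdivrMr// ler_wpM2l ?divr_ge0 ?(ltW e0)// lerDl.
  have h3 : fine (elliptical_prob g (th n) (E0 u')) <= fine (elliptical_prob g (th n) (An n)).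
    by rewrite -!hmn; exact: fine_probabilityS.
  rewrite lerBlDr (splitr e) addrA; apply: le_trans h1 _; rewrite lerD2r.
  by apply: le_trans h2 _; rewrite lerD2r.
have cv : c n * (fine (elliptical_prob g th' A) - e) + b n @[n --> U] -->
    c' * (fine (elliptical_prob g th' A) - e) + b'.
  by apply: cvgD => //; apply: cvgM => //; exact: cvg_cst.
apply: (cvgr_to_le cv); near=> n.
have h1 : c n * fine (elliptical_prob g (th n) (An n)) + b n <= 1 by near: n.
have h2 : fine (elliptical_prob g th' A) - e <= fine (elliptical_prob g (th n) (An n)) by near: n.
have h3 : 0 <= c n by near: n.
by apply: le_trans h1; rewrite lerD2r; exact: ler_wpM2l.
Unshelve. all: by end_near. Qed.

(** The limit of the fitted sub-densities; [a0] is the true one, and [rint A S] is their Hellinger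
    affinity on A. *)
Let a y := c' * f' y.
Let a0 y := (1 - pi0) * f0 y.
Let S y := Num.sqrt (a y * a0 y).
Let f'_ge0 y : 0 <= f' y. Proof. exact: (elliptical_pdf_ge0 g_ell _ pth'). Qed.
Let f0_ge0 y : 0 <= f0 y. Proof. exact: (elliptical_pdf_ge0 g_ell _ pth0). Qed.
Let cf' : continuous f'. Proof. exact: (continuous_elliptical_pdf gG2 pth'). Qed.
Let cf0 : continuous f0. Proof. exact: (continuous_elliptical_pdf gG2 pth0). Qed.
Let a_ge0 y : 0 <= a y. Proof. exact: mulr_ge0. Qed.
Let a0_ge0 y : 0 <= a0 y. Proof. by apply: mulr_ge0 => //; exact: ltW. Qed.
Let S_ge0 y : 0 <= S y. Proof. exact: sqrtr_ge0. Qed.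
Let cscale (k : R) (f : 'cV[R]_p -> R) : continuous f -> continuous (fun y => k * f y).
Proof. by move=> cf y; exact: (cvgM (cvg_cst k) (cf y)). Qed.
Let clin (f1 f2 f3 : 'cV[R]_p -> R) : continuous f1 -> continuous f2 -> continuous f3 ->
  continuous (fun y => f1 y + f2 y - f3 y).
Proof. by move=> c1 c2 c3 y; exact: (cvgB (cvgD (c1 y) (c2 y)) (c3 y)). Qed.
Let ca : continuous a. Proof. exact: cscale cf'. Qed.
Let ca0 : continuous a0. Proof. exact: cscale cf0. Qed.
Let cS : continuous S.
Proof.
move=> y; apply: (@continuous_cvg _ _ _ (nbhs y) _ (fun z => a z * a0 z) (@Num.sqrt R)).
  exact: sqrt_continuous.
by apply: cvgM; [exact: ca|exact: ca0].
Qed.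
Let Cb := c' * ((Num.sqrt (\det th'.2))^-1 * g 0) + (1 - pi0) * ((Num.sqrt (\det th0.2))^-1 * g 0).
Let aa0_le y : a y + a0 y <= Cb.
Proof.
apply: lerD; apply: ler_wpM2l => //; first exact: (elliptical_pdf_ub g_ell _ pth').
  exact: ltW.
exact: (elliptical_pdf_ub g_ell _ pth0).
Qed.
Let Cb0 : 0 <= Cb. Proof. by apply: le_trans (aa0_le 0); rewrite addr_ge0. Qed.
Let S_le y : 2 * S y <= a y + a0 y.
Proof.
have sa : Num.sqrt (a y) ^+ 2 = a y by rewrite sqr_sqrtr.
have sb : Num.sqrt (a0 y) ^+ 2 = a0 y by rewrite sqr_sqrtr.
have -> : S y = Num.sqrt (a y) * Num.sqrt (a0 y) by rewrite /S sqrtrM.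
by have := sqr_ge0 (Num.sqrt (a y) - Num.sqrt (a0 y)); rewrite sqrrB sa sb -mulr_natl; lra.
Qed.

(** The limit of [sqrt_AGM]. Off [An n] the ratio is the constant b / b0, with limit 2 b', on half
    of the sample. On [An n] it tends to a / a0, and its root times the density a0 is S. *)
Lemma affinity_ge1 : 1 <= rint A S + 2^-1 * Num.sqrt (2 * b').
Proof.
apply/ler_addgt0Pr => e' e'0; pose e := e' / 4.
have e0 : 0 < e by rewrite divr_gt0.
have [t1 t01 gt1] := gen_pos_beyond p_gt0 g_ell gG2 P_gem pi0_lt A_mve A_unique.
pose d := (Num.sqrt (\det th0.2))^-1 * g t1.
have d0 : 0 < d by rewrite mulr_gt0// invr_gt0 (sqrt_det_gt0 g_ell pth0).
have f0d y : E0 t1 y -> d <= f0 y.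
  move=> yE; rewrite (elliptical_pdfE g _ pth0); apply: ler_wpM2l.
    by rewrite invr_ge0 sqrtr_ge0.
  have q0 : 0 <= qf (Prec th0) (y - th0.1) by exact: pd_psd.
  by rewrite /gabs ger0_norm//; exact: (gen_le g_ell).
(* The maximum makes the ratio [phi] continuous and bounded on the whole space; it agrees with [f0]
   on [E0 t1], where the argument takes place. *)
pose m0 y := Num.max (f0 y) d.
have m00 y : 0 < m0 y by rewrite lt_max d0 orbT.
have cm0 : continuous m0.
  have cd : continuous ((fun=> d) : 'cV[R]_p -> R) by apply: cst_continuous.
  by move=> y; apply: continuous_max; [exact: cf0|exact: cd].
have m0E y : E0 t1 y -> m0 y = f0 y by move=> yE; apply/max_idPl; exact: f0d.
pose phi y := Num.sqrt (a y / ((1 - pi0) * m0 y)).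
have cphi : continuous phi.
  move=> y; apply: (@continuous_cvg _ _ _ (nbhs y) _ (fun z =>
    a z / ((1 - pi0) * m0 z)) (@Num.sqrt R)).
    exact: sqrt_continuous.
  apply: cvgM; first exact: ca.
  apply: cvgV; first by rewrite gt_eqF// mulr_gt0.
  exact: (cvgM (cvg_cst (1 - pi0)) (cm0 y)).
have phi0 y : 0 <= phi y by exact: sqrtr_ge0.
pose B := Num.sqrt (Cb / ((1 - pi0) * d)).
have phiB y : phi y <= B.
  apply: ler_wsqrtr; apply: ler_pM => //.
  - by rewrite invr_ge0 mulr_ge0// ltW.
  - by apply: le_trans (aa0_le y); rewrite lerDl.
  - have m1 : 0 < (1 - pi0) * m0 y by exact: mulr_gt0.
    have m2 : 0 < (1 - pi0) * d by exact: mulr_gt0.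
    by rewrite lef_pV2 ?posrE// ler_pM2l// /m0 le_max lexx orbT.
pose J := (Num.trunc (B / e)).+1.
have BJ : B <= J%:R * e.
  by rewrite -ler_pdivrMr//; apply: ltW; exact: truncnS_gt.
(* A layer of weight e loses h in the closed-set bound and h in the shell outside A; J * h <= 1
   keeps the total loss below 2 e. *)
pose h : R := J.+1%:R^-1.
have h0 : 0 < h by rewrite invr_gt0.
have Jh : J%:R * h <= 1 by rewrite ler_pdivrMr// mul1r ler_nat.
have [u [u1 u2 Pu]] := mve_shrink P t01 h0.
(* Closed sets not depending on n that contain the superlevel sets of [phi] within [An n]. Their
   parts inside A are not charged by Q. *)
pose C_ (j : 'I_J) := E0 u `&` [set y | j.+1%:R * e <= phi y].
have clC j : closed (C_ j).
  apply: closedI; first exact: closed_qball.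
  apply: (@preimage_closed _ _ phi [set r | j.+1%:R * e <= r]) => [y _|]; last exact: closed_ge.
  exact: cphi.
have mC j : measurable (C_ j) by exact: closed_measurable_col.
have mE w : measurable (E0 w) by exact: measurable_qball.
have AsubE : A `<=` E0 u.
  have AE : A = E0 t0 := mve_central_qball; move=> y; rewrite AE; apply: qballS; exact: ltW.
have PC j : fine (P (C_ j)) <= (1 - pi0) * fin (A `&` C_ j) + h.
  have PCf : (P (C_ j) < +oo)%E by apply: le_lt_trans (probability_le1 P (mC j)) (ltry 1).
  rewrite (fine_measureDI (mC j) mA PCf); apply: lerD.
    rewrite setIC (PE g_ell gG2 P_gem); last exact: measurableI.
    have : fine (Q (A `&` C_ j)) <= fine (Q A) by apply: fine_probabilityS => //;
      exact: measurableI.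
    rewrite (Q_A P_gem A_mve) /= => q0; have := ler_wpM2l (pi0_ge0 P_gem) q0.
    by rewrite mulr0; lra.
  apply: (@le_trans _ _ (fine (P (E0 u `\` A)))).
    apply: fine_probabilityS; [exact: measurableD|exact: measurableD|].
    by apply: setSD => y [].
  have PEf : (P (E0 u) < +oo)%E by apply: le_lt_trans (probability_le1 P (mE u)) (ltry 1).
  have := fine_measureDI (mE u) mA PEf.
  have -> : E0 u `&` A = A by apply/setIidPr.
  lra.
have nearC : \forall n \near U, forall j, Pn x n (C_ j) <= fine (P (C_ j)) + h.
  by apply: filter_forall => j; exact: (Pn_closed x_weak Uoo).
have [K hK] := @qball_bounded R p (Prec th0) th0.1 t1 pM0.
pose H n y := Num.sqrt (c n * (Num.sqrt (\det (Prec (th n))) * gabs g (qf (Prec (th n)) (y - (th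
  n).1))) / (c0 n * m0 y)).
have uni : \forall n \near U, forall y, @cbox R p K y -> `|H n y - phi y| < e.
  apply: (@uniform_near R nat U p K H phi) => // y _.
  have k1 : H z.2 z.1 @[z --> (nbhs y, U)] --> phi y.
    apply: (@continuous_cvg _ _ _ (filter_prod (nbhs y) U) _ (fun z =>
      c z.2 * (Num.sqrt (\det (Prec (th z.2))) * gabs g (qf (Prec (th z.2)) (z.1 - (th z.2).1)))
        / (c0 z.2 * m0 z.1)) (@Num.sqrt R)).
      exact: sqrt_continuous.
    apply: cvgM.
      by apply: cvgM; [exact: (cvg_comp _ _ cvg_snd hc)|exact: pdf_joint].
    apply: cvgV; first by rewrite gt_eqF// mulr_gt0.
    apply: cvgM; first exact: (cvg_comp _ _ cvg_snd c0_cvg).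
    by apply: (cvg_comp _ _ cvg_fst); exact: cm0.
  have k2 : phi z.1 @[z --> (nbhs y, U)] --> phi y.
    by apply: (cvg_comp _ _ cvg_fst); exact: cphi.
  exact: cvg_sub0 k1 k2.
have hs := emp_mve_sub x_weak UU Uoo hAn u1.
have c0h : \forall n \near U, 0 < c0 n by exact: (cvgr_gt _ c0_cvg).
have b0h : \forall n \near U, 0 < b0 n.
  by apply: (cvgr_gt _ b0_cvg); rewrite invr_gt0.
have lay : \sum_(j < J) (e * (1 - pi0)) * fin (A `&` C_ j) <= rint A S.
  have w0 : 0 <= e * (1 - pi0) by rewrite mulr_ge0// ltW.
  apply: (rint_layers mA A_lty mC w0 cf0 f0_ge0 Cb0 cS).
    move=> y; rewrite S_ge0 /=; apply: le_trans (aa0_le y); apply: le_trans (S_le y).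
    by have := S_ge0 y; lra.
  move=> y Ay.
  have yt1 : E0 t1 y by apply: (qballS (ltW u2)); exact: AsubE.
  have SE : S y = phi y * ((1 - pi0) * f0 y).
    have z0 : 0 < (1 - pi0) * f0 y by rewrite mulr_gt0// (lt_le_trans d0 (f0d _ yt1)).
    rewrite /phi m0E// -[X in _ * X]ger0_norm ?(ltW z0)// -sqrtr_sqr -sqrtrM;
      last by rewrite divr_ge0// ltW.
    by rewrite /S /a0 expr2 mulrA divfK// gt_eqF.
  rewrite SE; apply: (@le_trans _ _ ((\sum_(j < J) e * (j.+1%:R * e <=
    phi y)%R%:R) * ((1 - pi0) * f0 y))).
    rewrite mulr_suml; apply: ler_sum => j _.
    have i1 : (y \in C_ j)%:R <= (j.+1%:R * e <= phi y)%R%:R :> R.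
      by rewrite ler_nat; case: (boolP (y \in C_ j)) => // /set_mem [_ /= ->].
    have i2 : 0 <= e * ((1 - pi0) * f0 y) by rewrite mulr_ge0 ?(ltW e0)//; exact: a0_ge0.
    by have := ler_wpM2r i2 i1; lra.
  apply: ler_wpM2r; first exact: a0_ge0.
  by apply: layers_le => //; exact: ltW.
have cvb : (1 - Pn x n (An n)) * Num.sqrt (b n / b0 n) @[n --> U] --> 2^-1 * Num.sqrt (2 * b').
  apply: cvgM.
    have -> : 2^-1 = 1 - 2^-1 :> R by lra.
    by apply: cvgB; [exact: cvg_cst|exact: (Pn_emp_mve_cvg p_gt0 g_ell gG2 P_gem pi0_lt A_mve
      A_unique x_weak UU Uoo hAn)].
  apply: (@continuous_cvg _ _ _ U _ (fun n => b n / b0 n) (@Num.sqrt R));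
    first exact: sqrt_continuous.
  have -> : 2 * b' = b' / 2^-1 by rewrite invrK mulrC.
  by apply: cvgM => //; apply: cvgV => //; rewrite gt_eqF// invr_gt0.
(* One e for replacing the fitted ratio by [phi], one for the discretization into layers, two for
   the losses of the layers. *)
suff main : \forall n \near U, 1 <= 4 * e + rint A S + (1 - Pn x n (An n)) * Num.sqrt (b n / b0 n).
  have cv : 4 * e + rint A S + (1 - Pn x n (An n)) * Num.sqrt (b n / b0 n) @[n --> U] -->
    4 * e + rint A S + 2^-1 * Num.sqrt (2 * b') by apply: cvgD => //; exact: cvg_cst.
  have e4 : 4 * e = e' by rewrite mulrC divfK.
  have hm : 1 <= 4 * e + rint A S + 2^-1 * Num.sqrt (2 * b') by exact: (cvgr_to_ge cv main).
  move: (rint A S) (2^-1 * Num.sqrt (2 * b')) hm => r1 r2 hm.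
  by rewrite e4 in hm; rewrite [leRHS]addrC addrA.
near=> n.
have n0 : (0 < n)%N by near: n.
have pn : Theta R p (th n) by near: n.
have cn0 : 0 <= c n by near: n.
have bn0 : 0 <= b n by near: n.
have c0n : 0 < c0 n by near: n.
have b0n : 0 < b0 n by near: n.
have sub : An n `<=` E0 u by near: n.
have un : forall y, @cbox R p K y -> `|H n y - phi y| < e by near: n.
have hl : lik g (An n) (c0 n) (b0 n) th0 x n <= lik g (An n) (c n) (b n) (th n) x n by near: n.
have hC : forall j, Pn x n (C_ j) <= fine (P (C_ j)) + h by near: n.
have fn0 y : 0 <= elliptical_pdf g (th n) y by exact: (elliptical_pdf_ge0 g_ell _ pn).
pose beta := Num.sqrt (b n / b0 n).
pose uu (i : 'I_n) := if x i \in An n then c n * elliptical_pdf g (th n) (x i) else b n.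
pose vv (i : 'I_n) := if x i \in An n then c0 n * f0 (x i) else b0 n.
have subt y : An n y -> E0 t1 y by move=> /sub; apply: qballS; exact: ltW.
have uu0 i : 0 <= uu i by rewrite /uu; case: ifP => // _; exact: mulr_ge0.
have vv0 i : 0 < vv i.
  rewrite /vv; case: ifPn => // /set_mem /subt /f0d fd.
  by rewrite mulr_gt0// (lt_le_trans d0).
have AG := sqrt_AGM n0 uu0 vv0 hl.
have pt (i : 'I_n) : Num.sqrt (uu i / vv i) <=
  2 * e + \sum_(j < J) e * \1_(C_ j) (x i) + \1_(~` An n) (x i) * beta.
  rewrite /uu /vv !indicE in_setC; have [xA|xA] /= := boolP (x i \in An n); last first.
    rewrite mul1r lerDr; apply: addr_ge0; first by rewrite mulr_ge0// ltW.
    by apply: sumr_ge0 => j _; rewrite mulr_ge0// ltW.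
  rewrite mul0r addr0; have /set_mem xiA := xA.
  have hH : H n (x i) = Num.sqrt (c n * elliptical_pdf g (th n) (x i) / (c0 n * f0 (x i))).
    by rewrite /H -(pdf_det g_ell _ pn) m0E//; exact: subt.
  have := un (x i) (hK _ (subt _ xiA)); rewrite hH ltr_norml => /andP[_ h1].
  have := layers_ge (ltW e0) (le_trans (phiB (x i)) BJ).
  rewrite (eq_bigr (fun j : 'I_J => e * \1_(C_ j) (x i))) => [h2|].
    rewrite ltrBlDr in h1; apply: le_trans (ltW h1) _.
    by rewrite (_ : 2 * e = e + e) -?addrA ?lerD2l// mulr_natl.
  move=> j _; rewrite indicE; congr (_ * (nat_of_bool _)%:R).
  apply/idP/idP => [hj|/set_mem [] //]; apply/mem_set; split=> //; exact: sub.
apply: le_trans AG _.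
apply: (@le_trans _ _ (n%:R^-1 * \sum_(i < n) (2 * e + \sum_(j < J) e * \1_(C_ j) (x i) + \1_(~`
  An n) (x i) * beta))).
  apply: ler_wpM2l; first by rewrite invr_ge0.
  by apply: ler_sum => i _; exact: pt.
have nn : n%:R != 0 :> R by rewrite pnatr_eq0 -lt0n.
rewrite !big_split /= sumr_const card_ord -mulr_suml exchange_big /= !mulrDr.
have -> : n%:R^-1 * (2 * e *+ n) = 2 * e by rewrite -[2 * e *+ n]mulr_natl mulKf.
rewrite [X in _ + _ + X]mulrA -/(Pn x n (~` An n)) PnC// -/beta.
rewrite lerD2r.
have -> : n%:R^-1 * (\sum_(j < J) \sum_(i < n) e * \1_(C_ j) (x i)) =
  \sum_(j < J) e * Pn x n (C_ j).
  rewrite mulr_sumr; apply: eq_bigr => j _; rewrite -mulr_sumr /Pn mulrCA.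
  by [].
have s1 : \sum_(j < J) e * Pn x n (C_ j) <=
  \sum_(j < J) (e * (1 - pi0) * fin (A `&` C_ j) + e * (2 * h)).
  apply: ler_sum => j _; rewrite -mulrA -mulrDr; apply: ler_wpM2l; first exact: ltW.
  apply: le_trans (hC j) _.
  by rewrite (_ : 2 * h = h + h) ?addrA ?lerD2r// mulr_natl.
have s2 : \sum_(j < J) e * (2 * h) <= 2 * e.
  rewrite sumr_const card_ord -[X in X <= _]mulr_natl.
  have -> : J%:R * (e * (2 * h)) = 2 * e * (J%:R * h) by ring.
  by rewrite ler_piMr// mulr_ge0// ltW.
rewrite big_split /= in s1.
have -> : 4 * e + rint A S = 2 * e + (rint A S + 2 * e) by ring.
by rewrite lerD2l; apply: le_trans s1 (lerD lay s2).
Unshelve. all: by end_near. Qed.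

(** The integral over A of (sqrt a - sqrt a0) ^ 2 is at most (1 - b') + 1/2 - 2 (1 - sqrt (2 b') /
    2) = sqrt (2 b') - b' - 1/2, by [limit_mass], (1 - pi0) P_theta0(A) = 1/2 and [affinity_ge1].
    This is never positive, and the integrand is continuous. *)
Lemma limit_pdf y : O0 t0 y -> a y = a0 y.
Proof.
move=> yO; apply/eqP; apply/negPn/negP => ne.
pose D z := (Num.sqrt (a z) - Num.sqrt (a0 z)) ^+ 2.
have DE z : D z + 2 * S z = a z + a0 z.
  have SE : S z = Num.sqrt (a z) * Num.sqrt (a0 z) by rewrite /S sqrtrM.
  have sa : Num.sqrt (a z) ^+ 2 = a z by rewrite sqr_sqrtr.
  have sb : Num.sqrt (a0 z) ^+ 2 = a0 z by rewrite sqr_sqrtr.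
  by rewrite SE -[in RHS]sa -[in RHS]sb /D; ring.
have D0 z : 0 <= D z by exact: sqr_ge0.
have cD : continuous D.
  have -> : D = (fun z => (a z + a0 z) - 2 * S z) by apply/funext => z; rewrite -DE addrK.
  have c2S : continuous (fun z => 2 * S z) by exact: cscale cS.
  exact: clin ca ca0 c2S.
have aC z : 0 <= a z <= Cb.
  by rewrite a_ge0 /=; apply: le_trans (aa0_le z); rewrite lerDl; exact: a0_ge0.
have a0C z : 0 <= a0 z <= Cb.
  by rewrite a0_ge0 /=; apply: le_trans (aa0_le z); rewrite lerDr; exact: a_ge0.
have DC z : 0 <= D z <= Cb.
  by rewrite D0 /=; apply: le_trans (aa0_le z); rewrite -DE lerDl mulr_ge0.
have SC z : 0 <= 2 * S z <= Cb.
  by rewrite mulr_ge0//=; apply: le_trans (aa0_le z); rewrite -DE lerDr.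
have c2S : continuous (fun z => 2 * S z) by exact: cscale cS.
have e1 := rintD mA A_lty ca ca0 Cb0 aC a0C.
have e2 := rintD mA A_lty cD c2S Cb0 DC SC.
have eDS : (fun z => D z + 2 * S z) = (fun z => a z + a0 z) by apply/funext.
have e3 : rint A D + 2 * rint A S = rint A a + rint A a0.
  by rewrite -e1 -eDS e2 (rintZ mA cS)//.
have e4 : rint A a = c' * fine (elliptical_prob g th' A) by rewrite (rintZ mA cf').
have e5 : rint A a0 = 2^-1.
  rewrite (rintZ mA cf0)//; first exact: (mve_prob0_half p_gt0 g_ell gG2 P_gem pi0_lt A_mve
    A_unique).
  exact: ltW.
have aff := affinity_ge1; have lm := limit_mass.
have AGM : Num.sqrt (2 * b') <= b' + 2^-1.
  have b2 : 0 <= 2 * b' by rewrite mulr_ge0.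
  have := sqr_ge0 (Num.sqrt (2 * b') - 1); rewrite sqrrB sqr_sqrtr// expr1n mulr1 -mulr_natl.
  by move: (Num.sqrt (2 * b')) => r; lra.
have D_le : rint A D <= 0.
  move: e3 aff AGM lm; rewrite e4 e5.
  move: (rint A D) (rint A S) (c' * _) (Num.sqrt _) => r1 r2 r3 r4; lra.
have Dy : 0 < D y.
  rewrite lt_neqAle D0 andbT eq_sym sqrf_eq0 subr_eq0; apply: contraNneq ne => h.
  by rewrite -(sqr_sqrtr (a_ge0 y)) h sqr_sqrtr.
have nb : nbhs y (O0 t0 `&` [set z | D y / 2 < D z]).
  apply: filterI; first by apply: open_nbhs_nbhs; split=> //; exact: open_qballo.
  by apply: (cvgr_gt _ (cD y)); rewrite ltr_pdivrMr// ltr_pMr// ltr1n.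
have [r r0 sub] := nbhs_qball nb.
have subA : qball 1%:M y r `<=` A.
  by have AE : A = E0 t0 := mve_central_qball; move=> z /sub [zO _]; rewrite AE; exact: qballoW.
have D2 : 0 <= D y / 2 by rewrite divr_ge0// ltW.
have := rint_ge_qball mA A_lty cD Cb0 DC D2 subA (fun z hz => ltW (sub z hz).2).
have pos : 0 < D y / 2 * fine (lam (qball 1%:M y r)).
  apply: mulr_gt0; first by rewrite divr_gt0.
  have f1 : fine (lam (qball (1%:M : 'M[R]_p) y 1)) > 0.
    by rewrite fine_gt0// qball_gt0 (qball_lty _ _ (pd1 R p)).
  rewrite qball_dilate// fineM//; first by rewrite mulr_gt0//= exprn_gt0// sqrtr_gt0.
  by rewrite fin_numElt (qball_lty _ _ (pd1 R p)) (lt_le_trans (ltNyr 0)).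
by move=> h; have := lt_le_trans pos (le_trans h D_le); rewrite ltxx.
Qed.

Lemma limit_eq : [/\ mu' = th0.1, N' = Prec th0 & c' = 1 - pi0].
Proof.
have sM : 0 < Num.sqrt (\det (Prec th0)).
  by rewrite sqrtr_gt0 det_inv invr_gt0 (det_gt0 g_ell pth0).
have hy y : qf (Prec th0) (y - th0.1) < t0 ->
  c' * Num.sqrt (\det N') * g (qf N' (y - mu')) =
  (1 - pi0) * Num.sqrt (\det (Prec th0)) * g (qf (Prec th0) (y - th0.1)).
  move=> /limit_pdf; rewrite /a /a0 (pdf_det g_ell _ pth') (pdf_det g_ell _ pth0) /= invmxK.
  by rewrite /gabs !ger0_norm ?mulrA//; exact: pd_psd.
have c1 : 0 <= c' * Num.sqrt (\det N') by rewrite mulr_ge0.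
have c2 : 0 < (1 - pi0) * Num.sqrt (\det (Prec th0)) by rewrite mulr_gt0.
have [e1 e2 e3] := generator_identifies g_ell gG1 gG2 pM0 pN' (gen0_gt0 g_ell gG2) t00 c1 c2 hy.
split=> //; move: e3; rewrite e2 => /eqP;
  rewrite -subr_eq0 -mulrBl mulf_eq0 (gt_eqF sM) orbF subr_eq0.
by move=> /eqP.
Qed.

End limit.

(** * The three estimators *)

Section fit_cvg.
Import numFieldNormedType.Exports.
Context {R : realType} {p : nat} (p_gt0 : (0 < p)%N) (g : R -> R).
Hypotheses (g_ell : elliptical_generator p g) (gG1 : condG1 g) (gG2 : condG2 g).
Variables (P Q : probability 'cV[R]_p R) (pi0 : R) (th0 : 'cV[R]_p * 'M[R]_p).
Hypotheses (P_gem : gross_error_model g P pi0 th0 Q) (pi0_lt : pi0 < 2^-1).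
Variable A : set 'cV[R]_p.
Hypotheses (A_mve : is_mve P A) (A_unique : forall B, is_mve P B -> B = A).
Local Notation lam := (lebesgue_col R p).
Local Notation Prec th := (invmx th.2).
Local Notation E0 u := (qball (Prec th0) th0.1 u).
Local Notation O0 u := (qballo (Prec th0) th0.1 u).
Local Notation fin B := (fine (elliptical_prob g th0 B)).
Local Notation pth0 := (Theta0 P_gem).
Local Notation t0 := (mve_level p_gt0 g_ell gG2 P_gem pi0_lt A_mve A_unique).
Local Notation mve_level_gt0 := (mve_level_gt0 p_gt0 g_ell gG2 P_gem pi0_lt A_mve A_unique).

Let pM0 : posdefmx (Prec th0). Proof. exact: pd_inv pth0. Qed.
Let t00 : 0 < t0. Proof. exact: mve_level_gt0. Qed.
Let pi1 : 0 < 1 - pi0. Proof. by have := pi0_lt; lra. Qed.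

Lemma P_qballo_gt0 u : 0 < u -> 0 < fine (P (O0 u)).
Proof.
move=> u0; have mO : measurable (O0 u) by exact: measurable_qballo.
rewrite (PE g_ell gG2 P_gem mO); apply: ltr_pwDl; last first.
  by rewrite mulr_ge0 ?(pi0_ge0 P_gem)// fine_ge0.
apply: mulr_gt0 => //.
have [t1 t01 gt1] := gen_pos_beyond p_gt0 g_ell gG2 P_gem pi0_lt A_mve A_unique.
pose w := Num.min u t1; have w0 : 0 < w by rewrite lt_min u0 (lt_trans t00).
have mOw : measurable (O0 w) by exact: measurable_qballo.
pose d := (Num.sqrt (\det th0.2))^-1 * g t1.
have d0 : 0 < d by rewrite mulr_gt0// invr_gt0 (sqrt_det_gt0 g_ell pth0).
have lO : (lam (O0 w) < +oo)%E.
  apply: le_lt_trans (qball_lty th0.1 w pM0); apply: le_measureS => //.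
    exact: measurable_qball.
  exact: qballoW.
have fO : d * fine (lam (O0 w)) <= fin (O0 w).
  apply: (prob0_ge g_ell gG2 P_gem) => // [|y yO]; first exact: ltW.
  rewrite (elliptical_pdfE g _ pth0); apply: ler_wpM2l.
    by rewrite invr_ge0 sqrtr_ge0.
  have q0 : 0 <= qf (Prec th0) (y - th0.1) by exact: pd_psd.
  rewrite /gabs ger0_norm//; apply: (gen_le g_ell) => //.
  by apply: le_trans (ltW yO) _; rewrite ge_min lexx orbT.
apply: (@lt_le_trans _ _ (fin (O0 w))); last first.
  apply: (prob0S g_ell gG2 P_gem) => // y; rewrite /qballo /= => h.
  by apply: lt_le_trans h _; rewrite ge_min lexx.
apply: lt_le_trans fO; apply: mulr_gt0 => //; rewrite fine_gt0// lO andbT.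
rewrite qballo_dilate//; apply: mule_gt0; first by rewrite lte_fin exprn_gt0// sqrtr_gt0.
by rewrite qballo1// qball_gt0.
Qed.

Variable x : nat -> 'cV[R]_p.
Hypothesis x_weak : weak_limsup x P.
Variable U : set_system nat.
Hypotheses (UU : UltraFilter U) (Uoo : \oo `<=` U).
Variable An : nat -> set 'cV[R]_p.
Hypothesis hAn : \forall n \near \oo, is_mve (emp_prob x n) (An n).

(** [tail_bound] does not depend on n, so one sample is enough. For large n some observation lies in
    [O0 (t0 / 2)], inside [An n], and the spikes are placed there. *)
Lemma tail_of_fit :
  (\forall n \near U, exists M : R, forall th, Theta R p th ->
     2^-1 <= fine (elliptical_prob g th (An n)) ->
     exists c b, [/\ 2^-1 <= c, Num.min 2^-1 (fine (elliptical_prob g th (~` An n))) <= b &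
       lik g (An n) c b th x n <= M]) ->
  @tail_bound R p g.
Proof.
move=> hM.
have t2 : 0 < t0 / 2 by rewrite divr_gt0.
have t2' : t0 / 2 < t0 by rewrite ltr_pdivrMr// ltr_pMr// ltr1n.
have e0 : 0 < fine (P (O0 (t0 / 2))) / 2 by rewrite divr_gt0// P_qballo_gt0.
have [K hK] := @qball_bounded R p (Prec th0) th0.1 (t0 + 1) pM0.
have h1 := Pn_open x_weak UU Uoo (@open_qballo R p (Prec th0) th0.1 (t0 / 2)) e0.
have h2 := emp_mve_sup x_weak UU Uoo hAn t2 t2'.
have h3 := emp_mve_sub x_weak UU Uoo hAn (ltr_pwDr ltr01 (lexx t0) : t0 < t0 + 1).
have h4 := measurable_emp_mve Uoo hAn.
have : \forall n \near U, @tail_bound R p g; last by move=> /filter_ex [].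
near=> n.
have [M hMn] : exists M : R, forall th, Theta R p th ->
     2^-1 <= fine (elliptical_prob g th (An n)) ->
     exists c b, [/\ 2^-1 <= c, Num.min 2^-1 (fine (elliptical_prob g th (~` An n))) <= b &
       lik g (An n) c b th x n <= M] by near: n.
have k1 : fine (P (O0 (t0 / 2))) - fine (P (O0 (t0 / 2))) / 2 <= Pn x n (O0 (t0 / 2)) by near: n.
have k2 : E0 (t0 / 2) `<=` An n by near: n.
have k3 : An n `<=` E0 (t0 + 1) by near: n.
have k4 : measurable (An n) by near: n.
have [i hi] : exists i : 'I_n, O0 (t0 / 2) (x i).
  apply: contrapT => /forallNP hno.
  have : Pn x n (O0 (t0 / 2)) = 0.
    by rewrite /Pn big1 ?mulr0// => i _; rewrite indicE memNset//; exact: hno.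
  by move: k1 e0; lra.
apply: (tail_of_spikes p_gt0 g_ell gG2 (i := i) (O := O0 (t0 / 2)) (K0 := K) k4 _ _ _ hi hMn).
- exact: subset_trans k3 hK.
- exact: open_qballo.
- by apply: subset_trans k2; exact: qballoW.
Unshelve. all: by end_near. Qed.

Variables (th : nat -> 'cV[R]_p * 'M[R]_p) (c b c0 b0 : nat -> R) (Cm : R).
Hypothesis th_Theta : \forall n \near U, Theta R p (th n).
Hypothesis c_bound : \forall n \near U, 0 <= c n <= Cm.
Hypothesis b_bound : \forall n \near U, 0 <= b n <= 1.
Hypothesis mass : \forall n \near U, c n * fine (elliptical_prob g (th n) (An n)) + b n <= 1.
Hypothesis c0_cvg : c0 n @[n --> U] --> 1 - pi0.
Hypothesis b0_cvg : b0 n @[n --> U] --> (2^-1 : R).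
Hypothesis lik_le : \forall n \near U,
  lik g (An n) (c0 n) (b0 n) th0 x n <= lik g (An n) (c n) (b n) (th n) x n.
Hypothesis spikes : \forall n \near U, exists M : R, forall th, Theta R p th ->
     2^-1 <= fine (elliptical_prob g th (An n)) ->
     exists c b, [/\ 2^-1 <= c, Num.min 2^-1 (fine (elliptical_prob g th (~` An n))) <= b &
       lik g (An n) c b th x n <= M].

Lemma fit_cvg : th n @[n --> U] --> th0 /\ c n @[n --> U] --> 1 - pi0.
Proof.
have tail := tail_of_fit spikes.
have [mu' [N' [c' [b' [pN hmu hN [hS hc hb c0' b0']]]]]] :=
  fit_limit p_gt0 g_ell gG2 P_gem pi0_lt A_mve A_unique
  x_weak UU Uoo hAn th_Theta c_bound b_bound c0_cvg b0_cvg lik_le tail.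
have cg0 : \forall n \near U, 0 <= c n by apply: filterS c_bound => n /andP[].
have bg0 : \forall n \near U, 0 <= b n by apply: filterS b_bound => n /andP[].
have [e1 e2 e3] := limit_eq p_gt0 g_ell gG1 gG2 P_gem pi0_lt A_mve A_unique
  x_weak UU Uoo hAn th_Theta cg0 bg0 mass c0_cvg b0_cvg lik_le pN hmu hN hc hb c0' b0'.
split; last by rewrite -e3.
rewrite e1 in hmu; rewrite e2 invmxK in hS.
have -> : th = (fun n => ((th n).1, (th n).2)) by apply/funext => n; case: (th n).
by rewrite [th0]surjective_pairing; have h := cvg_pair hmu hS; exact: h.
Qed.

End fit_cvg.

Section log_likelihood.
Context {R : realType}.
Local Open Scope ereal_scope.

Lemma expeR_sum (I : Type) (r : seq I) (F : I -> \bar R) :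
  expeR (\sum_(i <- r) F i) = \prod_(i <- r) expeR (F i).
Proof.
elim: r => [|i r IH]; first by rewrite !big_nil expeR0.
by rewrite !big_cons expeRD IH.
Qed.

(** Exponentiating in the extended reals covers vanishing factors, whose logarithm is -oo. *)
Lemma sum_lne_le n (u v : 'I_n -> R) : (0 < n)%N ->
  (forall i, 0 <= u i)%R -> (forall i, 0 <= v i)%R ->
  (n%:R^-1)%:E * \sum_(i < n) lne (u i)%:E <= (n%:R^-1)%:E * \sum_(i < n) lne (v i)%:E ->
  (\prod_(i < n) u i <= \prod_(i < n) v i)%R.
Proof.
move=> n0 u0 v0.
rewrite lee_pmul2l//; last by rewrite lte_fin invr_gt0 ltr0n.
have h (w : 'I_n -> R) : (forall i, 0 <= w i)%R ->
  expeR (\sum_(i < n) lne (w i)%:E) = (\prod_(i < n) w i)%:E.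
  move=> w0; rewrite expeR_sum -prodEFin; apply: eq_bigr => i _.
  by rewrite lneK// in_itv /= leey lee_fin w0.
by rewrite -lee_expeR !h// lee_fin.
Qed.

Variables (p : nat) (g : R -> R) (x : nat -> 'cV[R]_p) (n : nat).
Hypotheses (g_ell : elliptical_generator p g) (gG2 : condG2 g).
Implicit Types (th : 'cV[R]_p * 'M[R]_p) (A : set 'cV[R]_p).
Local Notation v A c b th := (fun i : 'I_n =>
  (if x i \in A then c * elliptical_pdf g th (x i) else b)%R).
Local Notation prob th A := (fine (elliptical_prob g th A)).

Lemma prob_fin th A : Theta R p th -> measurable A -> elliptical_prob g th A = (prob th A)%:E.
Proof.
move=> pt mA; have [m hm] := elliptical_probability g_ell gG2 pt.
by rewrite -hm -fin_num_probability.
Qed.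

Lemma prob_ge0 th A : Theta R p th -> (0 <= prob th A)%R.
Proof. by move=> pt; have [m hm] := elliptical_probability g_ell gG2 pt; rewrite -hm fine_ge0. Qed.

Lemma probC th A : Theta R p th -> measurable A -> (prob th (~` A) = 1 - prob th A)%R.
Proof.
move=> pt mA; have [m hm] := elliptical_probability g_ell gG2 pt.
by rewrite -!hm probability_setC// (fin_num_probability m mA).
Qed.

Lemma prob_le1 th A : Theta R p th -> measurable A -> (prob th A <= 1)%R.
Proof. by move=> pt mA; have := prob_ge0 (~` A) pt; rewrite probC// subr_ge0. Qed.

Lemma lik_sE A pi th : Theta R p th -> measurable A ->
  lik_s g x n A pi th = (n%:R^-1)%:E *
    \sum_(i < n) lne (v A (1 - pi) ((1 - pi) * prob th (~` A) + pi)%R th i)%:E.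
Proof.
move=> pt mA; rewrite /lik_s /emp_mean; congr (_ * _); apply: eq_bigr => i _.
rewrite (prob_fin pt (measurableC mA)) -!EFinM -EFinD !indicE in_setC.
by case: (x i \in A) => /=; rewrite mul1e mul0e ?adde0 ?add0e.
Qed.

Lemma lik_cE A th : Theta R p th -> measurable A ->
  lik_c g x n A th = (n%:R^-1)%:E * \sum_(i < n) lne (v A 1%R (prob th (~` A)) th i)%:E.
Proof.
move=> pt mA; rewrite /lik_c /emp_mean; congr (_ * _); apply: eq_bigr => i _.
rewrite (prob_fin pt (measurableC mA)) !indicE in_setC mul1r.
by case: (x i \in A) => /=; rewrite mul1e mul0e ?adde0 ?add0e.
Qed.

Lemma lik_rE A th : Theta R p th -> measurable A -> (0 < prob th A)%R ->
  lik_r g x n A th = (n%:R^-1)%:E * \sum_(i < n) lne (v A (prob th A)^-1%R 1%R th i)%:E.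
Proof.
move=> pt mA p0; rewrite /lik_r /emp_mean; congr (_ * _); apply: eq_bigr => i _.
rewrite (prob_fin pt mA) inver gt_eqF// -EFinM indicE mulrC.
case: (x i \in A) => /=; first by rewrite mul1e.
by rewrite mul0e; exact: esym (@lne1 R).
Qed.

(** The MLE(r) criterion has c P_theta(A) = 1 and b = 1, of total mass 2; halving both brings it to
    mass 1 without affecting the maximizers. *)
Lemma lik_half A c th : lik g A (2^-1 * c)%R 2^-1%R th x n = (2^-1 ^+ n * lik g A c 1 th x n)%R.
Proof.
have -> : (2^-1 ^+ n = \prod_(i < n) 2^-1 :> R)%R by rewrite prodr_const card_ord.
rewrite /lik -big_split /=; apply: eq_bigr => i _.
by case: ifP => _; rewrite ?mulr1 ?mulrA.
Qed.

End log_likelihood.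

Section paths.
Import numFieldNormedType.Exports.
Context {R : realType} {p : nat} (p_gt0 : (0 < p)%N) (g : R -> R).
Hypotheses (g_ell : elliptical_generator p g) (gG1 : condG1 g) (gG2 : condG2 g).
Variables (P Q : probability 'cV[R]_p R) (pi0 : R) (th0 : 'cV[R]_p * 'M[R]_p).
Hypotheses (P_gem : gross_error_model g P pi0 th0 Q) (pi0_lt : pi0 < 2^-1).
Variable A : set 'cV[R]_p.
Hypotheses (A_mve : is_mve P A) (A_unique : forall B, is_mve P B -> B = A).
Local Notation pth0 := (Theta0 P_gem).
Local Notation prob th B := (fine (elliptical_prob g th B)).

Variable x : nat -> 'cV[R]_p.
Hypothesis x_weak : weak_limsup x P.
Variable An : nat -> set 'cV[R]_p.
Hypothesis hAn : \forall n \near \oo, is_mve (emp_prob x n) (An n).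

Let pi1 : 0 < 1 - pi0. Proof. by have := pi0_lt; lra. Qed.
Let pi1_0 : 1 - pi0 != 0. Proof. by rewrite gt_eqF. Qed.
Let pi0_ge0 : 0 <= pi0 := pi0_ge0 P_gem.

Let mAn : \forall n \near \oo, measurable (An n).
Proof.
apply: filterS hAn => n [/is_ellipsoidP [N [nu [_ ->]]] _ _].
exact: measurable_qball.
Qed.

Let P0_cvg U : UltraFilter U -> \oo `<=` U ->
  prob th0 (An n) @[n --> U] --> (2 * (1 - pi0))^-1.
Proof.
by move=> UU Uoo; exact: (prob0_emp_mve_cvg p_gt0 g_ell gG2 P_gem pi0_lt A_mve A_unique x_weak UU
  Uoo hAn).
Qed.

Let P0C_cvg U : UltraFilter U -> \oo `<=` U ->
  prob th0 (~` An n) @[n --> U] --> 1 - (2 * (1 - pi0))^-1.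
Proof.
move=> UU Uoo.
have h : 1 - prob th0 (An n) @[n --> U] --> 1 - (2 * (1 - pi0))^-1.
  by apply: cvgB; [exact: cvg_cst|exact: P0_cvg].
apply: cvg_trans h; apply: near_eq_cvg; apply: Uoo; apply: filterS mAn => n mA.
by rewrite (probC g_ell gG2 pth0).
Qed.

Lemma MLEs_cvg (pihat : nat -> R) (th : nat -> 'cV[R]_p * 'M[R]_p) :
  (\forall n \near \oo, is_MLEs g x n (An n) (pihat n) (th n)) ->
  (pihat n, th n) @[n --> \oo] --> (pi0, th0).
Proof.
move=> hM; apply: ultra_cvg => U UU Uoo.
pose c n := 1 - pihat n.
pose b n := (1 - pihat n) * prob (th n) (~` An n) + pihat n.
pose b0 n := (1 - pi0) * prob th0 (~` An n) + pi0.
have UM := Uoo _ hM; have UmA := Uoo _ mAn.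
have n_pos : \forall n \near U, (0 < n)%N by apply: Uoo; exists 1%N.
have thT : \forall n \near U, Theta R p (th n) by apply: filterS UM => n [].
have lik_le : \forall n \near U, forall (pi' : R) th', 0 <= pi' < 1 -> Theta R p th' ->
    lik g (An n) (1 - pi') ((1 - pi') * prob th' (~` An n) + pi') th' x n <=
    lik g (An n) (c n) (b n) (th n) x n.
  near=> n => pi' th' hpi' pt'.
  have n0 : (0 < n)%N by near: n.
  have mA : measurable (An n) by near: n.
  have [/andP[p0 p1] pt hmax] : is_MLEs g x n (An n) (pihat n) (th n) by near: n.
  have := hmax pi' th' hpi' pt'; rewrite !(lik_sE _ _ g_ell gG2)//.
  have v0 (pi2 : R) th2 (i : 'I_n) : 0 <= pi2 < 1 -> Theta R p th2 ->
    0 <= (if x i \in An n then (1 - pi2) * elliptical_pdf g th2 (x i)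
      else (1 - pi2) * prob th2 (~` An n) + pi2).
    move=> /andP[q0 q1] pt2; have q2 : 0 <= 1 - pi2 by lra.
    case: ifP => _; first by apply: mulr_ge0 => //; exact: (elliptical_pdf_ge0 g_ell _ pt2).
    by rewrite addr_ge0// mulr_ge0// (prob_ge0 g_ell gG2).
  apply: (sum_lne_le n0) => i; apply: v0 => //.
  by rewrite p0.
have [h1 h2] : th n @[n --> U] --> th0 /\ c n @[n --> U] --> 1 - pi0.
  apply: (@fit_cvg R p p_gt0 g g_ell gG1 gG2 P Q pi0 th0 P_gem pi0_lt A A_mve A_unique x x_weak U
    UU Uoo An hAn
    th c b (fun=> 1 - pi0) b0 1) => //.
  - by apply: filterS UM => n [/andP[q0 q1] _ _]; rewrite /c; apply/andP; split; lra.
  - near=> n.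
    have mA : measurable (An n) by near: n.
    have pt : Theta R p (th n) by near: n.
    have [/andP[q0 q1] _ _] : is_MLEs g x n (An n) (pihat n) (th n) by near: n.
    have q2 : 0 <= 1 - pihat n by lra.
    have r0 := prob_ge0 g_ell gG2 (~` An n) pt.
    have r1 := prob_le1 g_ell gG2 pt (measurableC mA).
    rewrite /b; apply/andP; split; first by rewrite addr_ge0// mulr_ge0.
    by have := ler_wpM2l q2 r1; rewrite mulr1; lra.
  - near=> n.
    have mA : measurable (An n) by near: n.
    have pt : Theta R p (th n) by near: n.
    by rewrite /b /c (probC g_ell gG2 pt mA) le_eqVlt; apply/orP; left; apply/eqP; ring.
  - exact: cvg_cst.
  - have e : 2^-1 = (1 - pi0) * (1 - (2 * (1 - pi0))^-1) + pi0 by field.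
    rewrite e; apply: cvgD; last exact: cvg_cst.
    exact: (cvgM (cvg_cst (1 - pi0)) (P0C_cvg UU Uoo)).
  - apply: filterS lik_le => n h; apply: (h pi0 th0) => //; last exact: pth0.
    by have := pi0_lt; rewrite pi0_ge0 /=; lra.
  (* The weight pi = 1/2 gives c = 1/2 and b >= 1/2 whatever the parameter. *)
  - near=> n; exists (lik g (An n) (c n) (b n) (th n) x n) => th' pt' hhalf.
    exists (1 - 2^-1), ((1 - 2^-1) * prob th' (~` An n) + 2^-1); split.
    + lra.
    + have := prob_ge0 g_ell gG2 (~` An n) pt'; rewrite ge_min; set r := prob _ _ => r0.
      by apply/orP; left; lra.
    + have hl : forall (pi' : R) th', 0 <= pi' < 1 -> Theta R p th' ->
        lik g (An n) (1 - pi') ((1 - pi') * prob th' (~` An n) + pi') th' x n <=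
        lik g (An n) (c n) (b n) (th n) x n by near: n.
      by apply: hl => //; apply/andP; split; lra.
have hpi : pihat n @[n --> U] --> pi0.
  have h3 : 1 - c n @[n --> U] --> 1 - (1 - pi0) by apply: cvgB; [exact: cvg_cst|exact: h2].
  rewrite subKr in h3; apply: cvg_trans h3; apply: near_eq_cvg; near=> n; by rewrite /c subKr.
have h := cvg_pair hpi h1; exact: h.
Unshelve. all: by end_near. Qed.

Lemma MLEc_cvg (th : nat -> 'cV[R]_p * 'M[R]_p) : pi0 = 0 ->
  (\forall n \near \oo, is_MLEc g x n (An n) (th n)) ->
  th n @[n --> \oo] --> th0.
Proof.
move=> pi00 hM; apply: ultra_cvg => U UU Uoo.
pose b n := prob (th n) (~` An n).
pose b0 n := prob th0 (~` An n).
have UM := Uoo _ hM; have UmA := Uoo _ mAn.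
have n_pos : \forall n \near U, (0 < n)%N by apply: Uoo; exists 1%N.
have thT : \forall n \near U, Theta R p (th n) by apply: filterS UM => n [].
have lik_le : \forall n \near U, forall th', Theta R p th' ->
    lik g (An n) 1 (prob th' (~` An n)) th' x n <= lik g (An n) 1 (b n) (th n) x n.
  near=> n => th' pt'.
  have n0 : (0 < n)%N by near: n.
  have mA : measurable (An n) by near: n.
  have [pt hmax] : is_MLEc g x n (An n) (th n) by near: n.
  have := hmax th' pt'; rewrite !(lik_cE _ _ g_ell gG2)//.
  have v0 th2 (i : 'I_n) : Theta R p th2 ->
    0 <= (if x i \in An n then 1 * elliptical_pdf g th2 (x i) else prob th2 (~` An n)).
    move=> pt2; case: ifP => _; first by rewrite mul1r; exact: (elliptical_pdf_ge0 g_ell _ pt2).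
    exact: (prob_ge0 g_ell gG2).
  by apply: (sum_lne_le n0) => i; exact: v0.
suff [] : th n @[n --> U] --> th0 /\ (fun=> 1 : R) n @[n --> U] --> 1 - pi0 by [].
apply: (@fit_cvg R p p_gt0 g g_ell gG1 gG2 P Q pi0 th0 P_gem pi0_lt A A_mve A_unique x x_weak U
  UU Uoo An hAn
    th (fun=> 1) b (fun=> 1) b0 1) => //.
- by near=> n; rewrite ler01 lexx.
- near=> n.
  have mA : measurable (An n) by near: n.
  have pt : Theta R p (th n) by near: n.
  by rewrite (prob_ge0 g_ell gG2 _ pt) (prob_le1 g_ell gG2 pt (measurableC mA)).
- near=> n.
  have mA : measurable (An n) by near: n.
  have pt : Theta R p (th n) by near: n.
  by rewrite /b (probC g_ell gG2 pt mA) mul1r addrC subrK.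
- by rewrite pi00 subr0; exact: cvg_cst.
- have e : 2^-1 = 1 - (2 * (1 - pi0))^-1 by rewrite pi00; field.
  by rewrite e; exact: P0C_cvg.
- by apply: filterS lik_le => n; apply; exact: pth0.
- near=> n; exists (lik g (An n) 1 (b n) (th n) x n) => th' pt' hhalf.
  exists 1, (prob th' (~` An n)); split.
  + by rewrite invf_le1// ler1n.
  + by rewrite ge_min lexx orbT.
  + have hl : forall th', Theta R p th' ->
      lik g (An n) 1 (prob th' (~` An n)) th' x n <= lik g (An n) 1 (b n) (th n) x n by near: n.
    exact: hl.
Unshelve. all: by end_near. Qed.

Lemma MLEr_cvg (alpha : R) (th : nat -> 'cV[R]_p * 'M[R]_p) : 0 < alpha < 2^-1 ->
  (\forall n \near \oo, is_MLEr g x n (An n) alpha (th n)) ->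
  th n @[n --> \oo] --> th0 /\
  (prob (th n) (An n) - fine (emp_prob x n (An n))) / prob (th n) (An n) @[n --> \oo] --> pi0.
Proof.
move=> /andP[al0 al1] hM.
suff main U : UltraFilter U -> \oo `<=` U -> th n @[n --> U] --> th0 /\
    (prob (th n) (An n) - fine (emp_prob x n (An n))) / prob (th n) (An n) @[n --> U] --> pi0.
  by split; apply: ultra_cvg => U UU Uoo; have [] := main U UU Uoo.
move=> UU Uoo.
have UM := Uoo _ hM; have UmA := Uoo _ mAn.
have n_pos : \forall n \near U, (0 < n)%N by apply: Uoo; exists 1%N.
have thT : \forall n \near U, Theta R p (th n) by apply: filterS UM => n [[]].
have half : 0 < 2^-1 :> R by rewrite invr_gt0.
pose c n := 2^-1 * (prob (th n) (An n))^-1.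
pose c0 n := 2^-1 * (prob th0 (An n))^-1.
have thP : \forall n \near U, alpha <= prob (th n) (An n).
  near=> n; have mA : measurable (An n) by near: n.
  have [[pt pa] _] : is_MLEr g x n (An n) alpha (th n) by near: n.
  by move: pa; rewrite (prob_fin g_ell gG2 pt mA) lee_fin.
have lik_le : \forall n \near U, forall th', Theta R p th' -> alpha <= prob th' (An n) ->
    lik g (An n) (2^-1 * (prob th' (An n))^-1) 2^-1 th' x n <= lik g (An n) (c n) 2^-1 (th n) x n.
  near=> n => th' pt' pa'.
  have n0 : (0 < n)%N by near: n.
  have mA : measurable (An n) by near: n.
  have [[pt _] hmax] : is_MLEr g x n (An n) alpha (th n) by near: n.
  have pa : alpha <= prob (th n) (An n) by near: n.
  have pa0 := lt_le_trans al0 pa; have pa0' := lt_le_trans al0 pa'.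
  have hT : Theta_ge g (An n) alpha th' by split=> //; rewrite (prob_fin g_ell gG2 pt' mA) lee_fin.
  have := hmax th' hT; rewrite !(lik_rE _ _ g_ell gG2)//.
  have v0 th2 (i : 'I_n) : Theta R p th2 -> 0 < prob th2 (An n) ->
    0 <= (if x i \in An n then (prob th2 (An n))^-1 * elliptical_pdf g th2 (x i) else 1).
    move=> pt2 pp; case: ifP => // _; apply: mulr_ge0; first by rewrite invr_ge0 ltW.
    exact: (elliptical_pdf_ge0 g_ell _ pt2).
  move=> /(sum_lne_le n0) h; rewrite /c !lik_half ler_wpM2l ?exprn_ge0 ?(ltW half)//.
  by apply: h => i; exact: v0.
have L0 : 2 * (1 - pi0) != 0 by rewrite mulf_neq0.
have P0c := P0_cvg UU Uoo.
(* Hence the true parameter eventually satisfies the constraint defining the restricted set. *)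
have al2 : alpha < (2 * (1 - pi0))^-1.
  apply: lt_le_trans al1 _; rewrite lef_pV2 ?posrE ?mulr_gt0//.
  by rewrite -[leRHS]mulr1 ler_wpM2l//; have := pi0_ge0; lra.
have thP0 : \forall n \near U, alpha <= prob th0 (An n) by apply: (cvgr_ge _ P0c).
have c0_cvg : c0 n @[n --> U] --> 1 - pi0.
  have e : 1 - pi0 = 2^-1 * ((2 * (1 - pi0))^-1)^-1 by field.
  rewrite e; have h : (prob th0 (An n))^-1 @[n --> U] --> ((2 * (1 - pi0))^-1)^-1.
    by apply: cvgV => //; rewrite invr_eq0.
  by apply: cvgM; [exact: cvg_cst|exact: h].
have [h1 h2] : th n @[n --> U] --> th0 /\ c n @[n --> U] --> 1 - pi0.
  apply: (@fit_cvg R p p_gt0 g g_ell gG1 gG2 P Q pi0 th0 P_gem pi0_lt A A_mve A_unique x x_weak U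
    UU Uoo An hAn
    th c (fun=> 2^-1) c0 (fun=> 2^-1) (2^-1 * alpha^-1)) => //.
  - near=> n; have pa : alpha <= prob (th n) (An n) by near: n.
    have pa0 := lt_le_trans al0 pa.
    rewrite mulr_ge0 ?invr_ge0 ?(ltW pa0)//= ler_wpM2l ?(ltW half)//.
    by rewrite lef_pV2 ?posrE.
  - near=> n; rewrite (ltW half) /=; by rewrite invf_le1// ler1n.
  - near=> n; have pa : alpha <= prob (th n) (An n) by near: n.
    have pa0 := lt_le_trans al0 pa.
    rewrite /c -mulrA mulVf ?gt_eqF// mulr1; lra.
  - exact: cvg_cst.
  - near=> n; have hl : forall th', Theta R p th' -> alpha <= prob th' (An n) ->
      lik g (An n) (2^-1 * (prob th' (An n))^-1) 2^-1 th' x n <=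
        lik g (An n) (c n) 2^-1 (th n) x n by near: n.
    by apply: hl; [exact: pth0|near: n].
  (* As alpha < 1/2, every parameter giving mass at least 1/2 to [An n] is admissible, and c = 1 /
     (2 P_theta(A_n)) >= 1/2 for it. *)
  - near=> n; exists (lik g (An n) (c n) 2^-1 (th n) x n) => th' pt' hhalf.
    have mA : measurable (An n) by near: n.
    exists (2^-1 * (prob th' (An n))^-1), 2^-1; split.
    + rewrite -[leLHS]mulr1 ler_wpM2l ?(ltW half)//.
      rewrite invf_ge1 ?(prob_le1 g_ell gG2 pt' mA)//.
      exact: lt_le_trans half hhalf.
    + by rewrite ge_min lexx.
    + have hl : forall th', Theta R p th' -> alpha <= prob th' (An n) ->
        lik g (An n) (2^-1 * (prob th' (An n))^-1) 2^-1 th' x n <=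
          lik g (An n) (c n) 2^-1 (th n) x n by near: n.
      by apply: hl => //; apply: le_trans (ltW al1) hhalf.
split=> //.
have PnA := Pn_emp_mve_cvg p_gt0 g_ell gG2 P_gem pi0_lt A_mve A_unique x_weak UU Uoo hAn.
(* Since c n = 1 / (2 P_theta(A_n)), the estimator of pi0 equals 1 - 2 P_n(A_n) c n. *)
have e : pi0 = 1 - 2 * (2^-1 * (1 - pi0)) by field.
rewrite [X in _ --> X]e.
have h : 1 - 2 * (Pn x n (An n) * c n) @[n --> U] --> 1 - 2 * (2^-1 * (1 - pi0)).
  by apply: cvgB; [exact: cvg_cst|apply: cvgM; [exact: cvg_cst|exact: cvgM]].
apply: cvg_trans h; apply: near_eq_cvg; near=> n.
have pa : alpha <= prob (th n) (An n) by near: n.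
have pa0 : prob (th n) (An n) != 0 by rewrite gt_eqF// (lt_le_trans al0 pa).
by rewrite /c emp_probE /=; field.
Unshelve. all: by end_near. Qed.

End paths.

Theorem theorem3p2 (R : realType) (p : nat) (p_gt0 : (0 < p)%N)
    (g : R -> R) (g_ell : elliptical_generator p g)
    (gG1 : condG1 g) (gG2 : condG2 g) (gGp : condGp p g)
    (P Q : probability 'cV[R]_p R) (pi0 : R) (th0 : 'cV[R]_p * 'M[R]_p)
    (P_gem : gross_error_model g P pi0 th0 Q) (pi0_lt : pi0 < 2^-1)
    (d : measure_display) (T : measurableType d) (Pr : probability T R)
    (X : nat -> {RV Pr >-> 'cV[R]_p}) (X_sample : random_sample P X)
    (A : set 'cV[R]_p) (A_mve : is_mve P A)
    (A_unique : forall B, is_mve P B -> B = A)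
    (A_ : nat -> T -> set 'cV[R]_p)
    (A_emp : {ae Pr, forall w, \forall n \near \oo,
       is_mve (emp_prob (X^~ w) n) (A_ n w)}) :
  [/\ forall (pihat : nat -> T -> R) (th : nat -> T -> 'cV[R]_p * 'M[R]_p),
        {ae Pr, forall w, \forall n \near \oo,
          is_MLEs g (X^~ w) n (A_ n w) (pihat n w) (th n w)} ->
        {ae Pr, forall w,
          (pihat n w, th n w) @[n --> \oo] --> (pi0, th0)},
      pi0 = 0 ->
      forall th : nat -> T -> 'cV[R]_p * 'M[R]_p,
        {ae Pr, forall w, \forall n \near \oo,
          is_MLEc g (X^~ w) n (A_ n w) (th n w)} ->
        {ae Pr, forall w, th n w @[n --> \oo] --> th0} &
      forall (alpha : R) (th : nat -> T -> 'cV[R]_p * 'M[R]_p),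
        0 < alpha < 2^-1 ->
        {ae Pr, forall w, \forall n \near \oo,
          is_MLEr g (X^~ w) n (A_ n w) alpha (th n w)} ->
        {ae Pr, forall w, th n w @[n --> \oo] --> th0} /\
        {ae Pr, forall w,
          let PA n := fine (elliptical_prob g (th n w) (A_ n w)) in
          let PnA n := fine (emp_prob (X^~ w) n (A_ n w)) in
          (PA n - PnA n) / PA n @[n --> \oo] --> pi0}].
Proof.
have weak := ae_weak_limsup X_sample.
split=> [pihat th hM|pi00 th hM|alpha th hal hM].
- apply: filterS3 weak A_emp hM => w xw hA;
  exact: (MLEs_cvg p_gt0 g_ell gG1 gG2 P_gem pi0_lt A_mve A_unique xw hA).
- apply: filterS3 weak A_emp hM => w xw hA;
  exact: (MLEc_cvg p_gt0 g_ell gG1 gG2 P_gem pi0_lt A_mve A_unique xw hA).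
- split; apply: filterS3 weak A_emp hM => w xw hA hw.
    by have [] := MLEr_cvg p_gt0 g_ell gG1 gG2 P_gem pi0_lt A_mve A_unique xw hA hal hw.
  by have [] := MLEr_cvg p_gt0 g_ell gG1 gG2 P_gem pi0_lt A_mve A_unique xw hA hal hw.
Qed.
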